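(* The paracategory $\underline{\mathbf I}$ of $\mathbf I$-digraphs, where $\mathbf I$ is the category of paths with root-preserving monotone morphisms, has weak m-amalgamation. In particular, the group $\mathrm{Homeo}_+([0,1])$ of increasing homeomorphisms of $[0,1]$ has a comeager conjugacy class.
   Context: **Relations.** For $R\subseteq A\times B$ and $S\subseteq B\times C$, $R\circ S=\{(a,c):\exists b\,(aRb \text{ and } bSc)\}$; $A$ is regarded as the co-domain and $B$ as the domain of $R$. For $C\subseteq A$, $C^R=\{b\in B:\exists a\in C\ aRb\}$. A mirrored symbol denotes the inverse relation. $R$ is co-surjective if for every $b\in B$ there is $a\in A$ with $aRb$; $R$ is co-injective if for every $a\in A$ there is $b\in B$ with $aRb$ and such that $a'Rb$ implies $a'=a$; $R$ is co-bijective if it is both. $\pi_R$ is the partial function from $B$ to $A$ with $\pi_R(b)=a$ iff $a$ is the unique element with $aRb$. **Graphs.** $\mathbf{Gr}$ is the category of finite reflexive graphs $(K,\sqcap)$; a morphism from $L$ to $K$ is a co-bijective relation $\sqsupset\subseteq K\times L$ that is edge-preserving ($a_0\sqsupset b_0$, $a_1\sqsupset b_1$, $b_0\sqcap b_1$ imply $a_0\sqcap a_1$); composition is composition of relations. $\mathbf K^A_B$ is the class of morphisms from $B$ to $A$. A paracategory is like a category, except that compositions of composable morphisms need not be morphisms of it. **Paths.** A path is a finite acyclic connected reflexive graph all of whose vertices have degree at most $2$ (loops not counted), equipped with one of the linear orders $\le$ compatible with the graph (immediate successors are neighbours); its smallest element is denoted $\mathbf 0$. A relation $\sqsupset\subseteq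 K\times L$ is monotone if $C^{\sqsupset}$ is connected (as an induced subgraph) whenever $C\subseteq K$ is connected. $\mathbf I$ is the category whose objects are all paths and whose morphisms are the monotone $\sqsupset\in\mathrm{mor}(\mathbf{Gr})$ with $\pi_{\sqsupset}(\mathbf 0)=\mathbf 0$. **Digraphs.** $\mathbf I$ is a Fraïssé category (closed under isomorphism, countable up to isomorphism, directed, and with amalgamation). Fix a Fraïssé sequence $(K_n,\succeq_n)$ in $\mathbf I$: $\succeq_n\in\mathbf I^{K_n}_{K_{n+1}}$ and, with $\succeq^m_m=\mathrm{Id}$ and $\succeq^m_n$ ($m<n$) the composition of the $\succeq_i$ from $K_n$ to $K_m$, every object of $\mathbf I$ admits a morphism from some $K_n$, and for every $m$ and $S\in\mathbf I^{K_m}_C$ there are $n\ge m$ and $T\in\mathbf I^C_{K_n}$ with $S\circ T=\succeq^m_n$. The objects of $\underline{\mathbf I}$ ($\mathbf I$-digraphs) are all triples $(K_m,\sqcap,\leftarrow)$ with $\leftarrow\,=\,\sqsupset\circ\preceq^m_n\subseteq K_m\times K_m$ for some $n\ge m$ and $\sqsupset\in\mathbf I^{K_m}_{K_n}$. A morphism from an object on $K_n$ with arrow relation $\twoheadleftarrow$ to one on $K_m$ with arrow relation $\leftarrow$ is a $\sqsupset\in\mathbf I^{K_m}_{K_n}$ that is weakly arrow-preserving: whenever $b_0\twoheadleftarrow b_1$ there are $a_0\sqsupset b_0$, $a_1\sqsupset b_1$ with $a_0\leftarrow a_1$. The underlying set of an object $A$ is $K_A$. **Weak m-amalgamation** of $\underline{\mathbf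 I}$: for every object $A$ there are an object $B$ and a morphism $R$ from $B$ to $A$ such that for all objects $C_0,C_1$ and morphisms $S_i$ from $C_i$ to $B$ ($i=0,1$) there are an object $D$ and morphisms $T_i$ from $D$ to $C_i$ such that $(R\circ S_0\circ T_0)\cap(R\circ S_1\circ T_1)\subseteq K_A\times K_D$ is co-surjective. $\mathrm{Homeo}_+([0,1])$ is the group of homeomorphisms $f$ of $[0,1]$ with $f(0)=0$, with the supremum metric; conjugacy classes are taken in this group. *)

(* Defs.v *)
From HB Require Import structures.
From mathcomp Require Import all_boot all_order all_algebra.
From mathcomp Require Import all_classical all_reals.
From mathcomp Require Import topology.
Import Order.TTheory GRing.Theory Num.Theory.
Import numFieldTopology.Exports.

Set Implicit Arguments.
Unset Strict Implicit.
Unset Printing Implicit Defensive.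

(* A relation R : {set A * B} has co-domain A and domain B: it goes from B to
   A, and [rcomp R S] is S followed by R. *)

Section Relations.
Context {A B C : finType}.
Implicit Types (R : {set A * B}) (S : {set B * C}) (X : {set A}).

Definition rcomp R S : {set A * C} :=
  [set p | [exists b, ((p.1, b) \in R) && ((b, p.2) \in S)]]%SET.

Definition rinv R : {set B * A} := [set p | (p.2, p.1) \in R]%SET.

Definition rimage X R : {set B} :=
  [set b | [exists a, (a \in X) && ((a, b) \in R)]]%SET.

Definition co_surjective R := forall b, exists a, (a, b) \in R.

Definition co_injective R :=
  forall a, exists b, (a, b) \in R /\ forall a', (a', b) \in R -> a' = a.

Definition co_bijective R := co_surjective R /\ co_injective R.

Definition rpi R (b : B) : option A :=
  [pick a | [forall a', ((a', b) \in R) == (a' == a)]].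

End Relations.

Definition rid (A : finType) : {set A * A} := [set p | p.1 == p.2]%SET.

Record graph := Graph {
  vertex :> finType;
  adj : rel vertex;
  adj_refl : reflexive adj;
  adj_sym : symmetric adj }.
Arguments adj {g} _ _.

Definition edge_preserving (K L : graph) (R : {set K * L}) :=
  forall a0 a1 b0 b1, (a0, b0) \in R -> (a1, b1) \in R ->
    adj b0 b1 -> adj a0 a1.

Definition gr_mor (K L : graph) (R : {set K * L}) :=
  co_bijective R /\ edge_preserving R.

(* Connectedness as an induced subgraph; the empty set counts as connected. *)
Definition connected_set (K : graph) (X : {set K}) :=
  {in X &, forall x y,
    connect (fun a b => [&& a \in X, b \in X & adj a b]) x y}.

Definition acyclic (K : graph) :=
  forall c : seq K, 2 < size c -> ~~ ucycleb adj c.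

Definition monotone_rel (K L : graph) (R : {set K * L}) :=
  forall X : {set K}, connected_set X -> connected_set (rimage X R).

Definition linear_order (T : finType) (le : rel T) :=
  [/\ reflexive le, antisymmetric le, transitive le & total le].

Definition immediate_succ (T : finType) (le : rel T) (x y : T) :=
  [/\ le x y, x != y & forall z, le x z -> le z y -> z = x \/ z = y].

(* The field [root], the smallest element, makes paths nonempty. *)
Record rpath := RPath {
  rpath_graph :> graph;
  rpath_connected : connected_set [set: rpath_graph]%SET;
  rpath_acyclic : acyclic rpath_graph;
  rpath_degree : forall x : rpath_graph,
    #|[set y : rpath_graph | adj x y & y != x]%SET| <= 2;
  rpath_le : rel rpath_graph;
  rpath_le_linear : linear_order rpath_le;
  rpath_le_compat : forall x y, immediate_succ rpath_le x y -> adj x y;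
  root : rpath_graph;
  root_min : forall x, rpath_le root x }.
Arguments root : clear implicits.

(* [I_mor R], for R : {set K * L}, says that R is a morphism from L to K. *)
Definition I_mor (K L : rpath) (R : {set K * L}) :=
  [/\ gr_mor R, monotone_rel R & rpi R (root L) = Some (root K)].

(* [bonds bond m k] is the composite bonding morphism from K_(k + m) to K_m;
   indexing by k = n - m avoids casts, [K (k.+1 + m)] and [K (k + m).+1]
   being convertible. *)
Fixpoint bonds (K : nat -> rpath) (bond : forall n, {set K n * K n.+1})
    (m k : nat) : {set K m * K (k + m)} :=
  match k return {set K m * K (k + m)} with
  | 0 => rid (K m)
  | k'.+1 => @rcomp (K m) (K (k' + m)) (K (k' + m).+1)
               (bonds bond m k') (bond (k' + m))
  end.

Record fraisse_sequence := FraisseSequence {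
  fobj :> nat -> rpath;
  fbond : forall n, {set fobj n * fobj n.+1};
  fbond_mor : forall n, I_mor (fbond n);
  fraisse_cofinal : forall P : rpath,
    exists n (R : {set P * fobj n}), I_mor R;
  fraisse_absorb : forall m (P : rpath) (S : {set fobj m * P}), I_mor S ->
    exists k (T : {set P * fobj (k + m)}),
      I_mor T /\ rcomp S T = bonds fbond m k }.

(* A paracategory whose morphisms are relations between finite sets: [rcomp]
   of two morphisms is not required to be a morphism. *)
Record rel_paracategory := RelParacategory {
  pobj :> Type;
  pcarrier : pobj -> finType;
  pmor : forall A B : pobj, {set pcarrier A * pcarrier B} -> Prop;
  pmor_id : forall A : pobj, pmor (rid (pcarrier A)) }.

Definition weak_m_amalgamation (P : rel_paracategory) :=
  forall A : P, exists (B : P) (R : {set pcarrier A * pcarrier B}),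
    pmor R /\
    forall (C0 C1 : P) (S0 : {set pcarrier B * pcarrier C0})
      (S1 : {set pcarrier B * pcarrier C1}),
      pmor S0 -> pmor S1 ->
      exists (D : P) (T0 : {set pcarrier C0 * pcarrier D})
        (T1 : {set pcarrier C1 * pcarrier D}),
        [/\ pmor T0, pmor T1 &
            co_surjective ((rcomp (rcomp R S0) T0)
                             :&: (rcomp (rcomp R S1) T1))%SET].

Record digraph (F : fraisse_sequence) := Digraph {
  level : nat;
  arrow : {set F level * F level};
  arrowP : exists k (S : {set F level * F (k + level)}),
    I_mor S /\ arrow = rcomp S (rinv (bonds (@fbond F) level k)) }.

Definition weakly_arrow_preserving (K L : finType) (E : {set K * K})
    (E' : {set L * L}) (R : {set K * L}) :=
  forall b0 b1, (b0, b1) \in E' ->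
    exists a0 a1, [/\ (a0, b0) \in R, (a1, b1) \in R & (a0, a1) \in E].

Definition digraph_mor (F : fraisse_sequence) (A B : digraph F)
    (R : {set F (level A) * F (level B)}) :=
  I_mor R /\ weakly_arrow_preserving (arrow A) (arrow B) R.

Lemma rimage_id (A : finType) (X : {set A}) : rimage X (rid A) = X.
Proof.
apply/setP => b; rewrite inE; apply/existsP/idP => [[a]|Xb].
  by rewrite inE /= => /andP[Xa /eqP <-].
by exists b; rewrite inE Xb /=.
Qed.

Lemma I_mor_id (K : rpath) : I_mor (rid K).
Proof.
split.
- split; first split.
  + by move=> b; exists b; rewrite inE /=.
  + by move=> a; exists a; split=> [|a']; rewrite inE //= => /eqP.
  + by move=> a0 a1 b0 b1; rewrite !inE /= => /eqP-> /eqP->.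
- by move=> X; rewrite rimage_id.
- rewrite /rpi; case: pickP => [a /forallP/(_ (root K))|/(_ (root K))].
    by rewrite inE /= eqxx => /eqP/esym/eqP ->.
  by move=> /forallP[]; move=> a; rewrite inE /=.
Qed.

Lemma digraph_mor_id (F : fraisse_sequence) (A : digraph F) :
  digraph_mor (A := A) (B := A) (rid (F (level A))).
Proof.
split; first exact: I_mor_id.
by move=> b0 b1 b01; exists b0, b1; rewrite !inE /=; split.
Qed.

Definition I_digraphs (F : fraisse_sequence) : rel_paracategory :=
  @RelParacategory (digraph F) (fun A => F (level A)) (@digraph_mor F)
    (@digraph_mor_id F).

Local Open Scope classical_set_scope.
Local Open Scope ring_scope.

Notation unit_interval R := (set_type `[0%R : R, 1%R]%classic).

Lemma unit_interval0_subproof (R : realType) :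
  (0 : R) \in (`[0, 1]%classic : set R).
Proof. by rewrite inE /= in_itv /= lexx ler01. Qed.

Definition unit_interval0 (R : realType) : unit_interval R :=
  exist _ 0 (unit_interval0_subproof R).

(* A homeomorphism of [0,1] is increasing exactly when it fixes 0. *)
Record homeo01 (R : realType) := Homeo01 {
  homeo_fun :> unit_interval R -> unit_interval R;
  homeo_continuous : continuous homeo_fun;
  homeo_inverse : exists g : unit_interval R -> unit_interval R,
    [/\ continuous g, cancel homeo_fun g & cancel g homeo_fun];
  homeo0 : homeo_fun (unit_interval0 R) = unit_interval0 R }.

HB.instance Definition _ (R : realType) := gen_eqMixin (homeo01 R).
HB.instance Definition _ (R : realType) := gen_choiceMixin (homeo01 R).

Section HomeoGroup.
Context {R : realType}.
Implicit Types f g h : homeo01 R.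

Lemma homeo_eqP f g : f =1 g -> f = g.
Proof.
case: f g => [f cf [f' Hf] f0] [g cg [g' Hg] g0] /= /funext fg; subst g.
by congr Homeo01; exact: Prop_irrelevance.
Qed.

Lemma homeo_id_subproof : exists g : unit_interval R -> unit_interval R,
  [/\ continuous g, cancel id g & cancel g id].
Proof. by exists id; split=> // x; exact: cvg_id. Qed.

Definition homeo_id : homeo01 R :=
  Homeo01 (fun x => @cvg_id _ (nbhs x)) homeo_id_subproof erefl.

Lemma homeo_comp_continuous f g : continuous (f \o g).
Proof.
by move=> x; apply: (@continuous_comp _ _ _ g f); exact: homeo_continuous.
Qed.

Lemma homeo_comp_inverse f g :
  exists h : unit_interval R -> unit_interval R,
    [/\ continuous h, cancel (f \o g) h & cancel h (f \o g)].
Proof.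
have [f' [cf' fK f'K]] := homeo_inverse f.
have [g' [cg' gK g'K]] := homeo_inverse g.
exists (g' \o f'); split.
- by move=> x; apply: (@continuous_comp _ _ _ f' g'); [exact: cf'|exact: cg'].
- exact: can_comp.
- exact: can_comp.
Qed.

Lemma homeo_comp0 f g : (f \o g) (unit_interval0 R) = unit_interval0 R.
Proof. by rewrite /= !homeo0. Qed.

Definition homeo_comp f g : homeo01 R :=
  Homeo01 (@homeo_comp_continuous f g) (homeo_comp_inverse f g)
    (homeo_comp0 f g).

Definition homeo_inv_fun f : unit_interval R -> unit_interval R :=
  sval (cid (homeo_inverse f)).

Lemma homeo_inv_continuous f : continuous (homeo_inv_fun f).
Proof. by rewrite /homeo_inv_fun; case: cid => g []. Qed.

Lemma homeoK f : cancel f (homeo_inv_fun f).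
Proof. by rewrite /homeo_inv_fun; case: cid => g []. Qed.

Lemma homeoVK f : cancel (homeo_inv_fun f) f.
Proof. by rewrite /homeo_inv_fun; case: cid => g []. Qed.

Lemma homeo_inv_inverse f : exists g : unit_interval R -> unit_interval R,
  [/\ continuous g, cancel (homeo_inv_fun f) g & cancel g (homeo_inv_fun f)].
Proof.
exists f; split; [exact: homeo_continuous|exact: homeoVK|exact: homeoK].
Qed.

Lemma homeo_inv0 f : homeo_inv_fun f (unit_interval0 R) = unit_interval0 R.
Proof. by rewrite -{1}(homeo0 f) homeoK. Qed.

Definition homeo_inv f : homeo01 R :=
  Homeo01 (@homeo_inv_continuous f) (homeo_inv_inverse f) (homeo_inv0 f).

Lemma homeo_compA : associative homeo_comp.
Proof. by move=> f g h; exact: homeo_eqP. Qed.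

Lemma homeo_comp1f : left_id homeo_id homeo_comp.
Proof. by move=> f; exact: homeo_eqP. Qed.

Lemma homeo_compf1 : right_id homeo_id homeo_comp.
Proof. by move=> f; exact: homeo_eqP. Qed.

Lemma homeo_compVf : left_inverse homeo_id homeo_inv homeo_comp.
Proof. by move=> f; apply: homeo_eqP => x /=; rewrite homeoK. Qed.

Lemma homeo_compfV : right_inverse homeo_id homeo_inv homeo_comp.
Proof. by move=> f; apply: homeo_eqP => x /=; rewrite homeoVK. Qed.

Definition homeo_distances f g : set R :=
  [set `|\val (f x) - \val (g x)| | x in [set: unit_interval R]].

Definition homeo_dist f g : R := sup (homeo_distances f g).

Lemma homeo_distances_neq0 f g : homeo_distances f g !=set0.
Proof. by eexists; exists (unit_interval0 R). Qed.

Lemma unit_interval_itv (x : unit_interval R) : 0 <= \val x <= 1.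
Proof. by have /set_mem /= := valP x; rewrite in_itv. Qed.

Lemma homeo_distances_ub f g : has_ubound (homeo_distances f g).
Proof.
exists 1 => _ [x _ <-]; rewrite ler_norml.
have /andP[f0 f1] := unit_interval_itv (f x).
have /andP[g0 g1] := unit_interval_itv (g x).
rewrite lerBlDr (le_trans f1) ?lerDl // andbT.
by rewrite lerBrDr (le_trans _ f0) // addrC subr_le0.
Qed.

Lemma homeo_dist_ub f g x : `|\val (f x) - \val (g x)| <= homeo_dist f g.
Proof. by apply: (ub_le_sup (homeo_distances_ub f g)); exists x. Qed.

Lemma homeo_dist_le f g (e : R) :
  (forall x, `|\val (f x) - \val (g x)| <= e) -> homeo_dist f g <= e.
Proof.
by move=> fge; apply: ge_sup (homeo_distances_neq0 f g) _ => _ [x _ <-].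
Qed.

Lemma homeo_distxx f : homeo_dist f f = 0.
Proof.
apply/eqP; rewrite eq_le homeo_dist_le => [|x]; last by rewrite subrr normr0.
exact: le_trans (normr_ge0 _) (homeo_dist_ub f f (unit_interval0 R)).
Qed.

Lemma homeo_dist_eq0 f g : homeo_dist f g = 0 -> f = g.
Proof.
move=> fg0; apply: homeo_eqP => x; apply: val_inj; apply/eqP.
by rewrite -subr_eq0 -normr_le0 -[leRHS]fg0 homeo_dist_ub.
Qed.

Lemma homeo_distC f g : homeo_dist f g = homeo_dist g f.
Proof.
by apply/eqP; rewrite eq_le; apply/andP; split; apply: homeo_dist_le => x;
  rewrite distrC homeo_dist_ub.
Qed.

Lemma homeo_dist_triangle g f h :
  homeo_dist f h <= homeo_dist f g + homeo_dist g h.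
Proof.
apply: homeo_dist_le => x; apply: le_trans (ler_distD (\val (g x)) _ _) _.
by apply: lerD; exact: homeo_dist_ub.
Qed.

End HomeoGroup.

HB.instance Definition _ (R : realType) :=
  isGroup.Build (homeo01 R) homeo_compA homeo_comp1f homeo_compf1
    homeo_compVf homeo_compfV.

HB.instance Definition _ (R : realType) :=
  isMetric.Build R (homeo01 R) homeo_distxx homeo_dist_eq0 homeo_distC
    homeo_dist_triangle.

Definition conjugacy_class (G : groupType) (f : G) : set G :=
  [set (f ^ h)%g | h in [set: G]].

Definition comeager (T : topologicalType) (A : set T) :=
  exists U : nat -> set T,
    (forall n, open (U n) /\ dense (U n)) /\ \bigcap_n U n `<=` A.

(* Main.v *)
(* A digraph over a path records, up to small overlaps, how an increasing
   homeomorphism f of [0,1] permutes finitely many points. Its points split into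
   runs on which f moves points in one direction, and each run can be realized by
   a translation of an interval. Given a digraph A, realize it in this way and let
   B be a fine subdivision in which, along each run, f maps each window W_z well
   inside W_(z+p). In any two refinements of B one finds orbits that follow the
   windows; matching these orbits, both refinements embed in one model whose
   blocks are moved alternately up and down by a translation, and between two
   consecutive matched points nothing can be separated by A.

   For homeomorphisms, the generic ones are those for which f - id changes sign
   at least three times in every rational interval on which f - id is not bounded
   away from 0. A back-and-forth between orbitals, followed by affine
   identifications of fundamental domains, shows that any two of them are
   conjugate. *)

Require Import Defs.
From HB Require Import structures.
From mathcomp Require Import all_boot all_order all_algebra.
From mathcomp Require Import all_classical all_reals topology.
From mathcomp Require Import normedtype realfun zify lra.
Import Order.TTheory GRing.Theory Num.Theory.
Import numFieldTopology.Exports numFieldNormedType.Exports.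

Set Implicit Arguments.
Unset Strict Implicit.
Unset Printing Implicit Defensive.

(** A morphism of digraphs controls arrows only up to incident vertices and edges, so following an
    orbit through a refinement could lose half a cell at every step. In the model for [B] a whole
    window is mapped into one cell in the middle of another window, hence the loss never
    accumulates. Two refinements may still have different runs and incompatible units of
    translation. Only the runs over the blocks of [B] have to match, because every bounded cell of
    [A] contains a window; the units are equalized by scaling, and spare blocks absorb all other
    runs. On the digraph side both the vertices and the edges of a path are cells, which doubles its
    height. Codes that differ by at most one share a vertex, and such a common vertex is all that
    m-amalgamation asks for. The statement on homeomorphisms is proved directly and not deduced from
    the amalgamation. Three sign changes are required there so that every gap of the back-and-forth
    contains a point moved up and a point moved down, each flanked by points moved the other way. *)

(** * Patterns: finitely many points and their images *)

(* [l j v] stands for "t_j <= f(t_v)", where t_1 < ... < t_c are cut points of a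
   line and f is an increasing bijection; t_0 = -oo and t_(c+1) = +oo. The cells
   0..c are the intervals [t_i, t_(i+1)]. *)
Definition pattern (c : nat) (l : rel nat) :=
  [/\ (forall j j' v v', j <= j' -> v <= v' -> l j' v -> l j v'),
      (forall v, 0 < v -> l 0 v), (forall j, j <= c -> l j c.+1),
      (forall j, 0 < j -> ~~ l j 0) & (forall v, v <= c -> ~~ l c.+1 v)].

(* The graph of f meets the product of the cells x' (values) and x (arguments). *)
Definition cell (l : rel nat) (x' x : nat) := ~~ l x'.+1 x && l x' x.+1.

(* The pattern of the inverse of f. *)
Definition flip (l : rel nat) : rel nat := fun j v => ~~ l v j.

Lemma pattern_flip c l : pattern c l -> pattern c (flip l).
Proof.
case=> mono l0 lc nl0 nlc; split.
- by move=> j j' v v' jj' vv'; apply: contra; apply: mono.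
- by move=> v; apply: nl0.
- by move=> j; apply: nlc.
- by move=> j j0; rewrite negbK l0.
- by move=> v vc; rewrite negbK lc.
Qed.

Lemma cell_flip l x' x : cell (flip l) x' x = cell l x x'.
Proof. by rewrite /cell /flip negbK andbC. Qed.

(** Maps of this kind send each cell of a subdivision to the coarser cell that contains it; no
    coarse cell is skipped. *)
Definition ustep (d c : nat) (X : nat -> nat) :=
  [/\ X 0 = 0, X d = c & forall x, x < d -> X x <= X x.+1 <= (X x).+1].

Lemma ustep_mono d c X : ustep d c X -> forall x y, x <= y -> y <= d -> X x <= X y.
Proof.
case=> _ _ step x y; elim: y => [|y IH] xy yd; first by have -> : x = 0 by lia.
have [->//|] := eqVneq x y.+1; have := step y; lia.
Qed.

Lemma ustep_le d c X x : ustep d c X -> x <= d -> X x <= c.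
Proof. by move=> u xd; case: (u) => _ <- _; apply: (ustep_mono u). Qed.

Lemma ustep_surj d c X y : ustep d c X -> y <= c -> exists2 x, x <= d & X x = y.
Proof.
case=> X0 Xd step; rewrite -Xd => {Xd}; elim: d step => [|d IH] step yX.
  by exists 0; lia.
have [ysmall|] := leqP y (X d); last first.
  by exists d.+1 => //; have := step d; lia.
by have [x xd <-] := IH (fun x xd => step x (ltnW xd)) ysmall; exists x; lia.
Qed.

(** For a downward closed [P] this is the last index in 1..c that satisfies [P], or 0 if there is
    none. *)
Definition upto_count (c : nat) (P : pred nat) := count P (iota 1 c).

Lemma upto_count_le c P : upto_count c P <= c.
Proof. by rewrite -[leqRHS](size_iota 1) count_size. Qed.

Lemma upto_countS c P : upto_count c.+1 P = upto_count c P + P c.+1.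
Proof. by rewrite /upto_count -[X in iota 1 X]addn1 iotaD count_cat /= add1n addn0. Qed.

Lemma upto_countP c (P : pred nat) j : (forall i j, 0 < i -> i <= j -> j <= c -> P j -> P i) ->
  0 < j -> j <= c -> P j = (j <= upto_count c P).
Proof.
elim: c j => [|c IH] j prev_cell j0 jc; first by lia.
rewrite upto_countS; have le := upto_count_le c P.
have IH' i : 0 < i -> i <= c -> P i = (i <= upto_count c P).
  by apply: IH => i' j' *; apply: (prev_cell i' j') => //; lia.
have [->|jne] := eqVneq j c.+1.
  case Pc: (P c.+1) => /=; last by lia.
  have [c0|c0] := posnP c; first by rewrite c0 /=; lia.
  have : P c by apply: prev_cell Pc.
  by rewrite IH' //; lia.
rewrite IH'; [|lia|lia].
case Pc: (P c.+1) => /=; last by rewrite addn0.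
have : P j by apply: prev_cell Pc; lia.
by rewrite IH' //; lia.
Qed.

(** The fine cuts [t 1 < ... < t c] serve as the coarse ones, and [X x] is the coarse cell around
    the fine cell [x]. A graph that meets a product of cells meets every larger product. Both
    [spiral_over] and [ambient_restrict] are instances. *)
Lemma restrict_pattern d lD c l t : pattern d lD -> pattern c l ->
  (forall j, 0 < j -> j <= c -> 0 < t j <= d) ->
  (forall i j, 0 < i -> i < j -> j <= c -> t i < t j) ->
  (forall j v, 0 < j -> j <= c -> 0 < v -> v <= c -> l j v = lD (t j) (t v)) ->
  let X := fun x => upto_count c (fun j => t j <= x) in
  [/\ ustep d c X,
      (forall x' x, x' <= d -> x <= d -> cell lD x' x -> cell l (X x') (X x)) &
      forall j x, 0 < j -> j <= c -> (t j <= x) = (j <= X x)].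
Proof.
move=> [mD _ _ _ _] [_ l0 lc nl0 nlc] tr ti lt X.
have XP j x : 0 < j -> j <= c -> (t j <= x) = (j <= X x).
  move=> j0 jc; rewrite /X -(@upto_countP c (fun j => t j <= x)) // => i k i0 ik kc.
  by have [->//|] := eqVneq i k; have := ti i k; lia.
have Xc x : X x <= c by apply: upto_count_le.
have X1 x : X x < c -> x < t (X x).+1.
  by move=> xc; rewrite ltnNge XP //; lia.
have X2 x : 0 < X x -> t (X x) <= x by move=> x0; rewrite XP //.
split=> //.
- split.
  + apply/eqP; rewrite -leqn0 leqNgt; apply/negP => p0.
    by have := X2 0 p0; have := tr (X 0); have := Xc 0; lia.
  + have := Xc d; rewrite leq_eqVlt => /predU1P[//|lt1].
    by have := X1 d lt1; have := tr (X d).+1; lia.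
  + move=> x xd; apply/andP; split.
      have [->//|p] := posnP (X x).
      by rewrite -XP // ltnW // ltnS X2.
    have [//|lt2] := leqP (X x.+1) (X x).+1.
    have lt3 : X x < c by have := Xc x.+1; lia.
    have := X1 _ lt3; have := ti (X x).+1 (X x.+1); have := X2 x.+1.
    by have := Xc x.+1; lia.
- move=> x' x x'd xd /andP[n1 p1]; apply/andP; split.
  + have := Xc x'; rewrite leq_eqVlt => /predU1P[->|lt1]; first exact: nlc.
    have [->|p] := posnP (X x); first exact: nl0.
    rewrite lt //; apply: contra n1; apply: mD; [exact: X1|exact: X2].
  + have [->|p] := posnP (X x'); first exact: l0.
    have := Xc x; rewrite leq_eqVlt => /predU1P[->|lt1]; first exact: lc.
    rewrite lt //; apply: mD p1; [exact: X2|exact: X1].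
Qed.

(** The ceiling of j / H: cuts are numbered from 1, so block B consists of the cuts (B - 1)H + 1,
    ..., BH, and block 0 only of the cut 0 at -oo. *)
Definition block_of H j := (j + H.-1) %/ H.

(* Consecutive blocks of length H are f-invariant; f moves points up, as
   prescribed by [loc], in odd blocks, and the inverse of f does in even blocks. *)
Definition glue H (loc : rel nat) : rel nat := fun j v =>
  (block_of H j < block_of H v) ||
  ((block_of H j == block_of H v) && (if odd (block_of H j) then loc j v else ~~ loc v j)).

Lemma block_of_mono H j v : j <= v -> block_of H j <= block_of H v.
Proof. by move=> jv; apply: leq_div2r; rewrite leq_add2r. Qed.

Lemma block_ofE H B j : 0 < j -> j <= H -> block_of H (B * H + j) = B.+1.
Proof.
move=> j0 jH; rewrite /block_of -addnA divnMDl; last by lia.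
suff -> : (j + H.-1) %/ H = 1 by rewrite addn1.
have -> : j + H.-1 = 1 * H + j.-1 by lia.
by rewrite divnMDl ?divn_small; lia.
Qed.

Lemma block_of0 H : 0 < H -> block_of H 0 = 0.
Proof. by move=> H0; rewrite /block_of divn_small //; lia. Qed.

Lemma block_of_gt0 H j : 0 < H -> 0 < j -> 0 < block_of H j.
Proof. by move=> H0 j0; rewrite divn_gt0 //; lia. Qed.

Lemma block_of_le H N j : 0 < H -> j <= N * H -> block_of H j <= N.
Proof.
move=> H0 jN; rewrite -ltnS ltn_divLR //; nia.
Qed.

Lemma glue_pattern H N (loc : rel nat) : 0 < H ->
  (forall j j' v v', j <= j' -> v <= v' -> loc j' v -> loc j v') ->
  pattern (N * H) (glue H loc).
Proof.
move=> H0 mono; split.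
- move=> j j' v v' jj' vv'; rewrite /glue.
  have b1 := block_of_mono H jj'; have b2 := block_of_mono H vv'.
  case/orP=> [lt|/andP[/eqP eq]]; first by apply/orP; left; lia.
  have [->|ne] := eqVneq (block_of H j) (block_of H j'); last by move=> _; apply/orP; left; lia.
  have [<-|ne] := eqVneq (block_of H v) (block_of H v'); last by move=> _; apply/orP; left; lia.
  rewrite eq eqxx ltnn /=; case: ifP => _; first exact: mono.
  by apply: contra; apply: mono.
- by move=> v v0; rewrite /glue block_of0 // block_of_gt0.
- move=> j jN; rewrite /glue -[(N * H).+1]addn1 block_ofE // ltnS block_of_le //.
- by move=> j j0; rewrite /glue block_of0 // ltn0 /=; have := block_of_gt0 H0 j0; lia.
- move=> v vN; rewrite /glue -[(N * H).+1]addn1 block_ofE //; have := block_of_le H0 vN; lia.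
Qed.

(* Labels the maximal runs of cuts moved in the same direction: odd labels are
   moved up. Labels start at 2, so that they are positive. *)
Fixpoint run (l : rel nat) j :=
  if j is j'.+1 then run l j' + (l j j != odd (run l j')) else 2.

Lemma run_odd l j : 0 < j -> odd (run l j) = l j j.
Proof. by case: j => // j _; rewrite [run _ _]/= oddD; case: (l _ _); case: (odd _). Qed.

Lemma run_mono l i j : i <= j -> run l i <= run l j.
Proof.
elim: j => [|j IH]; first by case: i.
by rewrite leq_eqVlt => /predU1P[->//|]; rewrite ltnS => /IH /=; lia.
Qed.

Lemma run_ge2 l j : 2 <= run l j.
Proof. by elim: j => //= j; lia. Qed.

Lemma run_le l j : run l j <= j.+2.
Proof. by elim: j => //= j; case: (_ != _); lia. Qed.

(** The direction changes between two consecutive cuts in between, so f has a fixed point there; it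
    separates the lower cut and its image from the upper cut and its image. *)
Lemma run_lt c l j v : pattern c l -> 0 < j -> 0 < v -> run l j < run l v -> l j v && ~~ l v j.
Proof.
case=> mono _ _ _ _ j0; elim: v => // v IH _ lt.
have jv : j <= v by rewrite leqNgt; apply/negP => /(run_mono l); lia.
have v0 : 0 < v by lia.
have [lt1|] := ltnP (run l j) (run l v).
  case/andP: (IH v0 lt1) => p n; rewrite (mono _ _ _ _ _ _ p) //=.
  by apply: contra n; apply: mono.
move=> ge; have eq : run l j = run l v by have := run_mono l jv; lia.
have := run_odd l v0; move: lt; rewrite eq /=.
case: (odd _) => /=; case lS: (l v.+1 v.+1); rewrite /= ?addn0 ?ltnn //= => _.
  move=> /esym lv; rewrite (mono j v v v.+1) //=.
  by apply: contraFN lS; apply: mono => //; lia.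
move=> /esym/negbT lv; rewrite (mono j v.+1 v.+1 v.+1) //=; last by lia.
by apply: contra lv; apply: mono.
Qed.

(** Replacing f by its inverse in the even runs lets every run be treated as moved up. *)
Definition orient (k : nat) (l : rel nat) : rel nat := if odd k then l else flip l.

Lemma pattern_orient k c l : pattern c l -> pattern c (orient k l).
Proof. by rewrite /orient; case: odd => // /pattern_flip. Qed.

Lemma orient_run l j : 0 < j -> orient (run l j) l j j.
Proof.
by move=> j0; rewrite /orient run_odd // /flip; case: ifP => // /negbT.
Qed.

Lemma odd_orient k k' l : odd k = odd k' -> orient k l = orient k' l.
Proof. by rewrite /orient => ->. Qed.

(** * Realizing runs by translations *)

(* Doubling the scale leaves room for a value strictly between two bounds. *)
Lemma greedy (s1 s2 : seq nat) : (forall x y, x \in s1 -> y \in s2 -> x < y) ->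
  (forall y, y \in s2 -> 0 < y) ->
  exists w, (forall x, x \in s1 -> 2 * x < w) /\ (forall y, y \in s2 -> w < 2 * y).
Proof.
move=> lt pos; exists (2 * \max_(x <- s1) x).+1; split.
  by move=> x xs; rewrite ltnS leq_mul2l /=; exact: (@leq_bigmax_seq _ s1 xpredT id).
move=> y ys; suff : \max_(x <- s1) x < y by lia.
elim: s1 lt => [|x s1 IH] lt; first by rewrite big_nil pos.
rewrite big_cons gtn_max lt ?inE ?eqxx //=; apply: IH => u v us; apply: lt.
by rewrite inE us orbT.
Qed.

(* The cuts of a run are placed one after the other at positions [th] so that f
   becomes the translation by h * p; the position h * z is reserved for the
   marker z, which lies in the cell [m k z] and is mapped to the marker z + p. *)
Section Realize.
Variables (c : nat) (K : nat -> nat) (B : nat -> rel nat) (m : nat -> nat -> nat) (p : nat).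
Hypothesis p0 : 0 < p.
Hypothesis Bmono : forall j j' v v', j <= j' -> v <= v' -> B (K j) j' v -> B (K j) j v'.
Hypothesis Brefl : forall j, 0 < j -> j <= c -> B (K j) j j.
Hypothesis mmono : forall j z z', z <= z' -> m (K j) z <= m (K j) z'.
Hypothesis mlow : forall j z, 0 < j -> j <= c -> z <= p -> m (K j) z < j.
Hypothesis mhigh : forall j, 0 < j -> j <= c -> exists Z, j <= m (K j) Z.
Hypothesis m1 : forall j v z, 0 < j -> j <= c -> 0 < v -> v <= c -> K j = K v ->
  v <= m (K j) z -> B (K j) j v -> j <= m (K j) (z + p).
Hypothesis m2 : forall j v z, 0 < j -> j <= c -> 0 < v -> v <= c -> K j = K v ->
  m (K j) z < v -> ~~ B (K j) j v -> m (K j) (z + p) < j.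

Definition placed n (h : nat) (th : nat -> nat) :=
  [/\ (forall j z, 0 < j -> j <= n -> j <= m (K j) z -> th j < h * z),
      (forall j z, 0 < j -> j <= n -> m (K j) z < j -> h * z < th j) &
      forall j v, 0 < j -> j <= n -> 0 < v -> v <= n -> K j = K v ->
       [/\ (j < v -> th j < th v), (B (K j) j v -> th j < th v + h * p) &
        (~~ B (K j) j v -> th v + h * p < th j)]].

Lemma realize_step n : n <= c -> exists2 h, 0 < h & exists th, placed n h th.
Proof.
elim: n => [|n IH] nc.
  by exists 1 => //; exists id; split => *; lia.
have [h h0 [th [pu pl pr]]] := IH (ltnW nc).
have [Z nZ] := mhigh (ltn0Sn n) nc.
set k := K n.+1 in nZ *.
have [L LP] : exists L : seq nat, forall v, (v \in L) = [&& 0 < v, v <= n & K v == k].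
  by exists [seq v <- iota 1 n | K v == k] => v; rewrite mem_filter mem_iota; lia.
(* [s1] lists what must end up below the new cut [n.+1], and [s2] what must end up above it. Markers
   beyond [Z] impose nothing new, since the cut already lies below the marker [Z]. *)
pose s1 := [seq h * z | z <- iota 0 Z & m k z <= n] ++ [seq th v | v <- L]
  ++ [seq th v + h * p | v <- L & ~~ B k n.+1 v].
pose s2 := [seq h * z | z <- iota 0 Z.+1 & n < m k z]
  ++ [seq th v + h * p | v <- L & B k n.+1 v].
have next_cell z : n < m k z -> p < z.
  move=> nz; rewrite ltnNge; apply/negP => zp; have := mlow (ltn0Sn n) nc zp.
  by rewrite -/k; lia.
(* Each lower bound is compared with each upper bound. When a marker meets the translate of a placed
   cut, [m1] or [m2] pulls the comparison back by one translation, to a marker and a cut already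
   compared; [mlow] handles the markers up to [p], which cannot be pulled back. *)
have [w [w1 w2]] : exists w, (forall x, x \in s1 -> 2 * x < w) /\
    (forall y, y \in s2 -> w < 2 * y).
  apply: greedy.
  - move=> x y; rewrite !mem_cat => /or3P[] /mapP[a + ->] /orP[] /mapP[b + ->];
      rewrite ?mem_filter ?LP ?mem_iota ?LP.
    + move=> /andP[az _] /andP[bz _]; rewrite ltn_pmul2l // ltnNge.
      by apply/negP => /(mmono n.+1); rewrite -/k; lia.
    + move=> /andP[az _] /and3P[bB b0 /andP[bn /eqP bk]].
      have bz0 z : z <= p -> m (K b) z < b by move=> zp; apply: mlow => //; lia.
      have [ap|pa] := leqP a p.
        have := pl b 0 b0 bn (bz0 0 isT); have : h * a <= h * p by rewrite leq_mul2l ap orbT.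
        lia.
      have : m (K b) (a - p) < b.
        rewrite ltnNge; apply/negP => le; have := @m1 n.+1 b (a - p).
        rewrite subnK ?(ltnW pa) // -/k bk; move: le; rewrite bk => le.
        by have bc : b <= c by [lia]; move=> /(_ isT nc b0 bc erefl le bB); lia.
      move=> /(pl b _ b0 bn); rewrite mulnBr.
      have : h * p <= h * a by rewrite leq_mul2l (ltnW pa) orbT.
      lia.
    + move=> /and3P[a0 an /eqP ak] /andP[bz _].
      by apply: pu => //; rewrite ak; lia.
    + move=> /and3P[a0 an /eqP ak] /and3P[bB b0 /andP[bn /eqP bk]].
      case: (pr a b) => //; first by rewrite ak bk.
      rewrite -ak in bB; move=> _ + _; apply; apply: Bmono bB => //; lia.
    + move=> /and3P[aB a0 /andP[an /eqP ak]] /andP[bz _].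
      have pb := next_cell _ bz.
      have le : a <= m (K a) (b - p).
        rewrite leqNgt; apply/negP => lt; have := @m2 n.+1 a (b - p).
        rewrite subnK ?(ltnW pb) // -/k ak; move: lt; rewrite ak => lt.
        by have bc : a <= c by [lia]; move=> /(_ isT nc a0 bc erefl lt aB); lia.
      have := pu a _ a0 an le; rewrite mulnBr.
      have : h * p <= h * b by rewrite leq_mul2l (ltnW pb) orbT.
      lia.
    + move=> /and3P[aB a0 /andP[an /eqP ak]] /and3P[bB b0 /andP[bn /eqP bk]].
      rewrite ltn_add2r; case: (pr a b) => //; first by rewrite ak bk.
      move=> + _ _; apply; rewrite ltnNge; apply/negP => ba.
      by move/negP: aB; apply; apply: Bmono bB.
  - move=> y; rewrite mem_cat => /orP[] /mapP[b + ->]; rewrite mem_filter.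
      by move=> /andP[/next_cell pb _]; rewrite muln_gt0 h0; lia.
    by move=> _; rewrite addn_gt0 muln_gt0 h0 p0 orbT.
exists (2 * h); first by lia.
exists (fun j => if j == n.+1 then w else 2 * th j).
have new j : 0 < j -> j <= n -> K j = k -> j \in L by rewrite LP => -> -> /= ->.
split.
- move=> j z j0 jn; case: eqVneq => [->|ne] jz; last first.
    by have := pu j z; nia.
  rewrite -/k in jz; have [zZ|Zz] := leqP z Z.
    rewrite -mulnA; apply: w2; rewrite mem_cat; apply/orP; left; apply/mapP.
    by exists z => //; rewrite mem_filter mem_iota; lia.
  apply: (@leq_trans (2 * (h * Z))); last by rewrite -mulnA !leq_mul2l (ltnW Zz) !orbT.
  apply: w2; rewrite mem_cat; apply/orP; left; apply/mapP.
  by exists Z => //; rewrite mem_filter mem_iota; lia.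
- move=> j z j0 jn; case: eqVneq => [->|ne] jz; last first.
    by have := pl j z; nia.
  rewrite -/k in jz; have zZ : z < Z.
    by rewrite ltnNge; apply/negP => /(mmono n.+1); rewrite -/k; lia.
  rewrite -mulnA; apply: w1; rewrite mem_cat; apply/orP; left; apply/mapP.
  by exists z => //; rewrite mem_filter mem_iota; lia.
- move=> j v j0 jn v0 vn Kjv.
  case: (eqVneq j n.+1) => [je|jne]; case: (eqVneq v n.+1) => [ve|vne].
  + subst j v; rewrite Brefl //; split=> //; first (by rewrite ltnn); move=> _.
    by rewrite -[ltnLHS]addn0 ltn_add2l !muln_gt0 h0 p0.
  + subst j; have vL : v \in L by apply: new; rewrite -/k; [|lia|].
    split; first by lia.
    * rewrite -/k -mulnA -mulnDr => Bv; apply: w2; rewrite mem_cat; apply/orP; right.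
      by apply/mapP; exists v => //; rewrite mem_filter Bv.
    * rewrite -/k -mulnA -mulnDr => Bv; apply: w1; rewrite !mem_cat; apply/or3P.
      by apply: Or33; apply/mapP; exists v => //; rewrite mem_filter Bv.
  + subst v; have jL : j \in L by apply: new; rewrite -/k; [|lia|].
    have lt : 2 * th j < w.
      by apply: w1; rewrite !mem_cat; apply/or3P; apply: Or32; apply/mapP; exists j.
    split=> // [_|]; first by lia.
    (* Bounds in this direction were not put into [s1] and [s2]: an earlier cut of the run is always
       below the image of a later one. *)
    have -> : B (K j) j n.+1.
      by apply: (@Bmono j j j n.+1) => //; first [lia|apply: Brefl => //; lia].
    by [].
  + have [||q1 q2 q3] := pr j v j0 _ v0 _ Kjv; [lia|lia|].
    rewrite -mulnA; split=> hyp; first by rewrite ltn_pmul2l ?q1.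
    * by have := q2 hyp; lia.
    * by have := q3 hyp; lia.
Qed.

End Realize.

(** * Markers: orbits followed cell by cell *)

Section Virtual.
Variables (c : nat) (l : rel nat).
Hypothesis pl : pattern c l.

(* [next_cell k a] is the highest cell met by f(cell a), and [prev_cell k u] is
   the cell of the preimage of the cut u. *)
Definition next_cell k a := upto_count c (fun j => orient k l j a.+1).
Definition prev_cell k u := upto_count c (fun x => ~~ orient k l u x).

Lemma next_cell_le k a : next_cell k a <= c. Proof. exact: upto_count_le. Qed.
Lemma prev_cell_le k a : prev_cell k a <= c. Proof. exact: upto_count_le. Qed.

Lemma orient_mono k j j' v v' : j <= j' -> v <= v' -> orient k l j' v -> orient k l j v'.
Proof. by case: (pattern_orient k pl) => + _ _ _ _; apply. Qed.

Lemma next_cellP k a j : 0 < j -> j <= c -> orient k l j a.+1 = (j <= next_cell k a).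
Proof.
move=> j0 jc; rewrite -(@upto_countP c (fun j => orient k l j a.+1)) //.
by move=> i i' _ ii' _; apply: orient_mono.
Qed.

Lemma prev_cellP k u x : 0 < x -> x <= c -> ~~ orient k l u x = (x <= prev_cell k u).
Proof.
move=> x0 xc; rewrite -(@upto_countP c (fun x => ~~ orient k l u x)) //.
by move=> i i' _ ii' _; apply: contra; apply: orient_mono.
Qed.

Lemma orient0 k v : 0 < v -> orient k l 0 v.
Proof. by case: (pattern_orient k pl) => _ + _ _ _; apply. Qed.

Lemma next_cell_mono k a a' : a <= a' -> next_cell k a <= next_cell k a'.
Proof.
move=> aa'; have [->//|p] := posnP (next_cell k a); have c1 := next_cell_le k a.
by rewrite -next_cellP //; apply: (@orient_mono _ _ (next_cell k a) a.+1) => //; rewrite ?next_cellP.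
Qed.

Lemma prev_cell_mono k u u' : u <= u' -> prev_cell k u <= prev_cell k u'.
Proof.
move=> uu'; have [->//|p] := posnP (prev_cell k u); have c1 := prev_cell_le k u.
rewrite -prev_cellP //; have : ~~ orient k l u (prev_cell k u) by rewrite prev_cellP.
by apply: contra; apply: orient_mono.
Qed.

(** One half of an adjunction between the two maps. It turns the base condition
    [b p.-1 <= next_cell k (b 0)] into the inequality that keeps the markers monotone from one row
    to the next below the base row. *)
Lemma prev_next_cell k x a : x <= next_cell k a -> prev_cell k x <= a.
Proof.
move=> xa; rewrite leqNgt; apply/negP => lt.
have : ~~ orient k l x a.+1 by rewrite prev_cellP //; have := prev_cell_le k x; lia.
have [->|x0] := posnP x; first by rewrite orient0.
by rewrite next_cellP ?xa // (leq_trans xa) // next_cell_le.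
Qed.

Lemma iter_mono (f : nat -> nat) n : (forall a b, a <= b -> f a <= f b) ->
  forall a b, a <= b -> iter n f a <= iter n f b.
Proof. by move=> fm; elim: n => //= n IH a b ab; apply/fm/IH. Qed.

(** While the lower cut of the current cell belongs to run [k], it is moved strictly up, so taking
    preimages lowers the index by at least one. Below the run, the cell stays below, since all cuts
    of the run are moved up. *)
Lemma iter_prev_cell_low k u n : u <= c -> run l u <= k ->
  (forall j, 0 < j -> j <= c -> run l j = k -> iter n (prev_cell k) u < j) \/
  iter n (prev_cell k) u + n <= u.
Proof.
move=> uc ruk; elim: n => [|n]; first by right; rewrite addn0.
rewrite iterS; set w := iter n _ u => IH.
have low : (forall j, 0 < j -> j <= c -> run l j = k -> w < j) ->
    forall j, 0 < j -> j <= c -> run l j = k -> prev_cell k w < j.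
  move=> wj j j0 jc rj; rewrite ltnNge -prev_cellP // negbK.
  apply: (@orient_mono _ _ j j) => //; first by rewrite ltnW ?wj.
  by rewrite -rj orient_run.
case: IH => [wj|wu]; first by left; apply: low.
have wc : w <= c by lia.
have [/andP[/eqP rw w0]|n1] := boolP ((run l w == k) && (0 < w)).
  right; have : prev_cell k w < w by rewrite ltnNge -prev_cellP // negbK -{1}rw orient_run.
  lia.
left; apply: low => j j0 jc rj; rewrite ltnNge; apply/negP => jw.
have r1 := run_mono l jw; have r2 : run l w <= run l u by apply: run_mono; lia.
by move/negP: n1; apply; rewrite (leq_trans j0 jw) andbT; lia.
Qed.

(** Dual to the previous lemma: the upper cut of the current cell is crossed at each step as long as
    it belongs to run [k]. *)
Lemma iter_next_cell_high k a n : (forall j, 0 < j -> j <= c -> run l j < k -> j <= a) ->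
  (forall j, 0 < j -> j <= c -> run l j = k -> j <= iter n (next_cell k) a) \/
  a + n <= iter n (next_cell k) a.
Proof.
move=> ak; elim: n => [|n]; first by right; rewrite addn0.
rewrite iterS; set w := iter n _ a => IH.
have high : (forall j, 0 < j -> j <= c -> run l j = k -> j <= w) ->
    forall j, 0 < j -> j <= c -> run l j = k -> j <= next_cell k w.
  move=> wj j j0 jc rj; rewrite -next_cellP //.
  apply: (@orient_mono _ j j j) => //; first by have := wj j j0 jc rj; lia.
  by rewrite -rj orient_run.
case: IH => [wj|wu]; first by left; apply: high.
have [/andP[/eqP rw wc]|n1] := boolP ((run l w.+1 == k) && (w < c)).
  right; have : w < next_cell k w by rewrite -next_cellP // -{1}rw orient_run.
  lia.
left; apply: high => j j0 jc rj; rewrite leqNgt; apply/negP => wj.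
have r1 := run_mono l wj; move/negP: n1; apply.
rewrite (leq_trans wj jc) andbT eqn_leq -{1}rj r1 /= leqNgt; apply/negP.
by move=> /(ak w.+1 isT (leq_trans wj jc)); lia.
Qed.

Variables (k p N : nat) (b : nat -> nat).

(* The markers N * p + z, with z < p, start in the cells [b z]; the other ones
   lie on the orbits of these cells. *)
Definition base_ok :=
  [/\ (forall z z', z <= z' -> z' < p -> b z <= b z'), b p.-1 <= next_cell k (b 0),
      (forall z, z < p -> b z <= c /\ run l (b z) <= k) &
      (forall z j, z < p -> 0 < j -> j <= c -> run l j < k -> j <= b z)].

Definition marker i :=
  let q := i %/ p in let z := i %% p in
  if q <= N then iter (N - q) (prev_cell k) (b z) else iter (q - N) (next_cell k) (b z).

Hypotheses (p0 : 0 < p) (cN : c.+2 <= N) (bok : base_ok).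

Lemma marker_up i z : z < p -> marker ((N + i) * p + z) = iter i (next_cell k) (b z).
Proof.
move=> zp; rewrite /marker divnMDl // divn_small // addn0 modnMDl modn_small //.
by case: leqP => [/[dup] le _|_]; [have -> : i = 0 by lia|]; rewrite ?addn0 ?subnn // addKn.
Qed.

Lemma marker_shift i : marker (i + p) =
  if i %/ p < N then iter (N - (i %/ p).+1) (prev_cell k) (b (i %% p))
  else iter ((i %/ p).+1 - N) (next_cell k) (b (i %% p)).
Proof.
rewrite /marker divnDr // divnn p0 addn1 modnDr; by [].
Qed.

(** Below the base row a marker is defined from the one above it, from the base row on the other way
    round. Either relation suffices for the two compatibility conditions with the cuts. *)
Lemma marker_step i : marker i = prev_cell k (marker (i + p)) \/ marker (i + p) = next_cell k (marker i).
Proof.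
rewrite marker_shift /marker; case: (leqP (i %/ p).+1 N) => lt.
  left; rewrite (ltnW lt) -(iterS _ (prev_cell k)); congr (iter _ _ _); lia.
right; case: leqP => le.
  have -> : i %/ p = N by lia.
  by rewrite subnn subSnn.
rewrite -(iterS _ (next_cell k)); congr (iter _ _ _); lia.
Qed.

Lemma marker_mono i j : i <= j -> marker i <= marker j.
Proof.
case: bok => bm bU _ _.
elim: j => [|j IH]; first by case: i.
rewrite leq_eqVlt => /predU1P[->//|]; rewrite ltnS => /IH le.
apply: (leq_trans le) => {IH le i}.
rewrite /marker [in j.+1 %/ p](divn_eq j p) [in j.+1 %% p](divn_eq j p).
rewrite -[(_ + _).+1]addnS divnMDl // modnMDl.
have zp := ltn_pmod j p0; set q := j %/ p; set z := j %% p in zp *.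
have [lt|] := ltnP z.+1 p.
  rewrite divn_small // addn0 modn_small //.
  by case: (leqP q N) => _; apply: iter_mono; rewrite ?bm // => a a'; [apply: prev_cell_mono|apply: next_cell_mono].
move=> ge; have zE : z = p.-1 by lia.
have -> : z.+1 = p by lia.
rewrite divnn p0 addn1 modnn zE; case: (leqP q.+1 N) => lt.
  rewrite (ltnW lt); have -> : N - q = (N - q.+1).+1 by lia.
  rewrite iterSr; apply: iter_mono => [a a'|]; first exact: prev_cell_mono.
  exact: prev_next_cell.
have -> : q.+1 - N = (q - N).+1 by lia.
rewrite iterSr; case: (leqP q N) => le.
  have -> : q = N by lia.
  by rewrite subnn.
by apply: iter_mono => [a a'|//]; exact: next_cell_mono.
Qed.

(** The marker [p] is [N - 1] backward steps away from [b 0]. As [c.+2 <= N], these are more steps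
    than there are cuts, so the orbit has left the run. *)
Lemma marker_low j i : 0 < j -> j <= c -> run l j = k -> i <= p -> marker i < j.
Proof.
move=> j0 jc rj ip; apply: (leq_ltn_trans (marker_mono ip)).
have -> : marker p = iter (N.-1) (prev_cell k) (b 0).
  have N1 : 0 < N by lia.
  by rewrite /marker divnn p0 modnn N1 subn1.
case: bok => _ _ /(_ 0 p0)[bc br] _.
have [//|le] := @iter_prev_cell_low k (b 0) N.-1 bc br; first exact.
lia.
Qed.

Lemma marker_high j : 0 < j -> j <= c -> run l j = k -> exists i, j <= marker i.
Proof.
move=> j0 jc rj; exists ((N + c) * p + 0); rewrite marker_up //.
case: bok => _ _ _ /(_ 0)/(_ _ p0) bh.
have [//|le] := @iter_next_cell_high k (b 0) c bh; first exact.
lia.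
Qed.

Lemma marker_push_le j v i : 0 < j -> j <= c -> 0 < v -> v <= c ->
  v <= marker i -> orient k l j v -> j <= marker (i + p).
Proof.
move=> j0 jc v0 vc vi jv; case: (marker_step i) => [E|->].
  rewrite leqNgt; apply/negP => lt.
  have : ~~ orient k l (marker (i + p)) v by rewrite prev_cellP // -E.
  by move/negP; apply; apply: orient_mono jv => //; apply: ltnW.
by rewrite -next_cellP //; apply: orient_mono jv => //; lia.
Qed.

Lemma marker_push_lt j v i : 0 < j -> j <= c -> 0 < v -> v <= c ->
  marker i < v -> ~~ orient k l j v -> marker (i + p) < j.
Proof.
move=> j0 jc v0 vc vi jv; case: (marker_step i) => [E|->].
  rewrite ltnNge; apply: contra jv => le.
  have : orient k l (marker (i + p)) v by rewrite -[orient _ _ _ _]negbK prev_cellP // -E -ltnNge.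
  exact: orient_mono.
by rewrite ltnNge -next_cellP //; apply: contra jv; apply: orient_mono.
Qed.

End Virtual.

(** The cell just below run [k]: the default base for runs in which no orbit is prescribed. *)
Definition first_cell c l k := upto_count c (fun j => run l j < k).

Lemma first_cellP c l k j : 0 < j -> j <= c -> (run l j < k) = (j <= first_cell c l k).
Proof.
move=> j0 jc; rewrite -(@upto_countP c (fun j => run l j < k)) //.
by move=> i i' _ ii' _; have := run_mono l ii'; lia.
Qed.

(** The two cuts bounding this cell belong to different runs, so by [run_lt] the cell meets its own
    image; hence all [p] markers of the base row may share it. *)
Lemma first_cell_base c l k p : pattern c l -> 2 <= k -> base_ok c l k p (fun=> first_cell c l k).
Proof.
move=> pl k2; have bc : first_cell c l k <= c by apply: upto_count_le.
have bk : 0 < first_cell c l k -> run l (first_cell c l k) < k.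
  by move=> f0; rewrite (@first_cellP c).
split=> //.
- have [->//|f0] := posnP (first_cell c l k).
  rewrite -next_cellP //; move: bc; rewrite leq_eqVlt => /predU1P[->|bc].
    by case: (pattern_orient k pl) => _ _ + _ _; apply.
  have : ~~ (run l (first_cell c l k).+1 < k) by rewrite (@first_cellP c) // ltnn.
  rewrite -leqNgt => r2.
  have /andP[] := @run_lt c l (first_cell c l k) (first_cell c l k).+1 pl f0 isT
    (leq_trans (bk f0) r2).
  by rewrite /orient /flip; case: ifP.
- move=> z _; split=> //; have [->//|/bk/ltnW//] := posnP (first_cell c l k).
- by move=> z j zp j0 jc; rewrite (@first_cellP c).
Qed.

Lemma realize_pattern c l p N b : pattern c l -> 0 < p -> c.+2 <= N ->
  (forall k, 2 <= k -> base_ok c l k p (b k)) ->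
  exists2 h, 0 < h & exists th,
    placed (run l) (fun k => orient k l) (fun k => marker c l k p N (b k)) p c h th.
Proof.
move=> pl p0 cN bok; have bk j := bok _ (run_ge2 l j).
apply: (@realize_step c) => //.
- by move=> j; exact: (orient_mono pl).
- by move=> j j0 _; apply: orient_run.
- by move=> j z z'; apply: marker_mono.
- by move=> j z j0 jc; apply: marker_low.
- by move=> j j0 jc; apply: marker_high.
- by move=> j v z j0 jc v0 vc Kjv; apply: marker_push_le.
- by move=> j v z j0 jc v0 vc Kjv; apply: marker_push_lt.
Qed.

(** * Spirals *)

(* u in 0..2k encodes a vertex or an edge of a path with vertices 0..k: the vertex
   u/2 if u is even, the edge {(u-1)/2, (u+1)/2} if u is odd. *)
Definition incident y u := (u <= (2 * y).+1) && (2 * y <= u.+1).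

Lemma glue_in H (loc : rel nat) B j v : block_of H j = B -> block_of H v = B ->
  orient B (glue H loc) j v = loc j v.
Proof.
move=> jB vB; rewrite /orient; case: ifP => oB.
  by rewrite /glue jB vB ltnn eqxx oB.
by rewrite /flip /glue jB vB ltnn eqxx oB /= negbK.
Qed.

Lemma orient_cell B l x' x : cell (orient B l) x' x = if odd B then cell l x' x else cell l x x'.
Proof. by rewrite /orient; case: ifP => _ //; rewrite cell_flip. Qed.

(* Each of the r blocks consists of Z + 1 groups of four cells. The cells
   4y+1, 4y+2, 4y+3 form the window y, and f maps the whole window y into its
   middle cell 4(y+p)+2; hence orbits cannot leave the windows in any refinement. *)
Section Spiral.
Variables (r Z p : nat).
Hypotheses (p0 : 0 < p) (pZ : p < Z).

Definition spiral_shift : rel nat := fun j v => j <= 4 * (v.-1 %/ 4 + p) + 2.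
Definition spiral_size := r * (4 * Z.+1).
Definition spiral := glue (4 * Z.+1) spiral_shift.

Lemma spiral_pattern : pattern spiral_size spiral.
Proof.
apply: glue_pattern; first by lia.
move=> j j' v v' jj' vv'; rewrite /spiral_shift => le.
apply: (leq_trans jj'); apply: (leq_trans le).
rewrite leq_add2r leq_mul2l /= leq_add2r leq_div2r //; lia.
Qed.

Lemma spiral_blk B i : 0 < i -> i <= 4 * Z.+1 -> 0 < B -> block_of (4 * Z.+1) (B.-1 * (4 * Z.+1) + i) = B.
Proof. by move=> i0 iZ B0; rewrite block_ofE // prednK. Qed.

Variable B : nat.
Hypotheses (B0 : 0 < B) (Br : B <= r).
Let y0 := B.-1 * Z.+1.
Let T := B * (4 * Z.+1).

Lemma T_eq : T = 4 * y0 + 4 * Z.+1.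
Proof. by rewrite /T /y0; nia. Qed.

Lemma spiral_orient j v : 4 * y0 < j <= T -> 4 * y0 < v <= T ->
  orient B spiral j v = spiral_shift j v.
Proof.
rewrite T_eq => /andP[j1 j2] /andP[v1 v2]; apply: glue_in.
  have -> : j = B.-1 * (4 * Z.+1) + (j - 4 * y0) by rewrite /y0 in j1 j2 *; nia.
  by apply: spiral_blk => //; lia.
have -> : v = B.-1 * (4 * Z.+1) + (v - 4 * y0) by rewrite /y0 in v1 v2 *; nia.
by apply: spiral_blk => //; lia.
Qed.

Lemma spiral_mono j j' v v' : j <= j' -> v <= v' -> orient B spiral j' v -> orient B spiral j v'.
Proof. by case: (pattern_orient B spiral_pattern) => + _ _ _ _; apply. Qed.

Lemma spiral_cell z x' x : z + p <= Z -> 4 * (y0 + z) < x < 4 * (y0 + z) + 4 ->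
  cell (orient B spiral) x' x -> x' = 4 * (y0 + z + p) + 2.
Proof.
move=> zp /andP[x1 x2] /andP[n1 p1]; have TE := T_eq.
have xd : x.-1 %/ 4 = y0 + z by lia.
have xd' : x %/ 4 = y0 + z by lia.
apply/eqP; rewrite eqn_leq; apply/andP; split.
  rewrite leqNgt; apply/negP => lt; have := spiral_mono lt (leqnn _) p1.
  rewrite spiral_orient; [|lia|lia].
  by rewrite /spiral_shift /= xd' ltnn.
rewrite leqNgt; apply/negP => lt; move/negP: n1; apply.
apply: (spiral_mono lt (leqnn _)); rewrite spiral_orient; [|lia|lia].
by rewrite /spiral_shift xd.
Qed.

(** Each passage through [incident] loses at most half a cell, so a gain of two cells remains
    visible in every refinement. *)
Lemma spiral_up x' x : 4 * y0 < x -> x.+2 <= T -> cell (orient B spiral) x' x -> x.+2 <= x'.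
Proof.
move=> x1 x2 /andP[n1 _]; have TE := T_eq.
rewrite leqNgt; apply/negP => lt; move/negP: n1; apply.
apply: (spiral_mono lt (leqnn _)); rewrite spiral_orient; [|lia|lia].
rewrite /spiral_shift; lia.
Qed.

Section Over.
Variables (c : nat) (l : rel nat) (xi : nat -> nat).
Hypotheses (pl : pattern c l) (ux : ustep c (2 * spiral_size) xi).
Hypothesis weak : forall u' u, u' <= c -> u <= c -> cell l u' u ->
  exists x' x, [/\ incident x' (xi u'), incident x (xi u) & cell spiral x' x].

Definition preim v := find (fun u => xi u == v) (iota 0 c.+1).

Lemma preimP v : v <= 2 * spiral_size -> preim v <= c /\ xi (preim v) = v.
Proof.
move=> /(ustep_surj ux)[x xc xv].
have h : has (fun u => xi u == v) (iota 0 c.+1).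
  by apply/hasP; exists x; [rewrite mem_iota; lia|apply/eqP].
have lt : preim v < c.+1 by rewrite -[ltnRHS](size_iota 0) -has_find.
split=> //; apply/eqP; have := nth_find 0 h.
by rewrite nth_iota.
Qed.

Lemma xi_lt u v : u <= c -> xi u < xi v -> u < v.
Proof. by move=> uc; rewrite !ltnNge; apply: contra => /(ustep_mono ux); apply. Qed.

Lemma weak_orient u' u : u' <= c -> u <= c -> cell (orient B l) u' u ->
  exists x' x, [/\ incident x' (xi u'), incident x (xi u) & cell (orient B spiral) x' x].
Proof.
rewrite orient_cell => u'c uc; case oB: (odd B) => C.
  by have [x' [x [? ? ?]]] := weak u'c uc C; exists x', x; rewrite orient_cell oB.
by have [x' [x [? ? ?]]] := weak uc u'c C; exists x, x'; rewrite orient_cell oB.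
Qed.

(** The bounds are even codes, that is, vertices: every cell incident to [xi u] then belongs to the
    window of the spiral. *)
Definition window z u := [&& u <= c, 2 * (4 * (y0 + z) + 1) <= xi u & xi u <= 2 * (4 * (y0 + z) + 3)].

Lemma up_cell k u : u <= c -> cell (orient k l) (next_cell c l k u) u.
Proof.
move=> uc; have [om o0 _ _ oc] := pattern_orient k pl; apply/andP; split.
  have := next_cell_le c l k u; rewrite leq_eqVlt => /predU1P[->|lt]; first exact: oc.
  have : ~~ orient k l (next_cell c l k u).+1 u.+1 by rewrite (next_cellP pl) ?ltnn.
  by apply: contra; apply: om.
have [->|p1] := posnP (next_cell c l k u); first exact: o0.
by rewrite (next_cellP pl) ?next_cell_le.
Qed.

(** The image is incident to the middle cell of the next window. The half cell lost in this way is
    smaller than the margin of one cell on each side. *)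
Lemma window_up z u : z + p <= Z -> window z u -> window (z + p) (next_cell c l B u).
Proof.
move=> zp /and3P[uc u1 u2]; rewrite /window next_cell_le /=.
have [x' [x [/andP[a1 a2] /andP[b1 b2] C]]] := weak_orient (next_cell_le c l B u) uc (up_cell B uc).
by have := spiral_cell zp _ C; lia.
Qed.

Definition base z := preim (2 * (4 * (y0 + z) + 2)).

Lemma size_ge : T <= spiral_size.
Proof. by rewrite /T /spiral_size leq_mul2r Br orbT. Qed.

Lemma baseP z : z <= Z -> base z <= c /\ xi (base z) = 2 * (4 * (y0 + z) + 2).
Proof. by move=> zZ; apply: preimP; have := size_ge; rewrite T_eq; lia. Qed.

Lemma base_window z : z <= Z -> window z (base z).
Proof. by move=> /baseP[bc bE]; rewrite /window bc bE; lia. Qed.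

Lemma base_lt : base 0 < c.
Proof.
have [bc bE] := baseP (leq0n Z); case: (ux) => _ xc _.
rewrite ltn_neqAle bc andbT; apply/eqP => bce; move: bE; rewrite bce xc.
by have := size_ge; rewrite T_eq; lia.
Qed.

(** If the cut were moved against the direction of the block, the image of cell [j.-1] would not go
    beyond that cell, against the gain of two cells in the spiral. *)
Lemma sign_in j : base 0 < j -> j <= c -> xi j.-1 + 4 <= 2 * T -> l j j = odd B.
Proof.
move=> bj jc xj; have [bc bE] := baseP (leq0n Z).
suff : orient B l j j by rewrite /orient /flip; case: ifP => _ => [|/negbTE].
apply/negPn/negP => nj; have j1c : j.-1 <= c by lia.
have jE : j.-1.+1 = j by lia.
have lt : next_cell c l B j.-1 < j.
  rewrite ltnNge -(next_cellP pl) //; [|lia]; by rewrite jE.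
have [x' [x [/andP[a1 a2] /andP[b1 b2] C]]] := weak_orient (next_cell_le c l B j.-1) j1c (up_cell B j1c).
have x1 : xi (base 0) <= xi j.-1 by apply: (ustep_mono ux); lia.
have x2 : xi (next_cell c l B j.-1) <= xi j.-1 by apply: (ustep_mono ux); lia.
have : x.+2 <= x' by apply: spiral_up C; lia.
lia.
Qed.

(** The run of the refinement lying over block [B]; by [run_label] the choice of the cut inside the
    block does not matter, away from the upper end. *)
Definition label := run l (base 0).+1.

Lemma label_odd : odd label = odd B.
Proof.
rewrite /label run_odd //; apply: sign_in => //; first exact: base_lt.
by have [_ /= ->] := baseP (leq0n Z); rewrite T_eq; lia.
Qed.

Lemma run_label j : base 0 < j -> j <= c -> xi j.-1 + 4 <= 2 * T -> run l j = label.
Proof.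
elim: j => // j IH bj jc xj; have [->//|ne] := eqVneq j (base 0).
have jb : base 0 < j by lia.
have x1 : xi j.-1 <= xi j by apply: (ustep_mono ux); lia.
rewrite /= in xj; rewrite /= IH //; [|lia|lia].
by rewrite sign_in // label_odd eqxx addn0.
Qed.

Lemma run_ge_label j : base 0 < j -> label <= run l j.
Proof. exact: run_mono. Qed.

Lemma run_window z m : z < Z -> base 0 <= m -> window z m -> run l m <= label.
Proof.
move=> zZ; rewrite leq_eqVlt => /predU1P[<- _|lt /and3P[mc m1 m2]].
  exact: run_mono.
rewrite run_label //; have : xi m.-1 <= xi m by apply: (ustep_mono ux); lia.
by rewrite T_eq; lia.
Qed.

Lemma up_label u : next_cell c l label u = next_cell c l B u.
Proof. by rewrite /next_cell (odd_orient _ label_odd). Qed.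

Lemma base_mono z z' : z <= z' -> z' <= Z -> base z <= base z'.
Proof.
move=> zz' z'Z; have [_ e1] := baseP (leq_trans zz' z'Z); have [c2 e2] := baseP z'Z.
have [->//|ne] := eqVneq z z'; apply/ltnW/xi_lt; last by rewrite e1 e2; lia.
by case: (baseP (leq_trans zz' z'Z)).
Qed.

Lemma base_marks_label : base_ok c l label p base.
Proof.
split.
- by move=> z z' zz' z'p; apply: base_mono => //; lia.
- rewrite up_label; have : window (0 + p) (next_cell c l B (base 0)).
    by apply: window_up; [lia|exact: base_window].
  rewrite add0n => /and3P[uc u1 u2].
  have [|c1 e1] := @baseP p.-1; first by lia.
  by apply/ltnW/xi_lt => //; rewrite e1; lia.
- move=> z zp; have [|bc _] := @baseP z; first by lia.
  split=> //; apply: (@run_window z); first by lia.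
    by apply: base_mono; lia.
  by apply: base_window; lia.
- move=> z j zp j0 jc lt; have : base 0 <= base z by apply: base_mono; lia.
  by apply: leq_trans; rewrite leqNgt; apply: contraL lt => /run_ge_label; rewrite -leqNgt.
Qed.

Lemma window_iter i z : z + i * p <= Z -> window (z + i * p) (iter i (next_cell c l label) (base z)).
Proof.
elim: i => [|i IH] le; first by rewrite addn0; apply: base_window; lia.
by rewrite iterS up_label mulSnr addnA; apply: window_up; [lia|apply: IH; lia].
Qed.

(** This marker is the (z / p)-th forward image of the base cell of window z mod p, and each image
    advances by [p] windows. *)
Lemma marker_window N z : z < Z -> c.+2 <= N -> let m := marker c l label p N base (N * p + z) in
  [/\ window z m, run l m <= label & base 0 <= m].
Proof.
move=> zZ cN m.
have mE : m = iter (z %/ p) (next_cell c l label) (base (z %% p)).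
  rewrite /m [in N * p + z](divn_eq z p) addnA -mulnDl marker_up //.
  by rewrite ltn_mod.
have W : window z m.
  rewrite mE; have := @window_iter (z %/ p) (z %% p).
  have -> : z %% p + z %/ p * p = z by rewrite addnC -divn_eq.
  by apply; lia.
suff bm : base 0 <= m by split=> //; exact: (run_window zZ).
have [z00|zp] := posnP z; first by rewrite mE z00 div0n mod0n.
have [bc e] := baseP (leq0n Z); case/and3P: W => mc m1 m2.
by apply/ltnW/xi_lt => //; rewrite e; lia.
Qed.

End Over.
End Spiral.

(** What a digraph morphism to a realization of the model yields: the cells are known only through
    the vertex or edge that they lie over. [strict_map] below is an honest refinement, cell by
    cell. *)
Definition weak_map c l xi n lP :=
  [/\ pattern c l, ustep c (2 * n) xi &
   forall u' u, u' <= c -> u <= c -> cell l u' u ->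
    exists x' x, [/\ incident x' (xi u'), incident x (xi u) & cell lP x' x]].

Definition strict_map d lD X c l :=
  [/\ pattern d lD, ustep d c X &
   forall x' x, x' <= d -> x <= d -> cell lD x' x -> cell l (X x') (X x)].

(* [embed_label] sends the label [kappa B] to the block B(2w+1) and preserves
   parity; the 2w blocks in between are for runs near the fixed points. *)
Section Emb.
Variables (kappa : nat -> nat) (w r : nat).
Hypothesis kw : forall B, 0 < B -> B <= r -> kappa B <= w /\ odd (kappa B) = odd B.
Hypothesis kS : forall B, 0 < B -> B < r -> kappa B < kappa B.+1.

Fixpoint embed_label B k := if B is B'.+1 then
  if k < kappa B then embed_label B' k else B * (2 * w).+1 + (k - kappa B) else k.

Lemma embed_label_le B k : embed_label B k <= B * (2 * w).+1 + k.
Proof. by elim: B => //= B IH; case: ifP; lia. Qed.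

Lemma embed_label_mono B k k' : B <= r -> k < k' -> embed_label B k < embed_label B k'.
Proof.
elim: B k k' => //= B IH k k' Br kk'.
have [lt|ge] := ltnP k (kappa B.+1); case: (ltnP k' (kappa B.+1)) => [lt'|ge']; last by lia.
- by apply: IH; lia.
- have := embed_label_le B k; have [] := @kw B.+1 isT Br; nia.
- lia.
Qed.

Lemma embed_label_odd B k : B <= r -> odd (embed_label B k) = odd k.
Proof.
elim: B => //= B IH Br; case: ltnP => [lt|ge]; first by apply: IH; lia.
have [_] := @kw B.+1 isT Br.
by rewrite oddD oddM oddB //= oddM /= => ->; case: (odd B); case: (odd k).
Qed.

Lemma embed_label_kappa B B' : 0 < B -> B <= B' -> B' <= r -> embed_label B' (kappa B) = B * (2 * w).+1.
Proof.
move=> B0; elim: B' => [|B' IH] BB' Br /=; first by lia.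
move: BB'; rewrite leq_eqVlt => /predU1P[->|lt]; first by rewrite ltnn subnn addn0.
have km : kappa B < kappa B'.+1.
  have : kappa B <= kappa B'; last by have := @kS B'; lia.
  elim: B' lt Br {IH} => [|B' IH] lt Br; first by lia.
  have [->//|ne] := eqVneq B B'.+1.
  by have := @kS B'; have := IH; lia.
by rewrite km IH //; lia.
Qed.

Lemma embed_label_gt0 B k : B <= r -> 0 < k -> 0 < embed_label B k.
Proof. by move=> Br k0; apply: leq_ltn_trans (embed_label_mono Br k0). Qed.

Lemma embed_label_inj B k k' : B <= r -> embed_label B k = embed_label B k' -> k = k'.
Proof.
move=> Br e; case: (ltngtP k k') => // lt; have := embed_label_mono Br lt; lia.
Qed.

Lemma embed_label_lt B k k' : B <= r -> (embed_label B k < embed_label B k') = (k < k').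
Proof.
move=> Br; case: (ltngtP k k') => [lt|gt|->]; last by rewrite ltnn.
  exact: embed_label_mono.
by apply/negbTE; rewrite -leqNgt ltnW // embed_label_mono.
Qed.
End Emb.

(** Instructions for placing the cuts of [l] in a model of [M] blocks, translated by [q] alternately
    up and down: cut [j] goes to offset [th j] of block [F j]. *)
Definition fits c l q M (th F : nat -> nat) :=
  [/\ (forall j, 0 < j -> j <= c -> 0 < F j <= M /\ 0 < th j),
      (forall j v, 0 < j -> j <= v -> v <= c -> F j <= F v),
      (forall j v, 0 < j -> j <= c -> 0 < v -> v <= c -> F j < F v -> l j v && ~~ l v j) &
      (forall j v, 0 < j -> j <= c -> 0 < v -> v <= c -> F j = F v ->
        [/\ (j < v -> th j < th v), (orient (F j) l j v -> th j < th v + q) &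
            (~~ orient (F j) l j v -> th v + q < th j)])].

(** The point at offset [pos] of block [b] lies in the cell [m], away from all cuts. *)
Definition splits c (th F : nat -> nat) m b pos :=
  (forall j, 0 < j -> j <= c -> j <= m -> F j < b \/ F j = b /\ th j < pos) /\
  (forall j, 0 < j -> j <= c -> m < j -> b < F j \/ F j = b /\ pos < th j).

Lemma fits_scale s c l q M th F : 0 < s -> fits c l q M th F ->
  fits c l (s * q) M (fun j => s * th j) F.
Proof.
move=> s0 [f1 f2 f3 f4]; split=> //.
  by move=> j j0 jc; rewrite muln_gt0 s0; apply: f1.
move=> j v j0 jc v0 vc /(f4 j v j0 jc v0 vc)[q1 q2 q3].
by split=> [/q1|/q2|/q3]; rewrite -?mulnDr ltn_pmul2l.
Qed.

Lemma splits_scale s c th F m b pos : 0 < s -> splits c th F m b pos ->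
  splits c (fun j => s * th j) F m b (s * pos).
Proof.
move=> s0 [f1 f2]; split=> j j0 jc jm.
  by case: (f1 j j0 jc jm) => [|[]]; [left|right; rewrite ltn_pmul2l].
by case: (f2 j j0 jc jm) => [|[]]; [left|right; rewrite ltn_pmul2l].
Qed.

(** * Amalgamation of patterns *)

Definition ambient H q := glue H (fun j v => j <= v + q).

Lemma ambient_restrict c l q M th F H : 0 < H -> pattern c l -> fits c l q M th F ->
  (forall j, 0 < j -> j <= c -> th j <= H) ->
  let X x := upto_count c (fun j => (F j).-1 * H + th j <= x) in
  strict_map (M * H) (ambient H q) X c l /\
  forall j x, 0 < j -> j <= c -> ((F j).-1 * H + th j <= x) = (j <= X x).
Proof.
move=> H0 pl [f1 f2 f3 f4] tH X.
have pD : pattern (M * H) (ambient H q) by apply: glue_pattern => //; lia.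
have tB j : 0 < j -> j <= c -> block_of H ((F j).-1 * H + th j) = F j.
  by move=> j0 jc; have [/andP[F0 _] t0] := f1 j j0 jc; rewrite block_ofE ?prednK ?tH.
have [ | | |u cell_rel XP] := restrict_pattern (t := fun j => (F j).-1 * H + th j) pD pl; last by split.
- move=> j j0 jc; have [/andP[F0 FM] t0] := f1 j j0 jc; have := tH j j0 jc.
  have : (F j).-1.+1 * H <= M * H by rewrite leq_mul2r prednK // FM orbT.
  by rewrite mulSn; move: ((F j).-1 * H) (M * H) => x y; lia.
- move=> i j i0 ij jc; have ic : i <= c by lia.
  have j0 : 0 < j by lia.
  have [/andP[Fi0 _] ti0] := f1 i i0 ic; have [/andP[Fj0 _] tj0] := f1 j j0 jc.
  have := f2 i j i0 (ltnW ij) jc; rewrite leq_eqVlt => /predU1P[e|lt].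
    by case: (f4 i j) => // /(_ ij); rewrite e ltn_add2l.
  have := tH i i0 ic; have : (F i).-1.+1 * H <= (F j).-1 * H by rewrite leq_mul2r; lia.
  by rewrite mulSn; move: ((F i).-1 * H) ((F j).-1 * H) => x y; lia.
- move=> j v j0 jc v0 vc; rewrite /ambient /glue !tB //.
  case: (ltngtP (F j) (F v)) => [lt|lt|e] /=.
  + by case/andP: (f3 j v j0 jc v0 vc lt).
  + by case/andP: (f3 v j v0 vc j0 jc lt) => _ /negbTE.
  + have := f4 j v j0 jc v0 vc e; have := f4 v j v0 vc j0 jc (esym e).
    rewrite /orient /flip e; case: ifP => _ [_ q1 q2] [_ q3 q4].
      rewrite -addnA leq_add2l.
      by case: (l j v) q3 q4 => /= q3 q4; [rewrite ltnW ?q3|have := q4 isT; lia].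
    rewrite -addnA leq_add2l.
    by case: (l j v) q1 q2 => /= q1 q2; [have := q2 isT; lia|rewrite ltnW ?q1].
Qed.

(** The point chosen for window z of block B depends on the refinement only through the unit [h];
    this is what allows two refinements to be matched. *)
Lemma placement c l xi r Z p w : 0 < p -> p < Z -> c.+2 <= w ->
  weak_map c l xi (spiral_size r Z) (spiral Z p) ->
  exists2 h, 0 < h & exists th F,
    fits c l (h * p) (r * (2 * w).+1 + w) th F /\
    forall B z, 0 < B -> B <= r -> z < Z -> exists m,
      window Z B c xi z m /\ splits c th F m (B * (2 * w).+1) (h * (w * p + z)).
Proof.
move=> p0 pZ cw [pl ux weak].
pose kappa B := label Z B c l xi.
have kw B : 0 < B -> B <= r -> kappa B <= w /\ odd (kappa B) = odd B.
  move=> B0 Br; split; last exact: (label_odd p0 pZ B0 Br pl ux weak).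
  have := base_lt p0 pZ B0 Br ux; have := run_le l (base Z B c xi 0).+1.
  by rewrite -/(kappa B) /kappa /label; lia.
(* Labels of consecutive blocks are weakly ordered because the base cells are, and distinct because
   their parities differ. *)
have kS B : 0 < B -> B < r -> kappa B < kappa B.+1.
  move=> B0 Br; have [_ o1] := kw B B0 (ltnW Br); have [_ o2] := kw B.+1 isT Br.
  rewrite ltn_neqAle; apply/andP; split.
    by apply/eqP => e; move: o2; rewrite -e o1 /=; case: (odd B).
  apply: run_mono; rewrite ltnS; apply: ltnW.
  have [c1 e1] := baseP p0 pZ B0 (ltnW Br) ux (leq0n Z).
  have [c2 e2] := baseP p0 pZ (isT : 0 < B.+1) Br ux (leq0n Z).
  by apply: (xi_lt ux c1); rewrite e1 e2; case: (B) B0 => //= B' _; nia.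
have kmono B B' : 0 < B -> B < B' -> B' <= r -> kappa B < kappa B'.
  move=> B0; elim: B' => // B' IH; rewrite ltnS leq_eqVlt => /predU1P[e|lt] Br.
    by subst B'; exact: kS.
  by apply: ltn_trans (IH lt (ltnW Br)) (kS _ _ Br); lia.
(* Runs over a block use the prescribed orbits through its windows; all other runs start from
   [first_cell]. *)
pose isB k := [pick B : 'I_r.+1 | (0 < B) && (kappa B == k)].
pose b k := if isB k is Some B then base Z B c xi else fun=> first_cell c l k.
have bE B : 0 < B -> B <= r -> b (kappa B) = base Z B c xi.
  move=> B0 Br; rewrite /b /isB; case: pickP => [B' /andP[B'0 /eqP e]|/(_ (Ordinal (Br : B < r.+1)))].
    have := ltn_ord B'; rewrite ltnS => B'r.
    case: (ltngtP B B') => [lt|lt|->//].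
      by have := kmono _ _ B0 lt B'r; rewrite e ltnn.
    by have := kmono _ _ B'0 lt Br; rewrite e ltnn.
  by rewrite /= B0 eqxx.
have bok k : 2 <= k -> base_ok c l k p (b k).
  move=> k2; rewrite /b /isB; case: pickP => [B /andP[B0 /eqP <-]|_].
    by apply: (base_marks_label p0 pZ B0 _ pl ux weak); rewrite -ltnS.
  exact: first_cell_base.
have [h h0 [th [u1 u2 u3]]] := realize_pattern pl p0 cw bok.
exists h => //; exists th; exists (fun j => embed_label kappa w r (run l j)).
split.
  split.
  - move=> j j0 jc; split.
      rewrite (embed_label_gt0 kw) //=; last by have := run_ge2 l j; lia.
      apply: (leq_trans (embed_label_le _ _ _ _)); rewrite leq_add2l.
      by have := run_le l j; lia.
    have : marker c l (run l j) p w (b (run l j)) 0 < j.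
      by apply: marker_low => //; apply: bok; apply: run_ge2.
    by move=> /(u2 j 0 j0 jc); rewrite muln0.
  - move=> j v j0 jv vc; have := run_mono l jv; rewrite leq_eqVlt => /predU1P[->//|lt].
    by rewrite ltnW // (embed_label_mono kw).
  - move=> j v j0 jc v0 vc; rewrite (embed_label_lt kw) //; exact: (run_lt pl).
  - move=> j v j0 jc v0 vc /(embed_label_inj kw (leqnn r)) e.
    by rewrite (odd_orient _ (embed_label_odd kw _ (leqnn r))); apply: u3.
move=> B z B0 Br zZ; exists (marker c l (kappa B) p w (b (kappa B)) (w * p + z)).
have [W rm bm] := marker_window p0 pZ B0 Br pl ux weak zZ cw.
rewrite bE //; split=> //; split=> j j0 jc jm.
  have : run l j <= kappa B by apply: leq_trans rm; apply: run_mono.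
  rewrite leq_eqVlt => /predU1P[e|lt]; last first.
    by left; rewrite -(embed_label_kappa w kS B0 Br (leqnn r)) (embed_label_lt kw).
  right; rewrite e (embed_label_kappa w kS B0 Br (leqnn r)); split=> //.
  by apply: u1 => //; rewrite e bE.
have : kappa B <= run l j by apply: run_ge_label; apply: leq_ltn_trans bm jm.
rewrite leq_eqVlt => /predU1P[e|lt]; last first.
  by left; rewrite -(embed_label_kappa w kS B0 Br (leqnn r)) (embed_label_lt kw).
right; rewrite -e (embed_label_kappa w kS B0 Br (leqnn r)); split=> //.
by apply: u2 => //; rewrite -e bE.
Qed.

Lemma values_bounded c (th : nat -> nat) : exists H, forall j, j <= c -> th j <= H.
Proof.
exists (\sum_(j <- iota 0 c.+1) th j) => j jc.
have jin : j \in iota 0 c.+1 by rewrite mem_iota; lia.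
by rewrite (big_rem j jin) leq_addr.
Qed.

(** Realize [A] by a translation of length [h] and replace each unit by a group of four cells, so
    that [p] is [h]. The runs of [A] become the blocks, with their labels unchanged. *)
Lemma spiral_over a lA : pattern a lA -> exists r Z p R,
  [/\ 0 < p, p < Z, strict_map (spiral_size r Z) (spiral Z p) R a lA &
   exists v : nat -> nat,
    (forall j x, 0 < j -> j <= a -> (v j <= x) = (j <= R x)) /\
    forall j, 0 < j -> j.+1 <= a -> exists B z, [/\ 0 < B, B <= r, z < Z,
      v j <= 4 * (B.-1 * Z.+1 + z) + 1 & 4 * (B.-1 * Z.+1 + z) + 3 < v j.+1]].
Proof.
move=> pA; have [h h0 [th [u1 u2 u3]]] := @realize_pattern a lA 1 a.+2
  (fun k _ => first_cell a lA k) pA isT (leqnn _) (fun k k2 => first_cell_base 1 pA k2).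
have [H Hth] := values_bounded a th.
pose Z := H + h + 3; pose r := run lA a; have hZ : h < Z by lia.
have thZ j : j <= a -> th j < Z by move=> /Hth; lia.
have r0 j : 0 < run lA j by have := run_ge2 lA j; lia.
(* Here 4 th j + 5 = 4 (th j + 1) + 1, so a cut of [A] is the lower end of the window [th j + 1] of
   its block. The window [th j] just below it contains no cut of [A] inside, which gives the
   separating windows. *)
pose Y j := (run lA j).-1 * Z.+1; pose v j := 4 * Y j + (4 * th j + 5).
have vE j : v j = (run lA j).-1 * (4 * Z.+1) + (4 * th j + 5).
  by rewrite /v /Y mulnCA.
have vB j : j <= a -> block_of (4 * Z.+1) (v j) = run lA j.
  by move=> ja; rewrite vE block_ofE ?prednK //; have := thZ j ja; lia.
have gap j : 0 < j -> j.+1 <= a -> v j <= 4 * (Y j.+1 + th j.+1) + 1.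
  move=> j0 ja; have := run_mono lA (leqnSn j); rewrite leq_eqVlt => /predU1P[e|lt].
    have [|||||] := u3 j j.+1 => //; [lia|move=> /(_ (leqnn _)) lt _ _].
    by rewrite /v /Y e; lia.
  have := thZ j (ltnW ja); have : Y j + Z.+1 <= Y j.+1.
    rewrite /Y addnC -mulSn leq_mul2r prednK //; have := r0 j; lia.
  by rewrite /v; lia.
have vlt i j : 0 < i -> i < j -> j <= a -> v i < v j.
  move=> i0; elim: j => // j IH ij ja; have [e|ne] := eqVneq i j.
    by subst i; have := gap j i0 ja; rewrite /v; lia.
  apply: (@ltn_trans (v j)); first by apply: IH; lia.
  have j0 : 0 < j by lia.
  by have := gap j j0 ja; rewrite /v; lia.
exists r, Z, h.
have rr j : j <= a -> run lA j <= r by apply: run_mono.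
have [ | | |u cell_rel XP] := restrict_pattern (t := v) (@spiral_pattern r Z h h0 hZ) pA.
- move=> j j0 ja; rewrite {1}/v addn_gt0 !addnS /= orbT vE /spiral_size.
  have : (run lA j).-1.+1 * (4 * Z.+1) <= r * (4 * Z.+1).
    by rewrite leq_mul2r prednK // rr // orbT.
  rewrite mulSn; have := thZ j ja.
  by move: (_.-1 * _) (r * _) => x y; lia.
- exact: vlt.
- move=> j w j0 ja w0 wa; rewrite /spiral /glue !vB //.
  case: (ltngtP (run lA j) (run lA w)) => [lt|lt|e] /=.
  + by case/andP: (run_lt pA j0 w0 lt).
  + by case/andP: (run_lt pA w0 j0 lt) => _ /negbTE.
  + have := u3 j w j0 ja w0 wa e; have := u3 w j w0 wa j0 ja (esym e).
    have ee : Y j = Y w by rewrite /Y e.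
    have d1 : (v w).-1 %/ 4 = Y w + th w + 1 by rewrite /v; lia.
    have d2 : (v j).-1 %/ 4 = Y j + th j + 1 by rewrite /v; lia.
    rewrite /spiral_shift d1 d2 /v ee muln1 /orient /flip e.
    case: ifP => _ [_ q1 q2] [_ q3 q4].
      by case: (lA j w) q3 q4 => /= q3 q4; [have := q3 isT|have := q4 isT]; lia.
    by case: (lA j w) q1 q2 => /= q1 q2; [have := q2 isT|have := q1 isT]; lia.
exists (fun x => upto_count a (fun j => v j <= x)); split=> //; first by split=> //; apply: spiral_pattern.
exists v; split=> // j j0 ja; exists (run lA j.+1), (th j.+1); split=> //.
- exact: rr.
- exact: thZ.
- exact: gap.
- by rewrite /v -/(Y j.+1); lia.
Qed.

(** Were [R y0] and [R y1] two apart, a whole cell of [A], hence a window of the spiral, would lie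
    between [y0] and [y1]. The marker of this window has the same position in both refinements, and
    [x] would be on both sides of it. *)
Theorem pattern_amalgamation a lA : pattern a lA -> exists n lP R,
  strict_map n lP R a lA /\
  forall c0 l0 xi0 c1 l1 xi1, weak_map c0 l0 xi0 n lP -> weak_map c1 l1 xi1 n lP ->
  exists d lD X0 X1, [/\ strict_map d lD X0 c0 l0, strict_map d lD X1 c1 l1 &
    forall x y0 y1, x <= d -> incident y0 (xi0 (X0 x)) -> incident y1 (xi1 (X1 x)) ->
      R y0 <= (R y1).+1 /\ R y1 <= (R y0).+1].
Proof.
move=> pA; have [r [Z [p [R [p0 pZ sR [v [vR vsep]]]]]]] := spiral_over pA.
exists (spiral_size r Z), (spiral Z p), R; split=> // c0 l0 xi0 c1 l1 xi1 wk0 wk1.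
pose w := c0 + c1 + 2.
have [|h0 h0p [th0 [F0 [f0 s0]]]] := placement (w := w) p0 pZ _ wk0; first by lia.
have [|h1 h1p [th1 [F1 [f1 s1]]]] := placement (w := w) p0 pZ _ wk1; first by lia.
(* Each placement is scaled by the unit of the other one, so that both use the same translation
   [q]. *)
have {f0} := fits_scale h1p f0; have {f1} := fits_scale h0p f1.
rewrite [h0 * (h1 * p)]mulnCA => f1 f0; set q := h1 * (h0 * p) in f0 f1.
pose g0 j := h1 * th0 j; pose g1 j := h0 * th1 j.
have [H0 b0] := values_bounded c0 g0; have [H1 b1] := values_bounded c1 g1.
pose H := H0 + H1 + h0 * (h1 * (w * p + Z)) + 1; pose M := r * (2 * w).+1 + w.
have Hp : 0 < H by lia.
have g0H j : 0 < j -> j <= c0 -> g0 j <= H by move=> _ /b0; lia.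
have g1H j : 0 < j -> j <= c1 -> g1 j <= H by move=> _ /b1; lia.
have [m0 E0] := ambient_restrict Hp (let: And3 p _ _ := wk0 in p) f0 g0H.
have [m1 E1] := ambient_restrict Hp (let: And3 p _ _ := wk1 in p) f1 g1H.
set X0 := (fun x => upto_count c0 _) in m0 E0; set X1 := (fun x => upto_count c1 _) in m1 E1.
exists (M * H), (ambient H q), X0, X1; split=> // x y0 y1 xd n0 n1.
have sep B z : 0 < B -> B <= r -> z < Z -> exists V,
    (exists m, window Z B c0 xi0 z m /\ (X0 x < m -> x < V) /\ (m < X0 x -> V < x)) /\
    (exists m, window Z B c1 xi1 z m /\ (X1 x < m -> x < V) /\ (m < X1 x -> V < x)).
  (* [P] is the offset of the marker in the common unit [h0 * h1], and [B * (2 * w).+1] is the block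
     reserved for [B] in both placements. *)
  move=> B0 Br zZ; pose P := h1 * (h0 * (w * p + z)).
  have PH : P <= H.
    have : P <= h0 * (h1 * (w * p + Z)).
      by rewrite /P [h1 * (h0 * _)]mulnCA !leq_mul2l leq_add2l (ltnW zZ) !orbT.
    by lia.
  pose b := B * (2 * w).+1; have bp : 0 < b by rewrite /b; nia.
  exists (b.-1 * H + P).
  have aux c F (g : nat -> nat) X : ustep (M * H) c X ->
      (forall j, 0 < j -> j <= c -> 0 < F j <= M /\ 0 < g j) ->
      (forall j, 0 < j -> j <= c -> g j <= H) ->
      (forall j x, 0 < j -> j <= c -> ((F j).-1 * H + g j <= x) = (j <= X x)) ->
      forall m, m <= c -> splits c g F m b P ->
      (X x < m -> x < b.-1 * H + P) /\ (m < X x -> b.-1 * H + P < x).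
    move=> u Fg gH XE m mc [sp1 sp2]; split=> lt.
      have jc : (X x).+1 <= c by lia.
      have : x < (F (X x).+1).-1 * H + g (X x).+1 by rewrite ltnNge XE // ltnn.
      have [/andP[Fp _] _] := Fg _ (ltn0Sn _) jc; have gj := gH _ (ltn0Sn _) jc.
      case: (sp1 _ (ltn0Sn _) jc lt) => [Fb|[-> gP]]; last by lia.
      have : (F (X x).+1).-1.+1 * H <= b.-1 * H by rewrite leq_mul2r; lia.
      by rewrite mulSn; move: (_.-1 * H) (b.-1 * H) => s t; lia.
    have jc : X x <= c by apply: (ustep_le u).
    have j0 : 0 < X x by lia.
    have : (F (X x)).-1 * H + g (X x) <= x by rewrite XE.
    have [/andP[Fp _] gp] := Fg _ j0 jc.
    case: (sp2 _ j0 jc lt) => [Fb|[<- gP]]; last by lia.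
    have : b.-1.+1 * H <= (F (X x)).-1 * H by rewrite leq_mul2r; lia.
    by rewrite mulSn; move: ((F (X x)).-1 * H) (b.-1 * H) => s t; lia.
  split.
    have [m [W sp]] := s0 B z B0 Br zZ; exists m; split=> //.
    case: m0 f0 => _ u _ [fa _ _ _]; apply: (aux _ _ _ _ u fa g0H E0).
      by case/and3P: W.
    exact: splits_scale.
  have [m [W sp]] := s1 B z B0 Br zZ; exists m; split=> //.
  case: m1 f1 => _ u _ [fa _ _ _]; apply: (aux _ _ _ _ u fa g1H E1).
    by case/and3P: W.
  by rewrite /P mulnCA; apply: splits_scale.
have [u0 u1] : ustep c0 (2 * spiral_size r Z) xi0 /\ ustep c1 (2 * spiral_size r Z) xi1.
  by case: wk0 wk1 => _ + _ [_ + _].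
have X0c : X0 x <= c0 by apply: upto_count_le.
have X1c : X1 x <= c1 by apply: upto_count_le.
have close (c c' : nat) xi xi' X X' y y' : incident y (xi X) -> incident y' (xi' X') ->
   X <= c -> X' <= c' ->
   ustep c (2 * spiral_size r Z) xi -> ustep c' (2 * spiral_size r Z) xi' ->
   (forall B z, 0 < B -> B <= r -> z < Z -> exists V,
    (exists m, window Z B c xi z m /\ (X < m -> x < V) /\ (m < X -> V < x)) /\
    (exists m, window Z B c' xi' z m /\ (X' < m -> x < V) /\ (m < X' -> V < x))) ->
   R y <= (R y').+1.
  move=> /andP[n1a n1b] /andP[n2a n2b] Xc Xc' u u' sp; rewrite leqNgt; apply/negP => lt.
  (* The cell [(R y).-1] of [A] lies strictly between [R y'] and [R y], so the window inside it lies
     between [y'] and [y]. *)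
  have j0 : 0 < (R y).-1 by lia.
  have yn : y <= spiral_size r Z by have := ustep_le u Xc; lia.
  have ja : (R y).-1.+1 <= a by case: sR => _ uR _; have := ustep_le uR yn; lia.
  have [B [z [B0 Br zZ v1 v2]]] := vsep _ j0 ja.
  have [V [[m [W [_ a2]]] [m' [W' [b1' _]]]]] := sp B z B0 Br zZ.
  have v3 : v (R y).-1.+1 <= y by rewrite vR //; lia.
  have v4 : y' < v (R y).-1 by rewrite ltnNge vR //; lia.
  case/and3P: W W' => mc w1 w2 /and3P[mc' w1' w2'].
  have : m < X by apply: (xi_lt u mc); lia.
  have : X' < m' by apply: (xi_lt u' Xc'); lia.
  by move=> /b1' ? /a2; lia.
split; first exact: (close c0 c1 xi0 xi1 (X0 x) (X1 x)).
apply: (close c1 c0 xi1 xi0 (X1 x) (X0 x)) => // B z B0 Br zZ.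
by have [V [? ?]] := sep B z B0 Br zZ; exists V.
Qed.

(** * Paths as intervals of integers *)

Section Rank.
Variable K : rpath.
Implicit Types x y z : K.

Definition rank x := #|[set y : K | rpath_le y x && (y != x)]|.
Definition height := #|{: K}|.-1.

Lemma rank_lt x y : rpath_le x y -> x != y -> rank x < rank y.
Proof.
case: (rpath_le_linear K) => refl anti trans _ xy ne.
apply/proper_card/properP; split.
  apply/fintype.subsetP => z; rewrite !inE => /andP[zx zne]; rewrite (trans _ _ _ zx xy) /=.
  by apply: contra zne => /eqP zy; apply/eqP/anti; rewrite zx zy xy.
by exists x; rewrite !inE ?xy ?ne // eqxx andbF.
Qed.

Lemma rank_inj : injective rank.
Proof.
move=> x y e; apply/eqP; apply: contraT => ne.
have [_ _ _ /(_ x y)/orP[]] := rpath_le_linear K => xy.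
  by have := rank_lt xy ne; rewrite e ltnn.
by have := rank_lt xy; rewrite eq_sym ne e ltnn => /(_ isT).
Qed.

Lemma card_rpath : #|{: K}| = height.+1.
Proof. by rewrite prednK //; apply/card_gt0P; exists (Defs.root K). Qed.

Lemma rank_le x : rank x <= height.
Proof.
rewrite -ltnS -card_rpath -cardsT; apply/proper_card/properP; split.
  by apply/fintype.subsetP => z; rewrite finset.in_setT.
by exists x; rewrite ?finset.in_setT // !inE eqxx andbF.
Qed.

Lemma rank_surj n : n <= height -> exists x, rank x = n.
Proof.
rewrite -ltnS => nh; pose f x : 'I_height.+1 := inord (rank x).
have fE x : f x = rank x :> nat by rewrite inordK // ltnS rank_le.
have inj : injective f by move=> x y e; apply: rank_inj; rewrite -!fE e.
have [|g fK gK] := inj_card_bij inj; first by rewrite card_ord card_rpath.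
by exists (g (Ordinal nh)); rewrite -fE gK.
Qed.

Definition unrank n := odflt (Defs.root K) [pick x : K | rank x == n].

Lemma unrankK n : n <= height -> rank (unrank n) = n.
Proof.
move=> /rank_surj[x e]; rewrite /unrank; case: pickP => [y /eqP//|/(_ x)].
by rewrite e eqxx.
Qed.

Lemma rankK x : unrank (rank x) = x.
Proof. by apply: rank_inj; rewrite unrankK ?rank_le. Qed.

Lemma rank_root : rank (Defs.root K) = 0.
Proof.
case: (rpath_le_linear K) => _ anti _ _.
apply/eqP; rewrite cards_eq0; apply/eqP/finset.setP => y; rewrite !inE.
apply/negP => /andP[yr /eqP ne]; apply: ne; apply: anti.
by rewrite yr root_min.
Qed.

Lemma rank_mono x y : rank x <= rank y -> rpath_le x y.
Proof.
have [refl _ _ /(_ x y)/orP[//|yx]] := rpath_le_linear K.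
have [->//|ne] := eqVneq y x.
by have := rank_lt yx ne; lia.
Qed.

Lemma rank_le_mono x y : rpath_le x y -> rank x <= rank y.
Proof. by move=> xy; have [->//|/(rank_lt xy)/ltnW] := eqVneq x y. Qed.

Lemma rank_adj_succ x y : rank y = (rank x).+1 -> adj x y.
Proof.
move=> e; apply: rpath_le_compat; split.
- by apply: rank_mono; lia.
- by apply/eqP => xy; move: e; rewrite xy; lia.
- move=> z /rank_le_mono xz /rank_le_mono zy.
  have [/rank_inj->|/rank_inj->] : rank z = rank x \/ rank z = rank y; first lia.
    by left.
  by right.
Qed.

(** An edge skipping a vertex would close the chain of immediate successors into a cycle. *)
Lemma rank_adj_le x y : rank x <= rank y -> adj x y -> rank y <= (rank x).+1.
Proof.
move=> xy axy; rewrite leqNgt; apply/negP => lt.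
pose c := [seq unrank i | i <- iota (rank x) (rank y - rank x).+1].
have in_le i : i \in iota (rank x) (rank y - rank x).+1 -> i <= height.
  by rewrite mem_iota; have := rank_le y; lia.
have sc : 2 < size c by rewrite size_map size_iota; lia.
have /negP[] := rpath_acyclic sc.
apply/andP; split; last first.
  rewrite map_inj_in_uniq ?iota_uniq // => i j /in_le ih /in_le jh e.
  by rewrite -(unrankK ih) e unrankK.
have step i : rank x <= i < rank y -> adj (unrank i) (unrank i.+1).
  move=> /andP[_ iy]; have := rank_le y => yh.
  by apply: rank_adj_succ; rewrite !unrankK //; lia.
rewrite /c /= rankK rcons_path; apply/andP; split.
  have : forall m i, rank x <= i -> i + m <= rank y ->
      path adj (unrank i) [seq unrank i | i <- iota i.+1 m].
    by elim=> // m IH i xi iy /=; rewrite step ?IH //; lia.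
  by move=> /(_ (rank y - rank x) (rank x)); rewrite rankK; apply; lia.
rewrite -{1}(rankK x) last_map -nth_last size_iota nth_iota; last by lia.
have -> : (rank x).+1 + (rank y - rank x).-1 = rank y by lia.
by rewrite rankK adj_sym.
Qed.

Lemma rank_adj x y : adj x y = (rank x <= (rank y).+1) && (rank y <= (rank x).+1).
Proof.
apply/idP/andP => [a|[xy yx]].
  case/orP: (leq_total (rank x) (rank y)) => le.
    by have := rank_adj_le le a; lia.
  by have := rank_adj_le le; rewrite adj_sym => /(_ a); lia.
case: (ltngtP (rank x) (rank y)) => [lt|lt|/rank_inj->]; last exact: adj_refl.
  by apply: rank_adj_succ; lia.
by rewrite adj_sym; apply: rank_adj_succ; lia.
Qed.

Definition convex (X : {set K}) :=
  forall x y n, x \in X -> y \in X -> rank x <= n <= rank y -> unrank n \in X.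

Lemma connected_convex X : connected_set X -> convex X.
Proof.
move=> con x y n xX yX /andP[xn ny]; have /connectP[s ps ly] := con x y xX yX.
subst y; elim: s x ps xX xn ny {yX} => [|z s IH] x /=.
  move=> _ xX xn nx; have -> : n = rank x by lia.
  by rewrite rankK.
move=> /andP[/and3P[_ zX axz] ps] xX xn ns.
have [nx|nx] := leqP n (rank x).
  have -> : n = rank x by lia.
  by rewrite rankK.
by apply: (IH z) => //; move: axz; rewrite rank_adj; lia.
Qed.

Lemma convex_connected X : convex X -> connected_set X.
Proof.
move=> cv; pose e := fun a b : K => [&& a \in X, b \in X & adj a b].
have esym : connect_sym e.
  by apply: sym_connect_sym => a b; rewrite /e adj_sym; case: (a \in X); case: (b \in X).
have main m x y : rank y = rank x + m -> x \in X -> y \in X -> connect e x y.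
  elim: m x => [|m IH] x E xX yX.
    by have -> : x = y by apply: rank_inj; lia.
  have yh := rank_le y; have zX : unrank (rank x).+1 \in X by apply: (cv x y) => //; lia.
  apply: (@connect_trans _ _ (unrank (rank x).+1)).
    by apply: connect1; rewrite /e xX zX rank_adj unrankK; lia.
  by apply: IH => //; rewrite unrankK; lia.
move=> x y xX yX; rewrite -/e.
case/orP: (leq_total (rank x) (rank y)) => le.
  by apply: (main (rank y - rank x)) => //; lia.
by rewrite esym; apply: (main (rank x - rank y)) => //; lia.
Qed.

End Rank.

Section StandardPath.
Variable n : nat.

Definition path_adj : rel 'I_n.+1 := fun i j => (i <= j.+1) && (j <= i.+1).

Lemma path_adj_refl : reflexive path_adj.
Proof. by move=> i; rewrite /path_adj; lia. Qed.

Lemma path_adj_sym : symmetric path_adj.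
Proof. by move=> i j; rewrite /path_adj andbC. Qed.

Definition path_graph := Graph path_adj_refl path_adj_sym.

(** At the largest vertex of a cycle both neighbours must be its predecessor, so they coincide. *)
Lemma path_acyclic : acyclic path_graph.
Proof.
move=> c sz; apply/negP => /andP[cyc unq].
have [x0 x0c] : exists x, x \in c by case: c sz {cyc unq} => // x c _; exists x; rewrite mem_head.
pose m : 'I_n.+1 := [arg max_(i > x0 in c) (i : nat)].
have [mc mM] : m \in c /\ forall x, x \in c -> x <= m.
  by rewrite /m; case: arg_maxnP.
have [k s E] := rot_to mc.
have {cyc} : cycle path_adj (m :: s) by rewrite -E rot_cycle.
have {unq} : uniq (m :: s) by rewrite -E rot_uniq.
have {sz} : 1 < size s by move: sz; rewrite -(size_rot k c) E.
have {mM} sM x : x \in s -> x <= m.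
  by move=> xs; apply: mM; rewrite -(mem_rot k) E inE xs orbT.
case: s sM {E} => // a s sM sz /= /and3P[mas as_ _] /andP[ma].
rewrite rcons_path => /andP[_ lm].
have ls : last a s \in s by case: s sz {mas as_ lm sM ma} => //= b s _; apply: mem_last.
have aE : a = m.-1 :> nat.
  have := sM a (mem_head _ _); have : m != a by apply: contra mas => /eqP->; apply: mem_head.
  by move: ma; rewrite /path_adj -val_eqE /=; lia.
have lE : last a s = m.-1 :> nat.
  have lI : last a s \in a :: s by rewrite inE ls orbT.
  have := sM _ lI; have : m != last a s by apply: contra mas => /eqP->.
  by move: lm; rewrite /path_adj -val_eqE /=; lia.
by move/negP: as_; apply; have -> : a = last a s by apply: val_inj; rewrite /= aE lE.
Qed.

Lemma path_degree (x : path_graph) : #|[set y : path_graph | adj x y & y != x]%SET| <= 2.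
Proof.
have sub : [set y : path_graph | adj x y & y != x] \subset [set (inord x.-1 : 'I_n.+1); (inord x.+1 : 'I_n.+1)].
  apply/fintype.subsetP => y; rewrite !inE -!val_eqE /adj /= /path_adj => /andP[/andP[a b] c].
  have yn := ltn_ord y; case: (ltngtP y x) c => // lt _; apply/orP; [left|right];
    rewrite inordK; lia.
by apply: leq_trans (subset_leq_card sub) _; rewrite cards2; case: (_ != _).
Qed.

Lemma path_le_linear : @linear_order 'I_n.+1 (fun i j => i <= j).
Proof.
split; [exact: leqnn| |by move=> j i k; apply: leq_trans|by move=> i j; apply: leq_total].
by move=> i j ij; apply: val_inj; apply: anti_leq.
Qed.

Lemma path_le_compat (x y : path_graph) :
  immediate_succ (fun i j : 'I_n.+1 => i <= j) x y -> adj x y.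
Proof.
move=> [xy ne H]; rewrite /adj /= /path_adj; move: ne; rewrite -val_eqE /= => ne.
have [le|gt] := leqP y x.+1; first by lia.
have yn := ltn_ord y; have := H (inord x.+1); rewrite inordK; last by lia.
have e : (inord x.+1 : 'I_n.+1) = x.+1 :> nat by rewrite inordK; lia.
by move=> []; [lia|lia| |] => /(congr1 val) /=; rewrite e; lia.
Qed.

Lemma path_connected : connected_set [set: path_graph]%SET.
Proof.
move=> x y _ _; pose e := fun a b : path_graph =>
  [&& a \in [set: path_graph]%SET, b \in [set: path_graph]%SET & adj a b].
rewrite -/e.
have esym : connect_sym e by apply: sym_connect_sym => a b; rewrite /e !inE adj_sym.
have main m (i j : 'I_n.+1) : j = i + m :> nat -> connect e i j.
  elim: m i => [|m IH] i E; first by have -> : i = j by apply: val_inj => /=; lia.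
  have jn := ltn_ord j.
  have iE : (inord i.+1 : 'I_n.+1) = i.+1 :> nat by rewrite inordK; lia.
  apply: (@connect_trans _ _ (inord i.+1)); last by apply: IH; lia.
  by apply: connect1; rewrite /e !inE /adj /= /path_adj iE; lia.
case/orP: (leq_total (x : nat) y) => le.
  by apply: (main (y - x)); lia.
by rewrite esym; apply: (main (x - y)); lia.
Qed.

Definition standard_path : rpath :=
  @RPath path_graph path_connected path_acyclic path_degree _ path_le_linear
    path_le_compat ord0 (fun=> leq0n _).

Lemma standard_path_height : height standard_path = n.
Proof. by rewrite /height card_ord. Qed.

End StandardPath.

(** * Morphisms of paths as monotone maps *)

(* [phi b] encodes, as in [incident], the vertex or the edge related to b. *)
Definition code k l (phi : nat -> nat) :=
  [/\ phi 0 = 0, phi l = 2 * k &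
   forall i, i < l -> phi i <= phi i.+1 <= 2 * (phi i)./2 + 2].

Lemma code_mono k l phi i j : code k l phi -> i <= j -> j <= l -> phi i <= phi j.
Proof.
case=> _ _ step; elim: j => [|j IH] ij jl; first by have -> : i = 0 by lia.
by have [->//|ne] := eqVneq i j.+1; have := step j; lia.
Qed.

Lemma code_even k l phi j : code k l phi -> j <= k -> exists2 i, i <= l & phi i = 2 * j.
Proof.
move=> [p0 pl step] jk; have : 2 * j <= phi l by rewrite pl; lia.
elim: l step {pl} => [|l IH] step le; first by exists 0; lia.
have [le'|lt] := leqP (2 * j) (phi l).
  by have [i il e] := IH (fun i il => step i (ltnW il)) le'; exists i => //; lia.
by exists l.+1 => //; have := step l; lia.
Qed.

Lemma code_le k l phi i : code k l phi -> i <= l -> phi i <= 2 * k.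
Proof. by move=> c il; case: (c) => _ <- _; apply: (code_mono c). Qed.

Lemma ustep_code k l X : ustep l (2 * k) X -> code k l X.
Proof. by case=> X0 Xl step; split=> // i il; have := step i il; lia. Qed.

(** Extends a code from the vertices, at arguments 2b, to the edges, at arguments 2b + 1. A jump
    from one vertex to the next now passes through the edge, so all steps are at most 1. *)
Definition doubled_code (phi : nat -> nat) x :=
  if odd x then (if phi x./2 == phi x./2.+1 then phi x./2 else 2 * (phi x./2)./2 + 1)
  else phi x./2.

Lemma doubled_code_even phi b : doubled_code phi (2 * b) = phi b.
Proof. by rewrite /doubled_code oddM /= mul2n doubleK. Qed.

Lemma doubled_code_odd phi b : doubled_code phi (2 * b).+1 =
  if phi b == phi b.+1 then phi b else 2 * (phi b)./2 + 1.
Proof. by rewrite /doubled_code /= oddM /= mul2n uphalf_double. Qed.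

Lemma even_odd_cases x : exists b, x = 2 * b \/ x = (2 * b).+1.
Proof. by exists x./2; lia. Qed.

Lemma doubled_code_ustep k l phi : code k l phi -> ustep (2 * l) (2 * k) (doubled_code phi).
Proof.
case=> p0 pl step; split; [by rewrite -[0]/(2 * 0) doubled_code_even|by rewrite doubled_code_even|].
move=> x; have [b [->|->]] := even_odd_cases x => xl.
  have := step b; rewrite doubled_code_even doubled_code_odd; case: eqP => [->|ne]; lia.
have -> : (2 * b).+2 = 2 * b.+1 by lia.
have := step b; rewrite doubled_code_even doubled_code_odd; case: eqP => [->|ne]; lia.
Qed.

Lemma doubled_code_incident k l phi y c u : code k l phi -> u <= 2 * l ->
  incident c u -> incident y (phi c) -> incident y (doubled_code phi u).
Proof.
case=> _ _ step ul; have [b [uE|uE]] := even_odd_cases u; rewrite uE /incident.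
  by rewrite doubled_code_even => /andP[? ?]; have -> : c = b by lia.
move=> /andP[c1 c2]; have := step b; rewrite doubled_code_odd.
have [->|->] : c = b \/ c = b.+1 by lia.
  by case: eqP => [->|ne]; lia.
by case: eqP => [->|ne]; lia.
Qed.

Lemma rpiE (A B : finType) (R : {set A * B}) b a :
  rpi R b = Some a <-> forall a', ((a', b) \in R) = (a' == a).
Proof.
rewrite /rpi; split.
  by case: pickP => // x /forallP H [<-] a'; apply/eqP/H.
move=> H; case: pickP => [x /forallP/(_ a)|/(_ a)/forallP[] a']; last by rewrite H.
by rewrite H eqxx => /eqP/esym/eqP ->.
Qed.

Lemma rcompP (A B C : finType) (R : {set A * B}) (S : {set B * C}) a c :
  reflect (exists2 b, (a, b) \in R & (b, c) \in S) ((a, c) \in rcomp R S).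
Proof.
rewrite inE; apply: (iffP existsP) => [[b /andP[]]|[b ab bc]]; exists b => //.
by apply/andP.
Qed.

Lemma rimageP (A B : finType) (R : {set A * B}) (X : {set A}) b :
  reflect (exists2 a, a \in X & (a, b) \in R) (b \in rimage X R).
Proof.
rewrite inE; apply: (iffP existsP) => [[a /andP[]]|[a aX ab]]; exists a => //.
by apply/andP.
Qed.

Lemma I_mor_comp (K L M : rpath) (R : {set K * L}) (S : {set L * M}) :
  I_mor R -> I_mor S -> I_mor (rcomp R S).
Proof.
move=> [[[sR iR] eR] mR /rpiE rR] [[[sS iS] eS] mS /rpiE rS]; split.
- split; first split.
  + move=> c; have [b bc] := sS c; have [a ab] := sR b.
    by exists a; apply/rcompP; exists b.
  + move=> a; have [b [ab ub]] := iR a; have [c [bc uc]] := iS b.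
    exists c; split; first by apply/rcompP; exists b.
    by move=> a' /rcompP[b' ab' /uc e]; apply: ub; rewrite -e.
  + move=> a0 a1 c0 c1 /rcompP[b0 ab0 bc0] /rcompP[b1 ab1 bc1] /(eS _ _ _ _ bc0 bc1).
    exact: eR.
- move=> X /mR /mS; congr connected_set; apply/finset.setP => c.
  apply/rimageP/rimageP => [[b /rimageP[a aX ab] bc]|[a aX /rcompP[b ab bc]]].
    by exists a => //; apply/rcompP; exists b.
  by exists b => //; apply/rimageP; exists a.
- apply/rpiE => a; apply/rcompP/idP => [[b ab]|].
    by rewrite rS => /eqP e; rewrite -rR -e.
  by move=> e; exists (Defs.root L); rewrite ?rR ?rS.
Qed.

Lemma bonds_mor (F : fraisse_sequence) m k : I_mor (bonds (@fbond F) m k).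
Proof.
elim: k => [|k IH]; first exact: I_mor_id.
exact: (I_mor_comp IH (@fbond_mor F (k + m))).
Qed.

Definition coded (K L : rpath) (R : {set K * L}) phi :=
  code (height K) (height L) phi /\
  forall a b, ((a, b) \in R) = incident (rank a) (phi (rank b)).

Lemma coded_mor (K L : rpath) (R : {set K * L}) phi : coded R phi -> I_mor R.
Proof.
move=> [c RE]; case: (c) => p0 pl step; split.
- split; first split.
  + move=> b; have := code_le c (rank_le b) => le.
    exists (unrank K (phi (rank b))./2).
    by rewrite RE unrankK; rewrite /incident; lia.
  + move=> a; have [i il e] := code_even c (rank_le a).
    exists (unrank L i); rewrite RE unrankK // e; split; first by rewrite /incident; lia.
    move=> a'; rewrite RE unrankK // e => n; apply: rank_inj.
    by move: n; rewrite /incident; lia.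
  + move=> a0 a1 b0 b1; rewrite !RE !rank_adj /incident => n0 n1 b01.
    have [e|[e|e]] : rank b1 = rank b0 \/ rank b1 = (rank b0).+1 \/ rank b0 = (rank b1).+1 by lia.
    * by rewrite e in n1; lia.
    * by rewrite e in n1; have := step (rank b0); have := rank_le b1; lia.
    * by rewrite e in n0; have := step (rank b1); have := rank_le b0; lia.
- move=> X /connected_convex cX; apply: convex_connected => b1 b2 n.
  move=> /rimageP[a1 a1X]; rewrite RE => r1 /rimageP[a2 a2X]; rewrite RE => r2 /andP[n1 n2].
  have nh : n <= height L by have := rank_le b2; lia.
  have m1 := code_mono c n1 nh; have m2 := code_mono c n2 (rank_le b2).
  apply/rimageP; rewrite /incident in r1 r2.
  have [le|gt] := leqP (phi n)./2 (rank a1).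
    by exists a1 => //; rewrite RE unrankK // /incident; lia.
  exists (unrank K (phi n)./2); first by apply: (cX a1 a2) => //; lia.
  have := code_le c nh => ?.
  by rewrite RE !unrankK //; rewrite /incident; lia.
- apply/rpiE => a; rewrite RE rank_root p0 /incident.
  rewrite -(inj_eq (@rank_inj K)) rank_root; lia.
Qed.

Definition coded_rel (K L : rpath) (phi : nat -> nat) : {set K * L} :=
  [set q | incident (rank q.1) (phi (rank q.2))]%SET.

Lemma coded_relP (K L : rpath) phi : code (height K) (height L) phi ->
  coded (coded_rel K L phi) phi.
Proof. by move=> c; split=> // a b; rewrite inE. Qed.

(** Edge preservation at loops leaves each vertex at most two relatives, which are adjacent.
    Monotonicity, applied to initial and final segments, makes these relatives increase. *)
Lemma mor_coded (K L : rpath) (R : {set K * L}) : I_mor R -> exists phi, coded R phi.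
Proof.
move=> [[[sR iR] eR] mR /rpiE rR].
set k := height K; set l := height L.
have near1 a a' b : (a, b) \in R -> (a', b) \in R -> rank a' <= (rank a).+1.
  by move=> ab a'b; have := eR _ _ _ _ ab a'b (adj_refl b); rewrite rank_adj => /andP[].
have low a b b' : (a, b') \in R -> rank b <= rank b' ->
    exists2 a', (a', b) \in R & rank a' <= rank a.
  move=> ab bb'; pose X := [set x : K | rank x <= rank a].
  have /mR/connected_convex cv : connected_set X.
    apply: convex_connected => x y n; rewrite !inE => xa ya xny.
    by rewrite unrankK; [lia|have := rank_le y; lia].
  have : unrank L (rank b) \in rimage X R.
    apply: (cv (Defs.root L) b'); rewrite ?rank_root //.
      by apply/rimageP; exists (Defs.root K); rewrite ?inE ?rank_root // rR.
    by apply/rimageP; exists a; rewrite // inE.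
  by rewrite rankK => /rimageP[x]; rewrite inE => xa xb; exists x.
(* Some vertex of L is related only to the last vertex of K. If the last vertex of L had a smaller
   relative, [low] would give that vertex a smaller one too. This anchors final segments as the root
   anchors initial ones. *)
have last a : (a, unrank L l) \in R -> rank a = k.
  move=> al; apply/eqP; rewrite eqn_leq rank_le leqNgt; apply/negP => lt.
  have [b [kb ub]] := iR (unrank K k).
  have [||a' a'b le] := @low a b (unrank L l) => //.
    by rewrite unrankK ?rank_le.
  by have := ub _ a'b => e; move: le; rewrite e unrankK //; lia.
have high a b b' : (a, b) \in R -> rank b <= rank b' ->
    exists2 a', (a', b') \in R & rank a <= rank a'.
  move=> ab bb'; pose X := [set x : K | rank a <= rank x].
  have /mR/connected_convex cv : connected_set X.
    apply: convex_connected => x y n; rewrite !inE => xa ya xny.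
    by rewrite unrankK; [lia|have := rank_le y; lia].
  have : unrank L (rank b') \in rimage X R.
    apply: (cv b (unrank L l)); last by rewrite unrankK // bb' rank_le.
      by apply/rimageP; exists a; rewrite // inE.
    have [a' a'l] := sR (unrank L l); apply/rimageP; exists a' => //.
    by rewrite inE (last _ a'l) rank_le.
  by rewrite rankK => /rimageP[x]; rewrite inE => xa xb; exists x.
pose P b i := (unrank K i, b) \in R.
pose lo b := find (P b) (iota 0 k.+1).
have loP b : [/\ lo b <= k, P b (lo b) & forall a, (a, b) \in R -> lo b <= rank a].
  have h : has (P b) (iota 0 k.+1).
    have [a ab] := sR b; apply/hasP; exists (rank a); last by rewrite /P rankK.
    by rewrite mem_iota /= add0n ltnS rank_le.
  have lt : lo b < k.+1 by rewrite -[ltnRHS](size_iota 0) -has_find.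
  split=> //; first by have := nth_find 0 h; rewrite nth_iota.
  move=> a ab; rewrite leqNgt; apply/negP => al.
  have := before_find 0 al; rewrite nth_iota; last by rewrite ltnS rank_le.
  by rewrite /P add0n rankK ab.
pose hi b := lo b + (P b (lo b).+1 && (lo b < k)).
have hiP b : [/\ hi b <= k, P b (hi b) & forall a, (a, b) \in R -> rank a <= hi b].
  rewrite /hi; have [lk Pl _] := loP b; case: andP => [[P1 lt]|n].
    rewrite addn1; split=> // a ab; have := near1 _ _ _ Pl ab.
    by rewrite unrankK.
  rewrite addn0; split=> // a ab; have := near1 _ _ _ Pl ab.
  rewrite unrankK // leq_eqVlt => /predU1P[e|//]; case: n; split.
    by rewrite /P -e rankK.
  by have := rank_le a; rewrite e.
have hilo b : lo b <= hi b <= (lo b).+1 by rewrite /hi -addn1 leq_addr leq_add2l leq_b1.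
have RE a b : ((a, b) \in R) = (lo b <= rank a <= hi b).
  apply/idP/idP => [ab|].
    have [_ _ h1] := loP b; have [_ _ h2] := hiP b; rewrite h1 ?h2 //.
  move=> le; have [e|e] : rank a = lo b \/ rank a = hi b by have := hilo b; lia.
    by have [_ + _] := loP b; rewrite /P -e rankK.
  by have [_ + _] := hiP b; rewrite /P -e rankK.
pose phi n := lo (unrank L n) + hi (unrank L n).
move: (lo) (hi) loP hiP hilo RE @phi => {}lo {}hi loP hiP hilo RE phi.
exists phi; split; last first.
  by move=> a b; rewrite RE /phi rankK /incident; have := hilo b; lia.
split.
- have rL : unrank L 0 = Defs.root L by apply: rank_inj; rewrite unrankK ?rank_root.
  have h0 : hi (Defs.root L) = 0.
    have [h1 + _] := hiP (Defs.root L); rewrite /P rR => /eqP/(congr1 (@rank K)).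
    by rewrite unrankK // rank_root.
  by rewrite /phi rL h0; have := hilo (Defs.root L); lia.
- rewrite -/l /phi; have [l1 /last + _] := loP (unrank L l).
  have [h1 /last + _] := hiP (unrank L l).
  by rewrite !unrankK // -/k => -> ->; lia.
- move=> i il; have rb : rank (unrank L i) = i by rewrite unrankK // ltnW.
  have rb' : rank (unrank L i.+1) = i.+1 by rewrite unrankK.
  rewrite /phi; set b := unrank L i in rb *; set b' := unrank L i.+1 in rb' *.
  have [lk Pl lmin] := loP b; have [hk Ph hmax] := hiP b.
  have [lk' Pl' lmin'] := loP b'; have [hk' Ph' hmax'] := hiP b'.
  have lm : lo b <= lo b'.
    have [|a ab] := low _ b _ Pl'; first by lia.
    by rewrite unrankK // => le; have := lmin _ ab; lia.
  have hm : hi b <= hi b'.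
    have [|a ab] := high _ _ b' Ph; first by lia.
    by rewrite unrankK // => le; have := hmax' _ ab; lia.
  have : adj b b' by rewrite rank_adj rb rb'; lia.
  move=> /(eR _ _ _ _ Pl Ph'); rewrite rank_adj !unrankK //.
  by have := hilo b; have := hilo b'; lia.
Qed.

(** * From digraphs to patterns and back *)

Section TwoCodes.
Variables (k n : nat) (s t : nat -> nat).
Hypotheses (cs : code k n s) (ct : code k n t).

(** The doubled codes trace a monotone curve with argument t and value s; this is the pattern of
    that curve, taken as the graph of f. *)
Definition pair_pattern : rel nat := fun j v =>
  all (fun c => (v <= doubled_code t c) ==> (j <= doubled_code s c)) (iota 0 (2 * n).+1).

Lemma pair_patternP j v :
  reflect (forall c, c <= 2 * n -> v <= doubled_code t c -> j <= doubled_code s c) (pair_pattern j v).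
Proof.
apply: (iffP allP) => H c.
  by move=> cn vt; have := H c; rewrite mem_iota add0n ltnS cn vt; apply.
by rewrite mem_iota add0n ltnS => /H cn; apply/implyP.
Qed.

Lemma pair_is_pattern : pattern (2 * k) pair_pattern.
Proof.
have us := doubled_code_ustep cs; have ut := doubled_code_ustep ct.
case: (us) => s0 sn _; case: (ut) => t0 tn _; split.
- move=> j j' v v' jj' vv' /pair_patternP H; apply/pair_patternP => c cn vt.
  by apply: (leq_trans jj'); apply: H => //; apply: leq_trans vt.
- by move=> v _; apply/pair_patternP.
- move=> j _; apply/pair_patternP => c cn; have := ustep_le ut cn; lia.
- move=> j j0; apply/pair_patternP => /(_ 0 isT isT); rewrite s0; lia.
- move=> v vk; apply/pair_patternP => /(_ _ (leqnn _)); rewrite tn sn => /(_ vk); lia.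
Qed.

(** The curve passes through every product of cells met by its graph, except that a diagonal step
    may skip a corner; an endpoint of that step is then still incident to it. *)
Lemma pair_cell x' x : x' <= 2 * k -> x <= 2 * k -> cell pair_pattern x' x ->
  exists b a' a, [/\ b <= n, incident a' (s b), incident a (t b), incident a' x' & incident a x].
Proof.
move=> x'k xk; have us := doubled_code_ustep cs; have ut := doubled_code_ustep ct.
move=> /andP[/allPn[c0]]; rewrite mem_iota add0n ltnS negb_imply => c0n /andP[c0t c0s].
move=> /pair_patternP H; rewrite -ltnNge in c0s.
have ms := ustep_mono us; have mt := ustep_mono ut.
(* The last moment at which the curve has not yet crossed the antidiagonal through (x', x). *)
pose P c := (c <= 2 * n) && (doubled_code s c + doubled_code t c <= x' + x).
have P0 : exists c, P c by exists 0; rewrite /P; case: us ut => -> _ _ [-> _ _].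
have Pm c : P c -> c <= 2 * n by case/andP.
case: (ex_maxnP P0 Pm) => c /andP[cn cP] cmax.
have exact_case d : d <= 2 * n -> doubled_code s d = x' -> doubled_code t d = x ->
    exists b a' a, [/\ b <= n, incident a' (s b), incident a (t b), incident a' x' & incident a x].
  move=> dn ds dt; exists d./2, (s d./2)./2, (t d./2)./2.
  have i1 : incident (s d./2)./2 (s d./2) by rewrite /incident; lia.
  have i2 : incident (t d./2)./2 (t d./2) by rewrite /incident; lia.
  have id2 : incident d./2 d by rewrite /incident; lia.
  split=> //; first by lia.
    by rewrite -ds; apply: (doubled_code_incident cs) i1.
  by rewrite -dt; apply: (doubled_code_incident ct) i2.
have [e|ne] := eqVneq (doubled_code s c + doubled_code t c) (x' + x).
  have tx : doubled_code t c <= x.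
    by rewrite leqNgt; apply/negP => lt; have := H c cn lt; lia.
  have [e'|ne'] := eqVneq (doubled_code t c) x; first by apply: (exact_case c) => //; lia.
  have [le|lt] := leqP c0 c; first by have := mt _ _ le cn; lia.
  by have := ms _ _ (ltnW lt) c0n; lia.
have cn' : c < 2 * n.
  rewrite ltn_neqAle cn andbT; apply/eqP => e; case: us ut => _ sn _ [_ tn _].
  by move: cP ne; rewrite e sn tn; lia.
have big : x' + x < doubled_code s c.+1 + doubled_code t c.+1.
  rewrite ltnNge; apply/negP => le; have := cmax c.+1; rewrite /P cn' le => /(_ isT).
  by rewrite ltnn.
have [_ _ /(_ c cn') ss] := us; have [_ _ /(_ c cn') tt] := ut.
have sc : doubled_code s c.+1 = (doubled_code s c).+1 by lia.
have tc : doubled_code t c.+1 = (doubled_code t c).+1 by lia.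
have tx : doubled_code t c <= x by rewrite leqNgt; apply/negP => lt; have := H c cn lt; lia.
have tE : doubled_code t c = x.
  apply/eqP; rewrite eqn_leq tx leqNgt; apply/negP => lt.
  have [le|lt'] := leqP c0 c; first by have := mt _ _ le cn; lia.
  by have := ms _ _ lt' c0n; lia.
have sE : (doubled_code s c).+1 = x' by lia.
(* One end of the diagonal step is a vertex of the path, the other an edge; the witness is the
   vertex. *)
have [b [cE|cE]] := even_odd_cases c.
  subst c; move: sc tc sE tE; rewrite !doubled_code_even !doubled_code_odd => sc tc sE tE.
  exists b, (s b)./2, (t b)./2; rewrite /incident -sE -tE.
  by move: sc tc; case: eqP => _; case: eqP => _ sc tc; split; lia.
have c2 : c.+1 = 2 * b.+1 by lia.
move: sc tc sE tE; rewrite c2 !doubled_code_even cE !doubled_code_odd => sc tc sE tE.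
exists b.+1, (s b.+1)./2, (t b.+1)./2; rewrite /incident.
by move: sc tc sE tE; case: eqP => ?; case: eqP => ? sc tc sE tE; split; lia.
Qed.

End TwoCodes.

Lemma digraph_pattern (F : fraisse_sequence) (A : digraph F) :
  let k := 2 * height (F (level A)) in
  exists2 l, pattern k l & forall x' x, x' <= k -> x <= k -> cell l x' x ->
    exists a' a, [/\ (a', a) \in arrow A, incident (rank a') x' & incident (rank a) x].
Proof.
have [m [S [IS ->]]] := arrowP A; move=> k.
have [s [cs SE]] := mor_coded IS; have [t [ct BE]] := mor_coded (@bonds_mor F (level A) m).
exists (pair_pattern (height (F (m + level A))) s t); first exact: pair_is_pattern.
move=> x' x x'k xk /(pair_cell cs ct x'k xk)[b [a' [a [bn i1 i2 i3 i4]]]].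
have a'k : a' <= height (F (level A)) by move: i3; rewrite /incident /k in x'k *; lia.
have ak : a <= height (F (level A)) by move: i4; rewrite /incident /k in xk *; lia.
exists (unrank _ a'), (unrank _ a); rewrite !unrankK //; split=> //.
apply/rcompP; exists (unrank _ b); first by rewrite SE !unrankK.
by rewrite inE /= BE !unrankK.
Qed.

(* A lattice path through the cells of a pattern, from (0, 0) to (n, n). *)
Fixpoint stair (l : rel nat) i : nat * nat :=
  if i is i'.+1 then
    let: (x', x) := stair l i' in if l x'.+1 x.+1 then (x'.+1, x) else (x', x.+1)
  else (0, 0).

Lemma stairP n l i : pattern n l -> i <= 2 * n -> let: (x', x) := stair l i in
  [/\ x' + x = i, x' <= n, x <= n & cell l x' x].
Proof.
case=> mono l0 ln nl0 nln; elim: i => [|i IH] il /=.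
  by rewrite /cell nl0 // l0.
have := IH (ltnW il); case: (stair l i) => x' x [e x'n xn /andP[c1 c2]].
case: ifP => lS.
  have lt : x' < n.
    rewrite ltn_neqAle x'n andbT; apply/eqP => ee; move: lS; rewrite ee.
    by rewrite (negbTE (nln _ _)) //; lia.
  split=> //; first by lia.
  by rewrite /cell lS andbT; apply: contra c1; apply: mono.
have lt : x < n.
  rewrite ltn_neqAle xn andbT; apply/eqP => ee; move: lS; rewrite ee ln //; lia.
split=> //; first by lia.
by rewrite /cell lS /=; apply: mono c2.
Qed.

Definition lift_pattern N (psi : nat -> nat) (l : rel nat) : rel nat := fun j v =>
  [|| j == 0, N < v | (j <= N) && l (psi j.-1).+1 (psi v)].

Lemma lift_is_pattern N n psi l : ustep N n psi -> pattern n l ->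
  pattern N (lift_pattern N psi l).
Proof.
move=> u [mono l0 ln nl0 nln]; case: (u) => p0 pN _; split.
- move=> j j' v v' jj' vv' /or3P[/eqP|lt|/andP[j'N p]].
  + by move=> e; rewrite /lift_pattern; have -> : j = 0 by lia.
  + by rewrite /lift_pattern (leq_trans lt vv') orbT.
  + rewrite /lift_pattern (leq_trans jj' j'N).
    case: (posnP j) => [->//|j0]; case: leqP => [v'N|//]; apply/orP; right => /=.
    by apply: mono p; rewrite ?ltnS; apply: (ustep_mono u) => //; lia.
- by [].
- by move=> j jN; rewrite /lift_pattern ltnSn orbT.
- move=> j j0; rewrite /lift_pattern p0 (negbTE (nl0 _ _)) //; lia.
- by move=> v vN; rewrite /lift_pattern ltnn /=; lia.
Qed.

Lemma lift_cell N n psi l x' x : ustep N n psi -> pattern n l -> x' <= N -> x <= N ->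
  cell (lift_pattern N psi l) x' x -> cell l (psi x') (psi x).
Proof.
move=> u [mono l0 ln nl0 nln] x'N xN /andP[]; rewrite /lift_pattern !negb_or /= => /andP[_ n1] p1.
case: (u) => p0 pN st; apply/andP; split.
  move: n1; rewrite negb_and -ltnNge => /orP[lt|//].
  have -> : x' = N by lia.
  by rewrite pN nln // (ustep_le u).
case/or3P: p1 => [/eqP->|lt|/andP[_ p1]]; first by rewrite p0 l0.
  have -> : x = N by lia.
  by rewrite pN ln // (ustep_le u).
have [->|x'0] := posnP x'; first by rewrite p0 l0.
have [xe|xlt] : x = N \/ x < N by lia.
  by rewrite xe pN ln // (ustep_le u).
apply: mono p1.
  by have := st x'.-1; rewrite prednK //; lia.
by have := st x; lia.
Qed.

Lemma half_ustep n N phi : code n N phi -> ustep N n (fun x => (phi x)./2).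
Proof. by case=> p0 pN st; split; [lia|lia|move=> x xN; have := st x; lia]. Qed.

(** Objects live only on members of the sequence, so the pattern is lifted to one of them lying over
    [P], and a lattice path through its cells supplies the arrows. *)
Lemma realize_digraph (F : fraisse_sequence) m (P : rpath) l (X : {set F m * P}) :
  I_mor X -> pattern (height P) l ->
  exists (D : digraph F) (T : {set P * F (level D)}),
    I_mor T /\ forall d' d, (d', d) \in arrow D -> exists x' x : P,
      [/\ (x', d') \in T, (x, d) \in T & cell l (rank x') (rank x)].
Proof.
move=> IX pl; have [k [T [IT _]]] := fraisse_absorb IX.
have [phi [cphi TE]] := mor_coded IT; 
set N := height (F (k + m)) in cphi.
pose psi x := (phi x)./2; have upsi : ustep N (height P) psi := half_ustep cphi.
pose l' := lift_pattern N psi l; have pl' := lift_is_pattern upsi pl.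
have st i : i <= 2 * N -> let: (x', x) := stair l' i in
  [/\ x' + x = i, x' <= N, x <= N & cell l' x' x] by apply: stairP.
have [Q hQ] : exists Q, height Q = 2 * N by exists (standard_path (2 * N)); apply: standard_path_height.
have step i : (stair l' i.+1 = ((stair l' i).1.+1, (stair l' i).2)) \/
              (stair l' i.+1 = ((stair l' i).1, (stair l' i).2.+1)).
  by rewrite /=; case: (stair l' i) => x' x /=; case: ifP; [left|right].
have codeS : code N (2 * N) (fun i => 2 * (stair l' i).1).
  split=> //; first by have := st _ (leqnn _); case: (stair _ _) => x' x /= [? ? ? _]; lia.
  by move=> i _; case: (step i) => -> /=; lia.
have codeT : code N (2 * N) (fun i => 2 * (stair l' i).2).
  split=> //; first by have := st _ (leqnn _); case: (stair _ _) => x' x /= [? ? ? _]; lia.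
  by move=> i _; case: (step i) => -> /=; lia.
pose sg := coded_rel (F (k + m)) Q (fun i => 2 * (stair l' i).1).
pose ta := coded_rel (F (k + m)) Q (fun i => 2 * (stair l' i).2).
have [csg sgE] : coded sg (fun i => 2 * (stair l' i).1) by apply: coded_relP; rewrite hQ.
have [cta taE] : coded ta (fun i => 2 * (stair l' i).2) by apply: coded_relP; rewrite hQ.
have Isg : I_mor sg by apply: coded_mor; split; [exact: csg|exact: sgE].
have Ita : I_mor ta by apply: coded_mor; split; [exact: cta|exact: taE].
(* Absorbing [ta] makes [ta] after [W] a bonding map, so that [sg] after [W] composed with its
   inverse has the form required of arrows. *)
have [k' [W [IW WE]]] := fraisse_absorb Ita.
have AP : exists k0 (S : {set F (k + m) * F (k0 + (k + m))}),
    I_mor S /\ rcomp (rcomp sg W) (rinv (bonds (@fbond F) (k + m) k')) =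
      rcomp S (rinv (bonds (@fbond F) (k + m) k0)).
  by exists k', (rcomp sg W); split=> //; apply: I_mor_comp.
suff main : forall d' d : F (k + m),
    (d', d) \in rcomp (rcomp sg W) (rinv (bonds (@fbond F) (k + m) k')) ->
    exists x' x : P, [/\ (x', d') \in T, (x, d) \in T & cell l (rank x') (rank x)].
  by exists (Digraph AP), T.
move=> d' d /rcompP[c /rcompP[y]].
rewrite sgE => d'y yc; rewrite inE /= -WE => /rcompP[y']; rewrite taE => dy' y'c.
have e1 : rank d' = (stair l' (rank y)).1 by move: d'y; rewrite /incident; lia.
have e2 : rank d = (stair l' (rank y')).2 by move: dy'; rewrite /incident; lia.
have yN := rank_le y; have y'N := rank_le y'; rewrite hQ in yN y'N.
have stc i : i <= 2 * N -> cell l' (stair l' i).1 (stair l' i).2.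
  by move=> /st; case: (stair _ _) => ? ? [].
have C : cell l' (rank d') (rank d).
  case: IW => [[_ eW] _ _]; have := eW _ _ _ _ yc y'c (adj_refl c).
  rewrite rank_adj e1 e2 => yy'.
  (* A step of the staircase changes a single coordinate, so coordinates read at two neighbouring
     steps still form a point of the staircase. *)
  have [e|[e|e]] : rank y' = rank y \/ rank y' = (rank y).+1 \/ rank y = (rank y').+1 by lia.
  - by rewrite e; apply: stc.
  - rewrite e; have := stc _ y'N; have := stc _ yN; rewrite e.
    by case: (step (rank y)) => -> /=.
  - rewrite e; have := stc _ y'N; have := stc _ yN; rewrite e.
    by case: (step (rank y')) => -> /=.
have dN := rank_le d; have d'N := rank_le d'.
have inT e : (unrank (P) (psi (rank e)), e) \in T.
  rewrite TE unrankK; first by rewrite /incident /psi; lia.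
  by apply: (ustep_le upsi); apply: rank_le.
exists (unrank _ (psi (rank d'))), (unrank _ (psi (rank d))); split=> //.
by rewrite !unrankK ?(ustep_le upsi) //; exact: (lift_cell upsi pl).
Qed.

Lemma weakly_arrow_preserving_comp (A B C : finType) (EA : {set A * A})
    (EB : {set B * B}) (EC : {set C * C}) (R : {set A * B}) (S : {set B * C}) :
  weakly_arrow_preserving EA EB R -> weakly_arrow_preserving EB EC S ->
  weakly_arrow_preserving EA EC (rcomp R S).
Proof.
move=> wR wS c0 c1 /wS[b0 [b1 [b0c b1c /wR[a0 [a1 [ab0 ab1 a01]]]]]].
by exists a0, a1; split=> //; apply/rcompP; [exists b0|exists b1].
Qed.

Definition cell_rel (P : rpath) (l : rel nat) : {set P * P} :=
  [set q | cell l (rank q.1) (rank q.2)]%SET.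

Lemma coded_weak (F : fraisse_sequence) (A : digraph F) (P : rpath) lP (R : {set F (level A) * P}) X l :
  (forall x' x, x' <= 2 * height (F (level A)) -> x <= 2 * height (F (level A)) -> cell l x' x ->
    exists a' a, [/\ (a', a) \in arrow A, incident (rank a') x' & incident (rank a) x]) ->
  strict_map (height P) lP X (2 * height (F (level A))) l -> coded R X ->
  weakly_arrow_preserving (arrow A) (cell_rel P lP) R.
Proof.
move=> lA [_ u cX] [_ RE] x' x; rewrite inE /= => C.
have xn (y : P) : rank y <= height P by apply: rank_le.
have [a' [a [Ea i1 i2]]] := lA _ _ (ustep_le u (xn x')) (ustep_le u (xn x)) (cX _ _ (xn _) (xn _) C).
by exists a', a; rewrite !RE.
Qed.

Theorem weak_m_amalgamation_digraphs (F : fraisse_sequence) :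
  weak_m_amalgamation (I_digraphs F).
Proof.
move=> A; have [lA pA cA] := digraph_pattern A.
have [n [lP [R [sR amal]]]] := pattern_amalgamation pA.
have [P hP] : exists P, height P = n by exists (standard_path n); apply: standard_path_height.
subst n; have [pP uR _] := sR; set kA := height (F (level A)) in sR uR cA pA.
pose RA := coded_rel (F (level A)) P R.
have cRA : coded RA R by apply: coded_relP; apply: ustep_code.
have [B [TB [ITB wTB]]] := realize_digraph (coded_mor cRA) pP.
exists B, (rcomp RA TB); split.
  split; first by apply: I_mor_comp ITB; apply: coded_mor cRA.
  apply: (@weakly_arrow_preserving_comp _ _ _ _ (cell_rel P lP)); first exact: coded_weak cA sR cRA.
  by move=> b0 b1 /wTB[x' [x [? ? ?]]]; exists x', x; rewrite inE.
move=> C0 C1 S0 S1 [IS0 wS0] [IS1 wS1].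
(* Followed through [S] and then [TB], arrows of C end in cells of [lP], up to incidence. *)
have over (C : digraph F) (S : {set F (level B) * F (level C)}) : I_mor S ->
    weakly_arrow_preserving (arrow B) (arrow C) S ->
    exists l xi, [/\ weak_map (2 * height (F (level C))) l xi (height P) lP,
      (forall x' x, x' <= 2 * height (F (level C)) -> x <= 2 * height (F (level C)) -> cell l x' x ->
        exists a' a, [/\ (a', a) \in arrow C, incident (rank a') x' & incident (rank a) x]) &
      forall u c y, u <= 2 * height (F (level C)) -> incident (rank c) u ->
        (y, c) \in rcomp TB S -> incident (rank y) (xi u)].
  move=> IS wS; have [l pC cC] := digraph_pattern C.
  have [phi [cphi QE]] := mor_coded (I_mor_comp ITB IS).
  have inc u c y : u <= 2 * height (F (level C)) -> incident (rank c) u ->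
      (y, c) \in rcomp TB S -> incident (rank y) (doubled_code phi u).
    by move=> uC cu; rewrite QE; apply: (doubled_code_incident cphi).
  exists l, (doubled_code phi); split=> //; split=> //; first exact: doubled_code_ustep.
  move=> u' u u'C uC /(cC _ _ u'C uC)[a' [a [/wS[b' [b [b'a ba /wTB[x' [x [x'b xb C']]]]]] i1 i2]]].
  exists (rank x'), (rank x); split=> //.
    by apply: (inc u' a') => //; apply/rcompP; exists b'.
  by apply: (inc u a) => //; apply/rcompP; exists b.
have [l0 [xi0 [wk0 ce0 in0]]] := over C0 S0 IS0 wS0.
have [l1 [xi1 [wk1 ce1 in1]]] := over C1 S1 IS1 wS1.
have [d [lD [X0 [X1 [s0 s1 close]]]]] := amal _ _ _ _ _ _ wk0 wk1.
have [Q hQ] : exists Q, height Q = d by exists (standard_path d); apply: standard_path_height.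
subst d.
have cX0 : coded (coded_rel (F (level C0)) Q X0) X0.
  by apply: coded_relP; case: s0 => _ u _; apply: ustep_code.
have cX1 : coded (coded_rel (F (level C1)) Q X1) X1.
  by apply: coded_relP; case: s1 => _ u _; apply: ustep_code.
have pD : pattern (height Q) lD by case: s0.
have [D [T [IT wT]]] := realize_digraph (coded_mor cX0) pD.
exists D, (rcomp (coded_rel _ _ X0) T), (rcomp (coded_rel _ _ X1) T).
have wT' : weakly_arrow_preserving (cell_rel Q lD) (arrow D) T.
  by move=> b0 b1 /wT[x' [x [? ? ?]]]; exists x', x; rewrite inE.
split.
- split; first by apply: I_mor_comp IT; apply: coded_mor cX0.
  by apply: (@weakly_arrow_preserving_comp _ _ _ _ (cell_rel Q lD)) wT'; apply: coded_weak ce0 s0 cX0.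
- split; first by apply: I_mor_comp IT; apply: coded_mor cX1.
  by apply: (@weakly_arrow_preserving_comp _ _ _ _ (cell_rel Q lD)) wT'; apply: coded_weak ce1 s1 cX1.
move=> e; case: IT => [[[sT _] _] _ _]; have [x xe] := sT e.
have xd := rank_le x.
have via (C : digraph F) (S : {set F (level B) * F (level C)}) l xi X :
    I_mor S -> strict_map (height Q) lD X (2 * height (F (level C))) l ->
    (forall u c y, u <= 2 * height (F (level C)) -> incident (rank c) u ->
        (y, c) \in rcomp TB S -> incident (rank y) (xi u)) ->
    coded (coded_rel (F (level C)) Q X) X ->
    exists2 y, y <= height P /\ incident y (xi (X (rank x))) &
      forall a : F (level A), incident (rank a) (R y) ->
        (a, e) \in rcomp (rcomp (rcomp RA TB) S) (rcomp (coded_rel _ _ X) T).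
  move=> IS [_ uX _] inC cX; have [[[sX _] _] _ _] := coded_mor cX.
  have [c cx] := sX x; have [[[sS _] _] _ _] := I_mor_comp ITB IS.
  have [y yc] := sS c; exists (rank y).
    split; first exact: rank_le.
    apply: (inC _ c) => //; first exact: (ustep_le uX).
    by have [_ <-] := cX.
  move=> a ay; apply/rcompP; exists c; last by apply/rcompP; exists x.
  case/rcompP: yc => b yb bc; apply/rcompP; exists b => //; apply/rcompP; exists y => //.
  by have [_ ->] := cRA.
have [y0 [y0n n0] H0] := via _ _ _ _ _ IS0 s0 in0 cX0.
have [y1 [y1n n1] H1] := via _ _ _ _ _ IS1 s1 in1 cX1.
have [r01 r10] := close _ _ _ xd n0 n1.
have R0 := ustep_le uR y0n; have R1 := ustep_le uR y1n.
(* For two codes that differ by at most one, half of the larger is a vertex incident to both. *)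
have [a [ak a0 a1]] : exists a, [/\ a <= kA, incident a (R y0) & incident a (R y1)].
  by exists (maxn (R y0) (R y1))./2; rewrite /incident; split; lia.
exists (unrank _ a); apply/finset.setIP; split; [apply: H0|apply: H1]; rewrite unrankK //.
Qed.

Local Open Scope classical_set_scope.
Local Open Scope ring_scope.

(** * Increasing homeomorphisms of the unit interval *)

HB.instance Definition _ (R : realType) :=
  SubType.copy (unit_interval R) {x : R | x \in `[0%R : R, 1%R]%classic}.
HB.instance Definition _ (R : realType) :=
  [SubChoice_isSubOrder of (unit_interval R) by <: with ring_display].

Section Basics.
Variable R : realType.
Local Notation I := (unit_interval R).
Implicit Types (x y z : I) (f g h : homeo01 R).

Lemma lt_valE x y : (x < y) = (\val x < \val y). Proof. by []. Qed.
Lemma le_valE x y : (x <= y) = (\val x <= \val y). Proof. by []. Qed.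

Lemma val_ge0 x : 0 <= \val x. Proof. by case/andP: (unit_interval_itv x). Qed.
Lemma val_le1 x : \val x <= 1. Proof. by case/andP: (unit_interval_itv x). Qed.

Definition clamp (t : R) : I := insubd (unit_interval0 R) t.

Lemma clampE (t : R) : 0 <= t <= 1 -> \val (clamp t) = t.
Proof.
move=> t01; rewrite /clamp val_insubd; case: ifP => // /negP[].
by apply/mem_set; rewrite /= in_itv.
Qed.

Lemma clampK x : clamp (\val x) = x.
Proof. by apply: val_inj; rewrite clampE // unit_interval_itv. Qed.

Definition i0 : I := clamp 0.
Definition i1 : I := clamp 1.
Lemma val_i0 : \val i0 = 0. Proof. by rewrite clampE // lexx ler01. Qed.
Lemma val_i1 : \val i1 = 1. Proof. by rewrite clampE // lexx ler01. Qed.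
Lemma i0_le x : i0 <= x. Proof. by rewrite le_valE val_i0 val_ge0. Qed.
Lemma i1_ge x : x <= i1. Proof. by rewrite le_valE val_i1 val_le1. Qed.
Lemma unit_interval0E : unit_interval0 R = i0.
Proof. by apply: val_inj; rewrite val_i0. Qed.

(** Stands in for continuity when homeomorphisms are built: it is stable under translation, maximum
    and minimum, and on [0,1] yields a homeomorphism once 0 and 1 are fixed. *)
Definition incsurj (F : R -> R) :=
  (forall s t, s < t -> F s < F t) /\ forall v, exists t, F t = v.

Definition line_ext (F : I -> I) (t : R) := if 0 <= t <= 1 then \val (F (clamp t)) else t.

Lemma line_ext_val F x : line_ext F (\val x) = \val (F x).
Proof. by rewrite /line_ext unit_interval_itv clampK. Qed.

Lemma line_ext_continuous (F : I -> I) : continuous F <-> {within `[0, 1], continuous (line_ext F)}.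
Proof.
rewrite subspace_sigL_continuousP.
have -> : sigL `[0, 1]%classic (line_ext F) = \val \o F.
  by apply/funext => x; rewrite /sigL /= -line_ext_val.
split=> [cF x|cF x].
  apply: continuous_comp; first exact: cF.
  exact: (@initial_continuous (I : choiceType) R \val).
move=> A [B [[C Co CB] Bx BA]].
have : nbhs x ((\val \o F) @^-1` C).
  by apply: (cF x); apply: open_nbhs_nbhs; split=> //; move: Bx; rewrite -CB.
by apply: filterS => y Cy; apply: BA; rewrite -CB.
Qed.

Lemma homeo_inj f : injective f.
Proof. exact: can_inj (homeoK f). Qed.

Lemma homeo_i0 f : f i0 = i0.
Proof. by rewrite -unit_interval0E homeo0. Qed.

(** A continuous injection of an interval is monotone, and fixing 0 excludes the decreasing case. *)
Lemma homeo_lt f x y : (f x < f y) = (x < y).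
Proof.
have lt : forall x y, x < y -> f x < f y; last first.
  by case: (ltgtP x y) => [/lt//|/lt/ltW/le_gtF//|->]; rewrite ltxx.
have /line_ext_continuous cf := @homeo_continuous _ f.
have inj : {in `[0, 1]%R &, injective (line_ext f)}.
  move=> s t; rewrite !in_itv /= /line_ext => s01 t01; rewrite s01 t01.
  by move=> /val_inj/homeo_inj/(congr1 val); rewrite !clampE.
have in01 z : \val z \in `[0, 1]%R by rewrite in_itv /= unit_interval_itv.
case: (itv_continuous_inj_mono cf inj) => mono {x y}x y xy.
  by rewrite lt_valE -!line_ext_val mono.
have := mono _ _ (in01 i1) (in01 i0); rewrite !line_ext_val homeo_i0.
rewrite val_i0 val_i1 ltr01 => lt0; have := val_ge0 (f i1); rewrite leNgt.
by rewrite lt0.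
Qed.

Lemma homeo_le f x y : (f x <= f y) = (x <= y).
Proof. by rewrite !leNgt homeo_lt. Qed.

Lemma homeo_i1 f : f i1 = i1.
Proof.
apply/eqP; rewrite eq_le i1_ge /=.
by rewrite -[leLHS](homeoVK f) homeo_le i1_ge.
Qed.

Lemma line_ext_incsurj f : incsurj (line_ext f).
Proof.
split=> [s t st|v].
  rewrite /line_ext; case: ifP => s01; case: ifP => t01 //.
  - by rewrite -lt_valE homeo_lt lt_valE !clampE.
  - have /andP[? ?] := unit_interval_itv (f (clamp s)).
    by move: s01 t01 => /andP[? ?]; case: andP => // n _; rewrite ltNge; apply/negP => ?; apply: n; split; lra.
  - have /andP[? ?] := unit_interval_itv (f (clamp t)).
    by move: t01 s01 => /andP[? ?]; case: andP => // n _; rewrite ltNge; apply/negP => ?; apply: n; split; lra.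
have [v01|nv] := boolP (0 <= v <= 1).
  exists (\val (homeo_inv f (clamp v))).
  by rewrite line_ext_val; have := homeoVK f (clamp v) => /= ->; rewrite clampE.
by exists v; rewrite /line_ext (negbTE nv).
Qed.

Lemma increasing_continuous (F : I -> I) :
  (forall x y, x < y -> F x < F y) -> (forall y, exists x, F x = y) -> continuous F.
Proof.
move=> lt surj; apply/line_ext_continuous.
have F0 : F i0 = i0.
  have [x xE] := surj i0; apply/eqP; rewrite eq_le i0_le andbT -[leRHS]xE.
  by case: (ltgtP i0 x) (i0_le x) => [/lt/ltW//| |->].
have F1 : F i1 = i1.
  have [x xE] := surj i1; apply/eqP; rewrite eq_le i1_ge /= -[leLHS]xE.
  by case: (ltgtP x i1) (i1_ge x) => [/lt/ltW//| |->].
have e0 : line_ext F 0 = 0 by rewrite -{1}val_i0 line_ext_val F0 val_i0.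
have e1 : line_ext F 1 = 1 by rewrite -{1}val_i1 line_ext_val F1 val_i1.
apply: segment_inc_surj_continuous.
  move=> s t; rewrite !in_itv /= => s01 t01.
  rewrite /line_ext s01 t01 -le_valE -[s in RHS]clampE // -[t in RHS]clampE // -le_valE.
  case: (ltgtP (clamp s) (clamp t)) => [/lt/ltW//|/lt/lt_geF//|->]; exact: lexx.
move=> v; rewrite e0 e1 /= in_itv /= => v01.
have [x xE] := surj (clamp v); exists (\val x); last by rewrite line_ext_val xE clampE.
by rewrite in_itv /= unit_interval_itv.
Qed.

Lemma mk_homeo (F : I -> I) :
  (forall x y, x < y -> F x < F y) -> (forall y, exists x, F x = y) ->
  exists h, forall x, h x = F x.
Proof.
move=> lt surj; have [G GK] := choice surj.
have FK : cancel F G.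
  move=> x; case: (ltgtP (G (F x)) x) => // /lt; rewrite GK ltxx //.
have ltG x y : x < y -> G x < G y.
  move=> xy; case: (ltgtP (G x) (G y)) => //; last by move/(congr1 F); rewrite !GK => e; move: xy; rewrite e ltxx.
  by move=> /lt; rewrite !GK => /lt_trans/(_ xy); rewrite ltxx.
have cF := increasing_continuous lt surj.
have cG : continuous G by apply: increasing_continuous => // x; exists (F x).
have F0 : F (unit_interval0 R) = unit_interval0 R.
  rewrite unit_interval0E; apply/eqP; rewrite eq_le i0_le andbT.
  rewrite -[leRHS]GK; case: (ltgtP i0 (G i0)) (i0_le (G i0)) => [/lt/ltW//| |<-] //.
by exists (Homeo01 cF (ex_intro _ G (And3 cG FK GK)) F0).
Qed.

End Basics.

(** * Generic homeomorphisms: a countable family of dense open conditions *)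

Section Density.
Variable R : realType.
Local Notation I := (unit_interval R).
Implicit Types (x y z : I) (f g h : homeo01 R) (F G : R -> R).

Lemma incsurj_affine (a b : R) : 0 < a -> incsurj (fun t => a * t + b).
Proof.
move=> a0; split=> [s t st|v]; first by rewrite ltrD2r ltr_pM2l.
by exists (a^-1 * (v - b)); rewrite mulVKf ?subrK // gt_eqF.
Qed.

Lemma incsurj_shift F (b : R) : incsurj F -> incsurj (fun t => F t + b).
Proof.
move=> [lt surj]; split=> [s t st|v]; first by rewrite ltrD2r lt.
by have [t tE] := surj (v - b); exists t; rewrite tE subrK.
Qed.

Lemma incsurj_le F s t : incsurj F -> s <= t -> F s <= F t.
Proof. by move=> [lt _]; rewrite le_eqVlt => /predU1P[->//|/lt/ltW]. Qed.

Lemma incsurj_max F G : incsurj F -> incsurj G -> incsurj (fun t => Num.max (F t) (G t)).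
Proof.
move=> iF iG; have [ltF sF] := iF; have [ltG sG] := iG; split=> [s t st|v].
  by rewrite gt_max !lt_max ltF // ltG // orbT.
have [s sE] := sF v; have [t tE] := sG v; case: (leP s t) => st.
  by exists s; rewrite max_l sE // -tE incsurj_le.
by exists t; rewrite max_r tE // -sE incsurj_le // ltW.
Qed.

Lemma incsurj_min F G : incsurj F -> incsurj G -> incsurj (fun t => Num.min (F t) (G t)).
Proof.
move=> iF iG; have [ltF sF] := iF; have [ltG sG] := iG; split=> [s t st|v].
  by rewrite lt_min !gt_min ltF // ltG // orbT.
have [s sE] := sF v; have [t tE] := sG v; case: (leP s t) => st.
  by exists t; rewrite min_r tE // -sE incsurj_le.
by exists s; rewrite min_l sE // -tE incsurj_le // ltW.
Qed.

Lemma incsurj_homeo F : incsurj F -> F 0 = 0 -> F 1 = 1 ->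
  exists h, forall x, \val (h x) = F (\val x).
Proof.
move=> iF F0 F1; have [ltF sF] := iF.
have F01 x : 0 <= F (\val x) <= 1.
  have := incsurj_le iF (val_ge0 x); have := incsurj_le iF (val_le1 x).
  by rewrite F0 F1 => -> ->.
have [||h hE] := @mk_homeo R (fun x => clamp (F (\val x))).
- by move=> x y xy; rewrite lt_valE !clampE // ltF.
- move=> y; have [t tE] := sF (\val y); exists (clamp t).
  have t01 : 0 <= t <= 1.
    apply/andP; split; rewrite leNgt; apply/negP => /ltF; rewrite tE ?F0 ?F1.
      by rewrite ltNge val_ge0.
    by rewrite ltNge val_le1.
  by rewrite (clampE t01) tE clampK.
by exists h => x; rewrite hE clampE.
Qed.

Definition alternates f x y := exists z1 z2 z3 z4,
  [/\ [/\ x < z1, z1 < z2, z2 < z3, z3 < z4 & z4 < y],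
      z1 < f z1, f z2 < z2, z3 < f z3 & f z4 < z4].

(** A piecewise linear map with fixed points c - u, c, c + u and slopes 1/2, 3, 1/2 there: repelling
    in the middle, attracting at the sides. *)
Definition wave (c u t : R) := Num.max (2^-1 * t + (c - u) / 2)
  (Num.min (3 * t + - 2 * c) (2^-1 * t + (c + u) / 2)).

Lemma incsurj_wave c u : incsurj (wave c u).
Proof.
apply: incsurj_max; first by apply: incsurj_affine; lra.
by apply: incsurj_min; apply: incsurj_affine; lra.
Qed.

Lemma wave_signs c u : 0 < u ->
  [/\ c - 2 * u < wave c u (c - 2 * u), wave c u (c - u / 2) < c - u / 2,
      c + u / 2 < wave c u (c + u / 2) & wave c u (c + 2 * u) < c + 2 * u].
Proof.
move=> u0; rewrite /wave; split; rewrite ?lt_max ?gt_max ?lt_min ?gt_min.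
- by apply/orP; left; lra.
- by apply/andP; split; [lra|apply/orP; left; lra].
- by apply/orP; right; apply/andP; split; lra.
- by apply/andP; split; [lra|apply/orP; right; lra].
Qed.

(* Clips F between two homeomorphisms of [0,1], one below and one above the
   identity on (0,1); this does not change the sign of F - id there. *)
Definition squeeze F (t : R) :=
  Num.max (Num.max (2^-1 * t + 0) (2 * t + - 1)) (Num.min (Num.min (2 * t + 0) (2^-1 * t + 2^-1)) (F t)).

Lemma incsurj_squeeze F : incsurj F -> incsurj (squeeze F).
Proof.
move=> iF; apply: incsurj_max; first by apply: incsurj_max; apply: incsurj_affine; lra.
by apply: incsurj_min => //; apply: incsurj_min; apply: incsurj_affine; lra.
Qed.

Lemma squeeze0 F : squeeze F 0 = 0.
Proof.
by apply/eqP; rewrite eq_le /squeeze !(le_max, ge_max, le_min, ge_min);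
  apply/andP; split; rewrite ?mulr0 ?add0r ?addr0 ?lexx ?orbT //=; lra.
Qed.

Lemma squeeze1 F : squeeze F 1 = 1.
Proof.
have e1 : (2 * 1 + - 1 : R) = 1 by lra.
have e2 : (2^-1 * 1 + 2^-1 : R) = 1 by lra.
by apply/eqP; rewrite eq_le /squeeze !(le_max, ge_max, le_min, ge_min) e1 e2 lexx ?orbT //=; lra.
Qed.

Lemma squeeze_gt F t : 0 < t < 1 -> t < F t -> t < squeeze F t.
Proof.
move=> /andP[t0 t1] tF; rewrite /squeeze !(lt_max, lt_min) tF andbT.
by apply/orP; right; apply/andP; split; lra.
Qed.

Lemma squeeze_lt F t : 0 < t < 1 -> F t < t -> squeeze F t < t.
Proof.
move=> /andP[t0 t1] tF; rewrite /squeeze !(gt_max, gt_min) tF orbT andbT.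
by apply/andP; split; lra.
Qed.

Lemma homeo_eps f z (e : R) : 0 < e -> exists2 d, 0 < d &
  forall t, `|\val z - \val t| < d -> `|\val (f z) - \val (f t)| < e.
Proof.
move=> e0; have [B [[C Co CB] Bz BA]] : nbhs z (f @^-1` ((@set_val R `[0, 1]) @^-1` ball (\val (f z)) e)).
  apply: (@homeo_continuous R f z); exists (set_val @^-1` ball (\val (f z)) e); split=> //.
    by exists (ball (\val (f z)) e) => //; apply: ball_open.
  exact: ballxx.
have : nbhs (\val z) C by apply: open_nbhs_nbhs; split=> //; move: Bz; rewrite -CB.
move=> /nbhs_ballP[d /= d0 dC]; exists d => // t zt.
have : B t by rewrite -CB; apply: dC.
by move=> /BA.
Qed.

Lemma dense_alternates f (e : R) x y z : 0 < e -> x < y -> x <= z <= y ->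
  `|\val (f z) - \val z| < e ->
  exists2 g, alternates g x y & forall t, `|\val (f t) - \val (g t)| <= e.
Proof.
move=> e0 xy /andP[xz zy] fz.
pose n := (e - `|\val (f z) - \val z|) / 2; have n0 : 0 < n by rewrite /n; lra.
have [d d0 df] := homeo_eps f z n0.
have [a [b [ab xa bY close]]] : exists a b : R, [/\ a < b, \val x <= a, b <= \val y &
    forall t, a < \val t < b -> `|\val (f t) - \val t| < e].
  have key t : `|\val z - \val t| < d -> `|\val z - \val t| < n -> `|\val (f t) - \val t| < e.
    move=> /df ft zt.
    have -> : \val (f t) - \val t = - (\val (f z) - \val (f t)) + (\val (f z) - \val z) + (\val z - \val t) by lra.
    apply: le_lt_trans (ler_normD _ _) _.
    have := ler_normD (- (\val (f z) - \val (f t))) (\val (f z) - \val z).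
    rewrite normrN /n in zt *; rewrite /n in ft.
    set p := `| _ - _| in ft *; lra.
  have [zy'|yz] := ltP z y.
    exists (\val z), (Num.min (\val y) (\val z + Num.min d n)).
    rewrite lt_min ltrDl lt_min d0 n0 -lt_valE zy' ge_min lexx; split=> // t /andP[zt].
    rewrite !lt_min => /andP[_]; rewrite -ltrBlDl lt_min => /andP[td tn].
    by apply: key; rewrite ler0_norm; lra.
  have zE : z = y by apply/eqP; rewrite eq_le zy yz.
  subst z; exists (Num.max (\val x) (\val y - Num.min d n)), (\val y).
  rewrite gt_max gtrBl lt_min d0 n0 -lt_valE xy le_max lexx; split=> // t /andP[+ ty].
  rewrite !gt_max => /andP[_]; rewrite ltrBlDr -ltrBlDl lt_min => /andP[td tn].
  by apply: key; rewrite ger0_norm; lra.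
pose c := (a + b) / 2; pose u := (b - a) / 8; have u0 : 0 < u by rewrite /u; lra.
pose k := squeeze (wave c u).
(* [k] clipped to the band of radius [e] around f. On (a, b) the identity lies strictly inside this
   band, so clipping keeps the sign of [k - id]. *)
pose G t := Num.max (line_ext f t + - e) (Num.min (line_ext f t + e) (k t)).
have iG : incsurj G.
  apply: incsurj_max; first exact/incsurj_shift/line_ext_incsurj.
  apply: incsurj_min; first exact/incsurj_shift/line_ext_incsurj.
  exact/incsurj_squeeze/incsurj_wave.
have f0 : line_ext f 0 = 0 by have := line_ext_val f (i0 R); rewrite homeo_i0 val_i0.
have f1 : line_ext f 1 = 1 by have := line_ext_val f (i1 R); rewrite homeo_i1 val_i1.
have G0 : G 0 = 0.
  rewrite /G f0 /k squeeze0 add0r add0r min_r; last by lra.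
  by rewrite max_r; lra.
have G1 : G 1 = 1.
  rewrite /G f1 /k squeeze1 min_r; last by lra.
  by rewrite max_r; lra.
have [g gE] := incsurj_homeo iG G0 G1.
have a0 := val_ge0 x; have b1 := val_le1 y.
have G_gt t : a < t < b -> t < wave c u t -> t < \val (g (clamp t)).
  move=> /andP[at_ tb] tw; have t01 : 0 <= t <= 1 by lra.
  have := close (clamp t); rewrite -line_ext_val clampE // at_ tb => /(_ isT).
  rewrite gE clampE // /G; move: (line_ext f t) => v; rewrite ltr_norml => /andP[v1 v2].
  rewrite lt_max lt_min squeeze_gt ?andbT //; last by lra.
  by apply/orP; right; lra.
have G_lt t : a < t < b -> wave c u t < t -> \val (g (clamp t)) < t.
  move=> /andP[at_ tb] tw; have t01 : 0 <= t <= 1 by lra.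
  have := close (clamp t); rewrite -line_ext_val clampE // at_ tb => /(_ isT).
  rewrite gE clampE // /G; move: (line_ext f t) => v; rewrite ltr_norml => /andP[v1 v2].
  rewrite gt_max gt_min squeeze_lt ?orbT ?andbT //; last by lra.
  lra.
exists g; last first.
  move=> t; rewrite gE /G line_ext_val; set p := \val (f t); rewrite ler_norml.
  have : Num.max (p + - e) (Num.min (p + e) (k (\val t))) <= p + e.
    by rewrite ge_max ge_min lexx andbT; lra.
  have : p + - e <= Num.max (p + - e) (Num.min (p + e) (k (\val t))) by rewrite le_max lexx.
  by set q := Num.max _ _; lra.
have [w1 w2 w3 w4] := wave_signs c u0.
have p1 : a < c - 2 * u < b by rewrite /c /u; lra.
have p2 : a < c - u / 2 < b by rewrite /c /u; lra.
have p3 : a < c + u / 2 < b by rewrite /c /u; lra.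
have p4 : a < c + 2 * u < b by rewrite /c /u; lra.
have m t : a < t < b -> \val (clamp t) = t by move=> ?; rewrite clampE //; lra.
exists (clamp (c - 2 * u)), (clamp (c - u / 2)), (clamp (c + u / 2)), (clamp (c + 2 * u)).
by rewrite !lt_valE !m // G_gt // G_lt // G_gt // G_lt //; split=> //; split; lra.
Qed.

Definition dense_pt n : I := clamp (if unpickle n is Some q then ratr q else 0).

Lemma dense_ptP x y : x < y -> exists2 n, x < dense_pt n & dense_pt n < y.
Proof.
move=> xy; have [q] := rat_in_itvoo (xy : \val x < \val y).
rewrite in_itv /= => /andP[xq qy].
exists (pickle q); rewrite /dense_pt pickleK lt_valE clampE //;
  by have /= := val_ge0 x; have /= := val_le1 y; lra.
Qed.

Lemma dense_pt0 : exists n, dense_pt n = i0 R.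
Proof. by exists (pickle (0 : rat)); rewrite /dense_pt pickleK rmorph0. Qed.

Lemma dense_pt1 : exists n, dense_pt n = i1 R.
Proof. by exists (pickle (1 : rat)); rewrite /dense_pt pickleK rmorph1. Qed.

(* Positive distance from the identity is required, rather than the absence of
   fixed points, to make the condition visibly open. *)
Definition moves f x y := exists2 e : R, 0 < e &
  forall z, x <= z <= y -> e <= `|\val (f z) - \val z|.

Definition good_on x y : set (homeo01 R) := [set f | x < y -> moves f x y \/ alternates f x y].

Lemma homeo_ballP f g (e : R) : ball f e g <-> homeo_dist f g < e.
Proof. by rewrite ballEmdist. Qed.

Lemma close_lt f g z (e : R) : homeo_dist f g < e -> `|\val (f z) - \val (g z)| < e.
Proof. exact/le_lt_trans/homeo_dist_ub. Qed.

Lemma good_on_open x y : open (good_on x y).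
Proof.
rewrite openE => f; rewrite /good_on /= => fxy.
have [xy|yx] := ltP x y; last first.
  by apply/nbhs_ballP; exists 1 => //= g _ xy; move: (lt_geF xy); rewrite yx.
apply/nbhs_ballP; have [[e e0 fe]|alt] := fxy xy.
  exists (e / 2); first by rewrite /= divr_gt0.
  move=> g /homeo_ballP fg _; left; exists (e / 2); first by rewrite divr_gt0.
  move=> z /fe le; have := close_lt z fg.
  have := ler_distD (\val (g z)) (\val (f z)) (\val z); lra.
case: alt => z1 [z2 [z3 [z4 [zs s1 s2 s3 s4]]]].
pose e := Num.min (Num.min (\val (f z1) - \val z1) (\val z2 - \val (f z2)))
                  (Num.min (\val (f z3) - \val z3) (\val z4 - \val (f z4))).
exists e; first by rewrite /= !lt_min !subr_gt0 -!lt_valE s1 s2 s3 s4.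
move=> g /homeo_ballP; rewrite !lt_min => /andP[/andP[d1 d2] /andP[d3 d4]] _; right.
exists z1, z2, z3, z4; split=> //; rewrite lt_valE.
- by have := close_lt z1 d1; rewrite ltr_norml => /andP[]; lra.
- by have := close_lt z2 d2; rewrite ltr_norml => /andP[]; lra.
- by have := close_lt z3 d3; rewrite ltr_norml => /andP[]; lra.
- by have := close_lt z4 d4; rewrite ltr_norml => /andP[]; lra.
Qed.

(** If [moves] fails, some point of [x, y] is moved arbitrarily little, and [dense_alternates]
    perturbs f there. *)
Lemma good_on_dense x y : dense (good_on x y).
Proof.
move=> O [f Of] Oo; have /nbhs_ballP[e /= e0 Oe] : nbhs f O by exact: open_nbhs_nbhs.
have [fxy|/not_implyP[xy nf]] := pselect (x < y -> moves f x y \/ alternates f x y).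
  by exists f.
have [z zxy fz] : exists2 z, x <= z <= y & `|\val (f z) - \val z| < e / 2.
  apply: contrapT => nz; apply: nf; left; exists (e / 2); first by rewrite divr_gt0.
  by move=> z zxy; rewrite leNgt; apply/negP => lt; apply: nz; exists z.
have e2 : 0 < e / 2 by rewrite divr_gt0.
have [g ag fg] := dense_alternates e2 xy zxy fz.
exists g; split; last by right.
by apply: Oe; apply/homeo_ballP; apply: le_lt_trans (homeo_dist_le fg) _; lra.
Qed.

Definition generic f := forall i j, good_on (dense_pt i) (dense_pt j) f.

Lemma comeager_generic (A : set (homeo01 R)) : generic `<=` A -> comeager A.
Proof.
move=> gA; pose U n : set (homeo01 R) :=
  if unpickle n is Some (i, j) then good_on (dense_pt i) (dense_pt j) else setT.
exists U; split.
  move=> n; rewrite /U; case: unpickle => [[i j]|].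
    by split; [exact: good_on_open|exact: good_on_dense].
  by split; [exact: openT|move=> O [f Of] _; exists f].
move=> f Uf; apply: gA => i j; have := Uf (pickle (i, j)) Logic.I.
by rewrite /U pickleK.
Qed.

(** A fixed point excludes [moves] on any rational interval around it. At 0 and 1 there is no room
    on one side, but these are rational endpoints themselves. *)
Lemma genericP f x y z : generic f -> x < y -> f z = z ->
  x < z \/ x = z /\ z = i0 R -> z < y \/ z = y /\ z = i1 R -> alternates f x y.
Proof.
move=> gf xy fz xz zy.
have [i xi iz] : exists2 i, x <= dense_pt i & dense_pt i <= z /\ (dense_pt i < z \/ z = i0 R).
  case: xz => [/dense_ptP[i ? ?]|[-> ->]].
    by exists i; [exact: ltW|split; [exact: ltW|left]].
  by have [i iE] := dense_pt0; exists i; rewrite iE //; split=> //; right.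
have [j jy zj] : exists2 j, dense_pt j <= y & z <= dense_pt j /\ (z < dense_pt j \/ z = i1 R).
  case: zy => [/dense_ptP[j ? ?]|[<- ->]].
    by exists j; [exact: ltW|split; [exact: ltW|left]].
  by have [j jE] := dense_pt1; exists j; rewrite jE //; split=> //; right.
have ij : dense_pt i < dense_pt j.
  case: iz zj => iz [lt|z0] [zj [lt'|z1]].
  - exact: le_lt_trans lt'.
  - exact: lt_le_trans zj.
  - exact: le_lt_trans lt'.
  - by move: z0; rewrite z1 => /(congr1 val) /=; have := val_i0 R; have := val_i1 R => /= -> -> /eqP; rewrite oner_eq0.
case: (gf i j ij) => [[e e0 /(_ z)]|[z1 [z2 [z3 [z4 [[a1 a2 a3 a4 a5] s1 s2 s3 s4]]]]]].
  by case: iz zj => -> _ [-> _] /(_ isT); rewrite fz subrr normr0 leNgt e0.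
exists z1, z2, z3, z4; split=> //; split=> //.
  exact: le_lt_trans a1.
exact: lt_le_trans jy.
Qed.

End Density.

(** * Orbitals and conjugacy *)

Section Orbits.
Variable R : realType.
Local Notation I := (unit_interval R).
Implicit Types (x y z a b s t : I) (f g h : homeo01 R) (k l : int).

Definition zpow f k x : I :=
  match k with Posz n => iter n f x | Negz n => iter n.+1 (homeo_inv f) x end.

Lemma zpowS f k x : zpow f (k + 1) x = f (zpow f k x).
Proof.
case: k => [n|[|n]]; first by rewrite -PoszD addn1.
  by rewrite /= homeoVK.
have -> : Negz n.+1 + 1 = Negz n by rewrite !NegzE; lia.
by rewrite /= homeoVK.
Qed.

Lemma zpowB f k x : zpow f (k - 1) x = homeo_inv f (zpow f k x).
Proof. by rewrite -[in RHS](subrK 1 k) zpowS /= homeoK. Qed.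

Lemma zpowD f k l x : zpow f (k + l) x = zpow f k (zpow f l x).
Proof.
elim/int_rect: k => [|n IH|n IH]; first by rewrite add0r.
  by rewrite -addn1 PoszD addrAC !zpowS IH.
by rewrite -addn1 PoszD opprD addrAC !zpowB IH.
Qed.

Lemma zpow1 f x : zpow f 1 x = f x. Proof. by []. Qed.

Lemma zpowKN f k x : zpow f k (zpow f (- k) x) = x.
Proof. by rewrite -zpowD subrr. Qed.

Lemma zpow_lt f k x y : (zpow f k x < zpow f k y) = (x < y).
Proof.
have it h n : (iter n h x < iter n h y) = (x < y).
  by elim: n => //= n IH; rewrite homeo_lt.
by case: k => n; exact: it.
Qed.

Lemma zpow_le f k x y : (zpow f k x <= zpow f k y) = (x <= y).
Proof. by rewrite !leNgt zpow_lt. Qed.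

Lemma homeo_invK f : homeo_inv (homeo_inv f) = f.
Proof. exact: (@invgK (homeo01 R) f). Qed.

Lemma zpowV f k x : zpow (homeo_inv f) k x = zpow f (- k) x.
Proof.
elim/int_rect: k => [//|n IH|n IH].
  by rewrite -addn1 PoszD zpowS IH opprD zpowB.
rewrite -addn1 PoszD opprD zpowB IH homeo_invK.
have -> : - (- n%:Z - 1) = - - n%:Z + 1 by lia.
by rewrite zpowS.
Qed.

Definition below f a b := forall k, zpow f k a < b.

Lemma below_lt f a b : below f a b -> a < b. Proof. exact: (fun H => H 0). Qed.

Lemma belowV f a b : below (homeo_inv f) a b <-> below f a b.
Proof.
by split=> ab k; have := ab (- k); rewrite zpowV // opprK.
Qed.

(* x and a lie in the same orbital: the orbit of each is not on one side of the
   other. *)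
Definition orb f a x := ~ below f a x /\ ~ below f x a.

Lemma orbV f a x : orb (homeo_inv f) a x <-> orb f a x.
Proof. by rewrite /orb !belowV. Qed.

Lemma not_below f a b : ~ below f a b -> exists k, b <= zpow f k a.
Proof. by move=> /existsNP[k /negP]; rewrite -leNgt; exists k. Qed.

Lemma orb_below f a x b : orb f a x -> below f a b -> below f x b.
Proof.
move=> [/not_below[k xk] _] ab j; apply: le_lt_trans (ab (j + k)).
by rewrite zpowD zpow_le.
Qed.

Lemma below_orb f a x b : orb f a x -> below f b a -> below f b x.
Proof.
move=> [_ /not_below[k ak]] ba j; rewrite -(zpow_lt f k) -zpowD.
exact: lt_le_trans ak.
Qed.

Lemma orb_refl f a : orb f a a.
Proof. by split=> /below_lt; rewrite ltxx. Qed.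

Section Positive.
Variables (f : homeo01 R) (a : I).
Hypothesis fa : a < f a.

Lemma zpow_incr k (n : nat) : zpow f k a <= zpow f (k + n%:Z) a.
Proof.
elim: n => [|n IH]; first by rewrite addr0.
apply: le_trans IH _; rewrite -addn1 PoszD addrA (zpowD f _ 1) zpow1.
by rewrite zpow_le ltW.
Qed.

Lemma zpow_le_exp k l : k <= l -> zpow f k a <= zpow f l a.
Proof.
by move=> kl; have := zpow_incr k `|l - k|%N; rewrite gez0_abs ?subr_ge0 // addrCA subrr addr0.
Qed.

Lemma orbP x : orb f a x <-> exists k, zpow f k a <= x < zpow f (k + 1) a.
Proof.
split; last first.
  move=> [k /andP[k1 k2]]; split=> H.
    by have := H (k + 1) => /(lt_trans k2); rewrite ltxx.
  have := H (- k); rewrite -(zpow_lt f k) zpowKN => /(le_lt_trans k1).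
  by rewrite ltxx.
move=> [/not_below[l xl] /not_below[m am]].
have lo : zpow f (- m) a <= x by rewrite -(zpow_le f m) zpowKN.
have hi : x < zpow f (l + 1) a.
  by apply: (le_lt_trans xl); rewrite zpowD zpow_lt zpow1.
have ex : exists n : nat, x < zpow f (- m + n%:Z) a.
  exists (absz (l + 1 + m)); apply: (lt_le_trans hi); apply: zpow_le_exp.
  have := lez_abs (l + 1 + m); lia.
case: (ex_minnP ex) => [[|n]] nx nmin.
  by move: nx; rewrite addr0 => /(le_lt_trans lo); rewrite ltxx.
exists (- m + n%:Z); rewrite -addrA -PoszD addn1 nx andbT leNgt; apply/negP => /nmin.
by rewrite ltnn.
Qed.

End Positive.

(* The affine correspondence between the fundamental domains [a, f a) and
   [b, g b). *)
Definition matched f g a b s t :=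
  [/\ a <= s < f a, b <= t < g b &
   (\val t - \val b) * (\val (f a) - \val a) = (\val s - \val a) * (\val (g b) - \val b)].

Lemma matched_sym f g a b s t : matched f g a b s t -> matched g f b a t s.
Proof. by case=> *; split. Qed.

Lemma matched_lt f g a b s t s' t' : a < f a -> b < g b ->
  matched f g a b s t -> matched f g a b s' t' -> s < s' -> t < t'.
Proof.
move=> fa gb [_ _ e] [_ _ e'] ss'; rewrite ltNge; apply/negP => tt'.
move: fa gb ss' tt' e e'; rewrite !lt_valE !le_valE.
move: (\val a) (\val b) (\val s) (\val t) (\val s') (\val t') (\val (f a)) (\val (g b)).
move=> {a b s t s' t'} a b s t s' t' fa gb h1 h2 h3 h4 e e'.
have p1 : 0 < (s' - s) * (gb - b) by apply: mulr_gt0; lra.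
have p2 : 0 <= (t - t') * (fa - a) by apply: mulr_ge0; lra.
lra.
Qed.

Lemma matched_ex f g a b s : a < f a -> b < g b -> a <= s < f a ->
  exists t, matched f g a b s t.
Proof.
move=> fa gb /andP[as_ sf].
have fa' : 0 < \val (f a) - \val a by rewrite subr_gt0.
have gb' : 0 < \val (g b) - \val b by rewrite subr_gt0.
pose q := (\val s - \val a) / (\val (f a) - \val a).
have q0 : 0 <= q by apply: divr_ge0; [rewrite subr_ge0|exact: ltW].
have q1 : q < 1 by rewrite /q ltr_pdivrMr // mul1r ltrD2r.
pose v := \val b + q * (\val (g b) - \val b).
have v1 : \val b <= v by rewrite /v lerDl mulr_ge0 // ltW.
have v2 : v < \val (g b).
  by rewrite /v -ltrBrDl -[ltRHS]mul1r ltr_pM2r.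
have v01 : 0 <= v <= 1.
  by rewrite (le_trans (val_ge0 b) v1) (ltW (lt_le_trans v2 (val_le1 _))).
exists (clamp v); split; rewrite ?le_valE ?lt_valE ?clampE //.
- by rewrite -le_valE as_.
- by rewrite v1.
- by rewrite /v /q addrAC subrr add0r mulrAC mulfVK // gt_eqF.
Qed.

(** The equivariant extension of [matched] to the whole orbitals of [a] and [b]. *)
Definition orb_rel f g a b x y := exists k s t,
  [/\ matched f g a b s t, x = zpow f k s & y = zpow g k t].

Lemma orb_rel_sym f g a b x y : orb_rel f g a b x y -> orb_rel g f b a y x.
Proof. by move=> [k [s [t [/matched_sym m xE yE]]]]; exists k, t, s. Qed.

Lemma orb_rel_orb f g a b x y : a < f a -> orb_rel f g a b x y -> orb f a x.
Proof.
move=> fa [k [s [t [[/andP[as_ sf] _ _] -> _]]]]; apply/(orbP fa); exists k.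
by rewrite zpow_le as_ zpowD zpow_lt.
Qed.

Lemma orb_rel_lt f g a b x y x' y' : a < f a -> b < g b ->
  orb_rel f g a b x y -> orb_rel f g a b x' y' -> x < x' -> y < y'.
Proof.
move=> fa gb [k [s [t [m -> ->]]]] [k' [s' [t' [m' -> ->]]]].
case: (ltgtP k k') => [lt _|gt|<-]; last first.
- by rewrite !zpow_lt; apply: matched_lt m m'.
- have [/andP[as_ _] _ _] := m; have [/andP[_ sf] _ _] := m'.
  move=> lt; suff : zpow f k' s' < zpow f k s by move=> /(lt_trans lt); rewrite ltxx.
  apply: (@lt_le_trans _ _ (zpow f (k' + 1) a)); first by rewrite zpowD zpow_lt.
  by apply: (@le_trans _ _ (zpow f k a)); [apply: zpow_le_exp => //; lia|rewrite zpow_le].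
- have [_ /andP[_ tg] _] := m; have [_ /andP[bt _] _] := m'.
  apply: (@lt_le_trans _ _ (zpow g (k + 1) b)); first by rewrite zpowD zpow_lt.
  by apply: (@le_trans _ _ (zpow g k' b)); [apply: zpow_le_exp => //; lia|rewrite zpow_le].
Qed.

Lemma orb_rel_ex f g a b x : a < f a -> b < g b -> orb f a x -> exists y, orb_rel f g a b x y.
Proof.
move=> fa gb /(orbP fa)[k /andP[k1 k2]].
have s1 : a <= zpow f (- k) x < f a.
  by rewrite -(zpow_le f k) zpowKN k1 -(zpow_lt f k) zpowKN -[f a]zpow1 -zpowD.
have [t m] := matched_ex fa gb s1.
by exists (zpow g k t), k, (zpow f (- k) x), t; split=> //; rewrite zpowKN.
Qed.

Lemma orb_relS f g a b x y : orb_rel f g a b x y <-> orb_rel f g a b (f x) (g y).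
Proof.
split=> [[k [s [t [m -> ->]]]]|[k [s [t [m xE yE]]]]].
  by exists (k + 1), s, t; split=> //; rewrite zpowS.
by exists (k - 1), s, t; split=> //; rewrite zpowB -?xE -?yE /= homeoK.
Qed.

Definition orb_iso f g a b (Phi : I -> I -> Prop) :=
  [/\ (forall x y, Phi x y -> orb f a x /\ orb g b y),
      (forall x, orb f a x -> exists y, Phi x y),
      (forall y, orb g b y -> exists x, Phi x y),
      (forall x y x' y', Phi x y -> Phi x' y' -> (x < x') = (y < y')) &
      forall x y, Phi x y -> Phi (f x) (g y)].

Definition same_sign f g a b := (a < f a /\ b < g b) \/ (f a < a /\ g b < b).

Lemma inv_gt f a : f a < a -> a < homeo_inv f a.
Proof. by move=> fa; rewrite -(homeo_lt f) /= homeoVK. Qed.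

(** The downward case is the upward one for the inverses, which have the same orbitals; equivariance
    is carried back by the converse direction of [orb_relS]. *)
Lemma orb_iso_ex f g a b : same_sign f g a b -> exists Phi, orb_iso f g a b Phi.
Proof.
have iso f' g' : a < f' a -> b < g' b ->
    orb_iso f' g' a b (orb_rel f' g' a b) /\
    forall x y, orb_rel f' g' a b (f' x) (g' y) -> orb_rel f' g' a b x y.
  move=> fa gb; split; last by move=> x y; case: (orb_relS f' g' a b x y) => _; apply.
  split.
  - move=> x y xy; split; first exact: (orb_rel_orb fa xy).
    exact: (orb_rel_orb gb (orb_rel_sym xy)).
  - by move=> x; apply: orb_rel_ex.
  - by move=> y /(orb_rel_ex gb fa)[x /orb_rel_sym]; exists x.
  - move=> x y x' y' xy xy'; apply/idP/idP; first exact: orb_rel_lt xy xy'.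
    by move: xy xy' => /orb_rel_sym xy /orb_rel_sym xy'; apply: orb_rel_lt xy xy'.
  - by move=> x y; case: (orb_relS f' g' a b x y) => + _; apply.
case=> [[fa gb]|[/inv_gt fa /inv_gt gb]].
  by exists (orb_rel f g a b); case: (iso f g fa gb).
have [[p1 p2 p3 p4 p5] p6] := iso _ _ fa gb.
exists (orb_rel (homeo_inv f) (homeo_inv g) a b); split=> //.
- by move=> x y /p1; rewrite !orbV.
- by move=> x /orbV; apply: p2.
- by move=> y /orbV; apply: p3.
- by move=> x y xy; apply: p6; rewrite /= !homeoK.
Qed.

End Orbits.

(** * Back-and-forth between orbitals, and conjugacy of generic homeomorphisms *)

Section BackAndForth.
Variable R : realType.
Local Notation I := (unit_interval R).
Implicit Types (x y z a b : I) (f g h : homeo01 R) (L : seq (I * I)).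

Definition separated f g (p q : I * I) := below f p.1 q.1 /\ below g p.2 q.2.

(** Each pair holds representatives of two matched orbitals; the matching preserves the direction of
    motion and the order of the orbitals. *)
Definition partial_iso f g L :=
  (forall p, p \in L -> same_sign f g p.1 p.2) /\
  forall p q, p \in L -> q \in L -> [\/ p = q, separated f g p q | separated f g q p].

Definition swap (p : I * I) := (p.2, p.1).

Lemma mem_swap L p : (p \in map swap L) = (swap p \in L).
Proof.
by apply/mapP/idP => [[q qL ->]|pL]; [case: q qL|exists (swap p) => //; case: p {pL}].
Qed.

Lemma partial_iso_swap f g L : partial_iso f g L -> partial_iso g f (map swap L).
Proof.
case=> sgn sep; split=> [p|p q]; rewrite !mem_swap.
  by move=> /sgn [[]|[]]; [left|right].
move=> pL qL; case: (sep _ _ pL qL) => [|[]|[]]; last 2 first.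
- by constructor 2.
- by constructor 3.
by case: p q {pL qL} => ? ? [? ?] [-> ->]; constructor 1.
Qed.

(** The supremum of the orbit of [b] is fixed, because g permutes the orbit. *)
Lemma below_sup g b c : below g b c -> exists z, [/\ g z = z, b <= z & z <= c].
Proof.
move=> bc; pose S : set R := [set \val (zpow g k b) | k in [set: int]].
have S0 : S !=set0 by exists (\val b), 0.
have Sub : has_ubound S by exists (\val c) => _ [k _ <-]; rewrite -le_valE ltW.
have s1 : \val b <= sup S by apply: ub_le_sup => //; exists 0.
have s2 : sup S <= \val c by apply: ge_sup => // _ [k _ <-]; rewrite -le_valE ltW.
have z01 : 0 <= sup S <= 1.
  by rewrite (le_trans (val_ge0 b) s1) (le_trans s2) ?val_le1.
pose z : I := clamp (sup S); have zE : \val z = sup S by rewrite /z clampE.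
have lez k : zpow g k b <= z by rewrite le_valE zE; apply: ub_le_sup => //; exists k.
have zle u : (forall k, zpow g k b <= u) -> z <= u.
  by move=> ku; rewrite le_valE zE; apply: ge_sup => // _ [k _ <-]; apply: ku.
exists z; split; [|by rewrite le_valE zE|by rewrite le_valE zE].
apply/eqP; rewrite eq_le; apply/andP; split; last first.
  apply: zle => k; have := lez (k - 1); rewrite zpowB -(homeo_le g) /=.
  by rewrite homeoVK.
rewrite -[leRHS](homeoVK g) homeo_le; apply: zle => k.
by rewrite -(homeo_le g) homeoVK; have := lez (k + 1); rewrite zpowS.
Qed.

Lemma list_max (s : seq I) : exists c, (forall y, y \in s -> y <= c) /\ (c = i0 R \/ c \in s).
Proof.
elim: s => [|y s [c [cmax cs]]]; first by exists (i0 R); split=> //; left.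
have [yc|cy] := leP y c.
  exists c; split=> [z|]; first by rewrite inE => /predU1P[->//|/cmax].
  by case: cs => [|cs]; [left|right; rewrite inE cs orbT].
exists y; split=> [z|]; last by right; rewrite mem_head.
by rewrite inE => /predU1P[->//|/cmax/le_trans]; apply; apply: ltW.
Qed.

Lemma list_min (s : seq I) : exists c, (forall y, y \in s -> c <= y) /\ (c = i1 R \/ c \in s).
Proof.
elim: s => [|y s [c [cmin cs]]]; first by exists (i1 R); split=> //; left.
have [cy|yc] := leP c y.
  exists c; split=> [z|]; first by rewrite inE => /predU1P[->//|/cmin].
  by case: cs => [|cs]; [left|right; rewrite inE cs orbT].
exists y; split=> [z|]; last by right; rewrite mem_head.
by rewrite inE => /predU1P[->//|/cmin]; apply: le_trans; apply: ltW.
Qed.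

(** Backward iterates stay below [z], and forward iterates stay below those of [z'], which
    decrease. *)
Lemma zpow_bound g z z' k : z < z' -> z < g z -> g z' < z' ->
  forall y, y <= z -> zpow g k y < z'.
Proof.
move=> zz' gz gz' y yz; have [k0|k0] := leP 0 k; last first.
  apply: le_lt_trans zz'; apply: (@le_trans _ _ (zpow g k z)); first by rewrite zpow_le.
  by have := zpow_le_exp gz (ltW k0).
apply: (@le_lt_trans _ _ (zpow g k z)); first by rewrite zpow_le.
apply: (@lt_le_trans _ _ (zpow g k z')); first by rewrite zpow_lt.
have := zpow_le_exp (inv_gt gz') (_ : - k <= 0); rewrite zpowV opprK; apply.
by rewrite oppr_le0.
Qed.

Lemma zpow_bound' g z z' k : z < z' -> g z < z -> z' < g z' ->
  forall y, y <= z -> zpow g k y < z'.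
Proof.
move=> zz' gz gz' y yz; rewrite -[k]opprK -zpowV.
apply: (@zpow_bound _ z) => //; first exact: inv_gt.
by rewrite -(homeo_lt g) /= homeoVK.
Qed.

Lemma extend_partial_iso f g L x : partial_iso f g L -> generic g -> f x <> x ->
  exists L', [/\ partial_iso f g L', {subset L <= L'} & exists2 p, p \in L' & orb f p.1 x].
Proof.
move=> [sgn sep] gg fx.
have [[p pL px]|no] := pselect (exists2 p, p \in L & orb f p.1 x).
  by exists L; split=> //; exists p.
have side p : p \in L -> below f p.1 x \/ below f x p.1.
  move=> pL; apply: contrapT => /not_orP[n1 n2].
  by apply: no; exists p.
(* [c] and [d] bound the gap on the side of g in which a partner of [x] must be found; their
   defaults are 0 and 1. *)
have [c [cmax cL]] := list_max [seq p.2 | p <- L & `[< below f p.1 x >]].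
have [d [dmin dL]] := list_min [seq p.2 | p <- L & `[< below f x p.1 >]].
have cmax' p : p \in L -> below f p.1 x -> p.2 <= c.
  by move=> pL px; apply: cmax; apply: map_f; rewrite mem_filter pL andbT; apply/asboolP.
have dmin' p : p \in L -> below f x p.1 -> d <= p.2.
  by move=> pL px; apply: dmin; apply: map_f; rewrite mem_filter pL andbT; apply/asboolP.
have {}cL : c = i0 R \/ exists2 p, p \in L & below f p.1 x /\ c = p.2.
  by case: cL => [|/mapP[p]]; [left|rewrite mem_filter => /andP[/asboolP ? ?] ->; right; exists p].
have {}dL : d = i1 R \/ exists2 p, p \in L & below f x p.1 /\ d = p.2.
  by case: dL => [|/mapP[p]]; [left|rewrite mem_filter => /andP[/asboolP ? ?] ->; right; exists p].
have nonfix p : p \in L -> g p.2 <> p.2.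
  by move=> /sgn[[_ gp]|[_ gp]] e; move: gp; rewrite e ltxx.
(* A fixed point of g in the gap: the supremum of the lower orbit if both bounds come from [L], an
   end of [0,1] otherwise. *)
have [z [gz cz zd cd]] : exists z, [/\ g z = z, c < z \/ c = z /\ z = i0 R,
    z < d \/ z = d /\ z = i1 R & c < d].
  have lt01 : i0 R < i1 R by rewrite lt_valE val_i0 val_i1 ltr01.
  case: cL dL => [->|[p pL [px ->]]] [->|[q qL [xq ->]]].
  - by exists (i0 R); split; rewrite ?homeo_i0 //; [right|left].
  - have q0 : i0 R < q.2.
      by rewrite lt_neqAle i0_le andbT; apply/eqP => e; apply: (nonfix q qL); rewrite -e homeo_i0.
    by exists (i0 R); split; rewrite ?homeo_i0 //; [right|left].
  - have p1 : p.2 < i1 R.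
      by rewrite lt_neqAle i1_ge andbT; apply/eqP => e; apply: (nonfix p pL); rewrite e homeo_i1.
    by exists (i1 R); split; rewrite ?homeo_i1 //; [left|right].
  - have pq : p.1 < q.1 := lt_trans (below_lt px) (below_lt xq).
    case: (sep p q pL qL) => [e|[_ bpq]|[bqp _]].
    + by move: pq; rewrite e ltxx.
    + have [z [gz pz zq]] := below_sup bpq.
      exists z; split=> //; last exact: below_lt.
        left; rewrite lt_neqAle pz andbT; apply/eqP => e; apply: (nonfix p pL); by rewrite e.
      left; rewrite lt_neqAle zq andbT; apply/eqP => e; apply: (nonfix q qL); by rewrite -e.
    + by have := lt_trans pq (below_lt bqp); rewrite ltxx.
have [z1 [z2 [z3 [z4 [[cz1 z12 z23 z34 z4d] s1 s2 s3 s4]]]]] := genericP gg cd gz cz zd.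
(* [z3] is moved up between [z2] and [z4], which are moved down; [z2] is moved down between [z1] and
   [z3], which are moved up. This keeps their orbits apart from [c] and [d]. *)
have [y [ss cy yd]] : exists y, [/\ same_sign f g x y, below g c y & below g y d].
  case: (ltgtP x (f x)) => [lt|gt|e]; last by case: fx.
  - exists z3; split; first by left.
      move=> k; apply: lt_trans z23; apply: (zpow_bound (z := z1)) => //; exact: ltW.
    by move=> k; apply: lt_trans z4d; apply: (zpow_bound (z := z3)).
  - exists z2; split; first by right.
      by move=> k; apply: (zpow_bound (z := z1)) => //; apply: ltW.
    move=> k; apply: (lt_trans _ z4d); apply: (lt_trans _ z34).
    exact: (zpow_bound' (z := z2)).
have new p : p \in L -> separated f g p (x, y) \/ separated f g (x, y) p.
  move=> pL; case: (side p pL) => px; [left|right]; split=> //= k.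
    by apply: le_lt_trans (cy k); rewrite zpow_le; apply: cmax'.
  by apply: lt_le_trans (yd k) _; apply: dmin'.
exists ((x, y) :: L); split.
- split=> [p|p q]; rewrite !inE => /predU1P[->//|pL]; first exact: sgn.
    move=> /predU1P[->|qL]; first by constructor 1.
    by case: (new q qL) => ?; [constructor 3|constructor 2].
  move=> /predU1P[->|qL]; last exact: sep.
  by case: (new p pL) => ?; [constructor 2|constructor 3].
- by move=> p pL; rewrite inE pL orbT.
- by exists (x, y); rewrite ?mem_head //; apply: orb_refl.
Qed.

Lemma extend_partial_iso_both f g L x : partial_iso f g L -> generic f -> generic g ->
  exists L', [/\ partial_iso f g L', {subset L <= L'},
    f x <> x -> exists2 p, p \in L' & orb f p.1 x &
    g x <> x -> exists2 p, p \in L' & orb g p.2 x].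
Proof.
move=> pL gf gg.
have [L1 [pL1 LL1 c1]] : exists L', [/\ partial_iso f g L', {subset L <= L'} &
    f x <> x -> exists2 p, p \in L' & orb f p.1 x].
  have [fx|nfx] := pselect (f x = x); first by exists L; split=> // /(_ fx).
  by have [L' [? ? ?]] := extend_partial_iso pL gg nfx; exists L'.
have [gx|ngx] := pselect (g x = x); first by exists L1; split=> // /(_ gx).
have [L2 [pL2 LL2 [p pL2' px]]] := extend_partial_iso (partial_iso_swap pL1) gf ngx.
exists (map swap L2); split.
- exact: partial_iso_swap.
- by move=> q /LL1 qL; rewrite mem_swap; apply: LL2; rewrite mem_swap; case: q qL.
- move=> /c1[q qL qx]; exists q => //; rewrite mem_swap; apply: LL2.
  by rewrite mem_swap; case: q qL {qx}.
- by move=> _; exists (swap p) => //; rewrite mem_swap; case: p pL2' {px}.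
Qed.

(** The union of a chain of finite matchings, whose step [n] takes care of [dense_pt n] for both f
    and g. *)
Lemma orbital_iso f g : generic f -> generic g -> exists H : I * I -> Prop,
  [/\ (forall p, H p -> same_sign f g p.1 p.2),
      (forall p q, H p -> H q -> [\/ p = q, separated f g p q | separated f g q p]),
      (forall n, f (dense_pt R n) <> dense_pt R n -> exists2 p, H p & orb f p.1 (dense_pt R n)) &
      (forall n, g (dense_pt R n) <> dense_pt R n -> exists2 p, H p & orb g p.2 (dense_pt R n))].
Proof.
move=> gf gg; pose S := {L | partial_iso f g L}.
have line_ext (nL : nat * S) : exists L' : S, [/\ {subset sval nL.2 <= sval L'},
    f (dense_pt R nL.1) <> dense_pt R nL.1 -> exists2 p, p \in sval L' & orb f p.1 (dense_pt R nL.1) &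
    g (dense_pt R nL.1) <> dense_pt R nL.1 -> exists2 p, p \in sval L' & orb g p.2 (dense_pt R nL.1)].
  case: nL => n [L pL]; have [L' [pL' ? ? ?]] := extend_partial_iso_both (dense_pt R n) pL gf gg.
  by exists (exist _ L' pL').
have [E EP] := choice line_ext.
have nil_iso : partial_iso f g [::] by split.
pose fix chain n : S := if n is n'.+1 then E (n', chain n') else exist _ [::] nil_iso.
have mono m n : (m <= n)%N -> {subset sval (chain m) <= sval (chain n)}.
  move=> mn; rewrite -(subnK mn); elim: (n - m)%N => // k IH p /IH pk.
  by case: (EP ((k + m)%N, chain (k + m)%N)) => + _ _; apply.
exists (fun p => exists n, p \in sval (chain n)); split.
- by move=> p [n]; case: (chain n) => L [sgn _] /= /sgn.
- move=> p q [m pm] [n qn].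
  have pM := mono _ _ (leq_maxl m n) _ pm; have qM := mono _ _ (leq_maxr m n) _ qn.
  by case: (chain (maxn m n)) pM qM => L [_ sep] /=; apply: sep.
- move=> n fn; case: (EP (n, chain n)) => _ /(_ fn)[p pE po] _.
  by exists p => //; exists n.+1.
- move=> n gn; case: (EP (n, chain n)) => _ _ /(_ gn)[p pE po].
  by exists p => //; exists n.+1.
Qed.

Lemma relation_homeo (Psi : I -> I -> Prop) :
  (forall x y x' y', Psi x y -> Psi x' y' -> (x < x') = (y < y')) ->
  (forall x x', x < x' -> exists d e, [/\ Psi d e, x < d & d < x']) ->
  (forall y y', y < y' -> exists d e, [/\ Psi d e, y < e & e < y']) ->
  exists h, forall x y, Psi x y -> h x = y.
Proof.
move=> lt dom ran.
have lub (S : I -> Prop) : exists m, (forall y, S y -> y <= m) /\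
    forall u, (forall y, S y -> y <= u) -> m <= u.
  pose T : set R := [set t | t = 0 \/ exists2 y, S y & t = \val y].
  have T0 : T !=set0 by exists 0; left.
  have Tub u : (forall y, S y -> y <= u) -> ubound T (\val u).
    by move=> Su t [->|[y /Su yu ->]]; [exact: val_ge0|rewrite -le_valE].
  have T1 : has_ubound T by exists (\val (i1 R)); apply: Tub => y _; apply: i1_ge.
  have m01 : 0 <= sup T <= 1.
    rewrite ub_le_sup //=; last by left.
    by rewrite -[leRHS](val_i1 R); apply: ge_sup => //; apply: Tub => y _; apply: i1_ge.
  exists (clamp (sup T)); split=> [y Sy|u Su]; rewrite le_valE clampE //.
    by apply: ub_le_sup => //; right; exists y.
  by apply: ge_sup => //; apply: Tub.
(* The extension sends [x] to the supremum of the partners of points up to [x]. *)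
have [F FP] := choice (fun x => lub (fun y => exists2 x', x' <= x & Psi x' y)).
have F_ge x x' y : x' <= x -> Psi x' y -> y <= F x.
  by move=> x'x p; case: (FP x) => + _; apply; exists x'.
have F_le x u : (forall x' y, x' <= x -> Psi x' y -> y <= u) -> F x <= u.
  by move=> xu; case: (FP x) => _; apply => y [x' x'x p]; apply: xu p.
have le x y x' y' : Psi x y -> Psi x' y' -> (x <= x') = (y <= y').
  by move=> p p'; rewrite !leNgt (lt _ _ _ _ p' p).
have FE x y : Psi x y -> F x = y.
  move=> p; apply/eqP; rewrite eq_le (F_ge x x) // andbT.
  by apply: F_le => x' y' x'x p'; rewrite -(le _ _ _ _ p' p).
have F_lt x x' : x < x' -> F x < F x'.
  move=> /dom[d [e [p xd /dom[d' [e' [p' dd' d'x']]]]]].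
  apply: (@le_lt_trans _ _ e).
    by apply: F_le => x1 y1 x1x p1; rewrite -(le _ _ _ _ p1 p) (le_trans x1x) ?ltW.
  apply: (@lt_le_trans _ _ e'); first by rewrite -(lt _ _ _ _ p p').
  by apply: F_ge p'; apply: ltW.
have F_surj y : exists x, F x = y.
  have [x [x_ge x_le]] := lub (fun x => exists2 y', y' <= y & Psi x y').
  exists x; case: (ltgtP (F x) y) => // [/ran|/ran] [d [e [p e1 e2]]].
    have dx : d <= x by apply: x_ge; exists e => //; apply: ltW.
    by have := F_ge _ _ _ dx p; rewrite leNgt e1.
  have xd : x <= d.
    by apply: x_le => x' [y' y'y p']; rewrite (le _ _ _ _ p' p) (le_trans y'y) ?ltW.
  have := F_le x e; rewrite leNgt e2 => H; exfalso; suff: false by []; apply: H => x' y' x'x p'.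
  by rewrite -(le _ _ _ _ p' p) (le_trans x'x).
have [h hF] := mk_homeo F_lt F_surj.
by exists h => x y /FE <-.
Qed.

(** If two rational points in the interval are fixed, f alternates there and moves some [z1] up; a
    rational point between [z1] and its image cannot be fixed. *)
Lemma generic_nonfixed f x y : generic f -> x < y -> exists n,
  [/\ f (dense_pt R n) <> dense_pt R n, x < dense_pt R n & dense_pt R n < y].
Proof.
move=> gf /dense_ptP[i xi iy]; have [j ij jy] := dense_ptP iy.
have [fi|nfi] := pselect (f (dense_pt R i) = dense_pt R i); last by exists i.
have [k ik kj] := dense_ptP ij.
have [fk|nfk] := pselect (f (dense_pt R k) = dense_pt R k); last first.
  by exists k; split; [|exact: lt_trans ik|exact: lt_trans jy].
have [z1 [z2 [z3 [z4 [[a1 a2 a3 a4 a5] s1 _ _ _]]]]] := genericP gf ij fk (or_introl ik) (or_introl kj).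
have : z1 < Order.min (f z1) (dense_pt R j).
  by rewrite lt_min s1 (lt_trans a2) // (lt_trans a3) // (lt_trans a4).
move=> /dense_ptP[n zn]; rewrite lt_min => /andP[nf nj]; exists n; split.
- move=> e; have : f z1 < f (dense_pt R n) by rewrite homeo_lt.
  by rewrite e => /lt_trans/(_ nf); rewrite ltxx.
- exact: lt_trans xi (lt_trans a1 zn).
- exact: lt_trans jy.
Qed.

Lemma generic_conjugate f g : generic f -> generic g ->
  exists h, forall x, h (f x) = g (h x).
Proof.
move=> gf gg; have [H [sgn sep covf covg]] := orbital_iso gf gg.
have iso (p : {p | H p}) : exists Phi, orb_iso f g (sval p).1 (sval p).2 Phi.
  by case: p => p Hp; apply: orb_iso_ex; apply: sgn.
have [Phi PhiP] := choice iso.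
pose Psi x y := exists p : {p | H p}, Phi p x y.
have lt1 x y x' y' : Psi x y -> Psi x' y' -> x < x' -> y < y'.
  move=> [p xy] [q xy'] xx'; have [o1 _ _ o4 _] := PhiP p; have [o1' _ _ _ _] := PhiP q.
  case: (sep _ _ (svalP p) (svalP q)) => [e|[sf sg]|[sf sg]].
  - have pq : p = q by apply: eq_sig_hprop => // ? ? ?; exact: Prop_irrelevance.
    by subst q; rewrite -(o4 _ _ _ _ xy xy').
  - have [_ oy] := o1 _ _ xy; have [_ oy'] := o1' _ _ xy'.
    exact: below_lt (below_orb oy' (orb_below oy sg)).
  - have [ox _] := o1 _ _ xy; have [ox' _] := o1' _ _ xy'.
    by have := lt_trans xx' (below_lt (below_orb ox (orb_below ox' sf))); rewrite ltxx.
have lt2 x y x' y' : Psi x y -> Psi x' y' -> y < y' -> x < x'.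
  move=> [p xy] [q xy'] yy'; have [o1 _ _ o4 _] := PhiP p; have [o1' _ _ _ _] := PhiP q.
  case: (sep _ _ (svalP p) (svalP q)) => [e|[sf sg]|[sf sg]].
  - have pq : p = q by apply: eq_sig_hprop => // ? ? ?; exact: Prop_irrelevance.
    by subst q; rewrite (o4 _ _ _ _ xy xy').
  - have [ox _] := o1 _ _ xy; have [ox' _] := o1' _ _ xy'.
    exact: below_lt (below_orb ox' (orb_below ox sf)).
  - have [_ oy] := o1 _ _ xy; have [_ oy'] := o1' _ _ xy'.
    by have := lt_trans yy' (below_lt (below_orb oy (orb_below oy' sg))); rewrite ltxx.
have lt x y x' y' : Psi x y -> Psi x' y' -> (x < x') = (y < y').
  by move=> p p'; apply/idP/idP; [exact: lt1 p p'|exact: lt2 p p'].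
have dom x x' : x < x' -> exists d e, [/\ Psi d e, x < d & d < x'].
  move=> /(generic_nonfixed gf)[n [/covf[p Hp po] xn nx]].
  have [_ /(_ _ po)[e pe] _ _ _] := PhiP (exist _ p Hp).
  by exists (dense_pt R n), e; split=> //; exists (exist _ p Hp).
have ran y y' : y < y' -> exists d e, [/\ Psi d e, y < e & e < y'].
  move=> /(generic_nonfixed gg)[n [/covg[p Hp po] yn ny]].
  have [_ _ /(_ _ po)[d pd] _ _] := PhiP (exist _ p Hp).
  by exists d, (dense_pt R n); split=> //; exists (exist _ p Hp).
have [h hP] := relation_homeo lt dom ran.
exists h => x.
have agree d e : Psi d e -> h (f d) = g (h d).
  move=> p; rewrite (hP _ _ p); apply: hP; case: p => p pde; exists p.
  by case: (PhiP p) => _ _ _ _; apply.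
(* If [k1 x < k2 x], a point d of the dense domain lies between [x] and the preimage of [k2 x] under
   [k1]; then [k2 d = k1 d < k2 x] although [x < d]. *)
have one (k1 k2 : homeo01 R) : (forall d e, Psi d e -> k1 d = k2 d) -> k2 x <= k1 x.
  move=> k12; rewrite leNgt; apply/negP => lt'.
  have : x < homeo_inv k1 (k2 x) by rewrite -(homeo_lt k1) /= homeoVK.
  move=> /dom[d [e [p xd]]]; rewrite -(homeo_lt k1) /= homeoVK (k12 _ _ p).
  by rewrite homeo_lt => /lt_trans/(_ xd); rewrite ltxx.
apply/eqP; rewrite eq_le; apply/andP; split.
  by apply: (one (homeo_comp g h) (homeo_comp h f)) => d e /agree /=.
by apply: (one (homeo_comp h f) (homeo_comp g h)) => d e /agree /=.
Qed.

Theorem comeager_conjugacy_class : exists f : homeo01 R, comeager (conjugacy_class f).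
Proof.
(* Without any generic homeomorphism, the dense open sets have empty
   intersection, so no appeal to Baire's theorem is needed. *)
have [[f gf]|no] := pselect (exists f : homeo01 R, generic f); last first.
  by exists (homeo_id : homeo01 R); apply: comeager_generic => f gf; case: no; exists f.
exists f; apply: comeager_generic => g gg.
have [h hP] := generic_conjugate gf gg.
(* Conjugation by k puts the inverse of k on the left, so the conjugator is the inverse of [h]. *)
exists (homeo_inv h) => //; apply: homeo_eqP => x.
rewrite /conjg; change (homeo_inv (homeo_inv h) (f (homeo_inv h x)) = g x).
by rewrite homeo_invK hP /= homeoVK.
Qed.

End BackAndForth.

Theorem theorem6p17 (R : realType) :
  (forall F : fraisse_sequence, weak_m_amalgamation (I_digraphs F)) /\
  (exists f : homeo01 R, comeager (conjugacy_class f)).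
Proof.
by split; [exact: weak_m_amalgamation_digraphs|exact: comeager_conjugacy_class].
Qed.
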